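(* Let $k\ge 1$ be a fixed integer. For the random key graph $G(n,X_n,Y_n)$ let $q_n$ denote its edge probability, and define the sequence $\alpha_n$ by $$q_n=\frac{\ln n+(k-1)\ln\ln n+\alpha_n}{n}.$$ Suppose $X_n\ge 2$ for all $n$ sufficiently large. Then $$\lim_{n\to\infty}\mathbb{P}[G(n,X_n,Y_n)\text{ is $k$-connected}]=\lim_{n\to\infty}\mathbb{P}[G(n,X_n,Y_n)\text{ has minimum degree at least }k]$$ and this common limit equals $0$ if $\lim_{n\to\infty}\alpha_n=-\infty$; equals $1$ if $\lim_{n\to\infty}\alpha_n=\infty$; and equals $\exp\!\big(-\frac{e^{-\alpha^*}}{(k-1)!}\big)$ if $\lim_{n\to\infty}\alpha_n=\alpha^*\in(-\infty,\infty)$.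
   Context: The random key graph $G(n,X_n,Y_n)$ (with $1\le X_n\le Y_n$ integers depending on $n$) has node set $\{v_1,\dots,v_n\}$; each node $v_i$ is independently assigned a set $S_i$ of $X_n$ distinct objects chosen uniformly at random among all $X_n$-element subsets of a pool of $Y_n$ objects; an undirected edge joins $v_i$ and $v_j$ ($i\ne j$) iff $S_i\cap S_j\neq\emptyset$. The edge probability is $q_n=1-\binom{Y_n-X_n}{X_n}/\binom{Y_n}{X_n}$. A graph is $k$-connected if it remains connected after deletion of any at most $k-1$ nodes (equivalently, every pair of nodes is joined by $k$ internally disjoint paths). All limits are as $n\to\infty$; $\ln$ is the natural logarithm. *)

(* Defs.v *)
From Stdlib Require Export Reals.
From mathcomp Require Export all_boot.
Set Implicit Arguments.
Unset Strict Implicit.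
Unset Printing Implicit Defensive.

Definition key_assign (n Y : nat) := {ffun 'I_n -> {set 'I_Y}}.

Definition valid_assign (n X Y : nat) (f : key_assign n Y) : bool :=
  [forall i, #|f i| == X].

Definition rkg_adj (n Y : nat) (f : key_assign n Y) : rel 'I_n :=
  fun i j => (i != j) && (f i :&: f j != set0).

Definition connected_on (n : nat) (e : rel 'I_n) (V : {set 'I_n}) : bool :=
  [forall u in V, forall v in V,
     connect (fun a b => [&& a \in V, b \in V & e a b]) u v].

Definition k_connected (n : nat) (e : rel 'I_n) (k : nat) : bool :=
  [forall S : {set 'I_n}, (#|S| < k)%N ==> connected_on e (~: S)].

Definition min_degree_ge (n : nat) (e : rel 'I_n) (k : nat) : bool :=
  [forall i, (k <= #|[set j | e i j]|)%N].

Definition rkg_prob (n X Y : nat) (P : key_assign n Y -> bool) : R :=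
  Rdiv (INR #|[set f : key_assign n Y | valid_assign X f && P f]|)
       (INR #|[set f : key_assign n Y | valid_assign X f]|).

Definition edge_prob (X Y : nat) : R :=
  Rminus (IZR 1) (Rdiv (INR 'C(Y - X, X)) (INR 'C(Y, X))).

Definition alpha_seq (k : nat) (X Y : nat -> nat) (n : nat) : R :=
  Rminus (Rminus (Rmult (INR n) (edge_prob (X n) (Y n))) (ln (INR n)))
         (Rmult (Rminus (INR k) (IZR 1)) (ln (ln (INR n)))).

Definition tends_to_plus_infty (u : nat -> R) : Prop :=
  forall M : R, exists N : nat, forall n : nat, (N <= n)%N -> Rlt M (u n).

Definition tends_to_minus_infty (u : nat -> R) : Prop :=
  forall M : R, exists N : nat, forall n : nat, (N <= n)%N -> Rlt (u n) M.

Definition prob_kconn (k : nat) (X Y : nat -> nat) (n : nat) : R :=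
  @rkg_prob n (X n) (Y n) (fun f => k_connected (rkg_adj f) k).

Definition prob_mindeg (k : nat) (X Y : nat -> nat) (n : nat) : R :=
  @rkg_prob n (X n) (Y n) (fun f => min_degree_ge (rkg_adj f) k).

(* Main.v *)
(* Write x = X^2/Y, so that q is about x.  If the minimum degree is at least k but
   the graph is not k-connected, fewer than k nodes separate a set A with
   2 <= |A| <= n/2 from the rest.  The number of keys held by A is what matters:
   conditionally on the key sets in A, the remaining nodes are independent, and a
   node avoids a set of u keys with probability at most (1 - 1/Y)^(X u).
   A component of size at most e0 ln n contains an edge whose ends have few
   neighbours outside A; for the other sizes a union bound over A works, where for
   sizes comparable with n one bounds the number of keys of A from below, and for
   very small X one bounds instead the probability that some set of keys splits the
   nodes.  All this is uniform as long as n q lies between ln n - O(1) and a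
   multiple of ln n.  Minimum degree: the l-th factorial moment of the number of
   nodes of degree < k converges to that of a Poisson variable and Bonferroni's
   inequalities give the limit; the second moment method handles alpha -> -oo and
   the first moment method alpha -> +oo.  A too dense graph is compared, in the last
   case, with one having n q of order ln n: splitting every key into m keys can only
   delete edges. *)

Require Import Defs.
From mathcomp Require all_order all_algebra ring lra.
From mathcomp Require Import all_boot Rstruct zify.
From Stdlib Require Import Lra.
Set Implicit Arguments.
Unset Strict Implicit.
Unset Printing Implicit Defensive.

(** For sets A of bounded size r the union bound is not enough: about n^r choices meet a bound of
    order n^(-r). Minimum degree at least k supplies the missing factor by forcing an edge inside A,
    and here X >= 2 is decisive. Two adjacent nodes share a key, so the second one brings only X - 1
    new keys for the others to avoid: a factor of about n^(-(X-1)/X) instead of 1/n, next to ln n /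
    n for the edge itself. For X >= 2 this beats two unrelated nodes by n^(-1/2) ln n at least; for
    X = 1 nothing would be gained. Once r exceeds a multiple of ln n, the union bound yields (c / ln
    n)^r, which is below every power of n, up to r of order n / (ln n)^3, where overlaps between key
    sets stop being negligible. The number of keys of A is handled through th ^ |keys|, since its
    mean is bounded by a product over the nodes of A. In the dense case the splitting factor is an
    integer, so x can be steered only up to a factor 2; this is why the estimates must hold for a
    whole range of n q. *)

Module FiniteProbability.
Import all_order all_algebra ring lra.
Import Order.TTheory GRing.Theory Num.Theory.

(** * Product expectations *)

Section ProductExpectation.
Local Open Scope ring_scope.
Variables (R : realFieldType) (I T : finType).
Implicit Types (w : I -> T -> R) (f : {ffun I -> T}).

Definition pE w (F : {ffun I -> T} -> R) : R :=
  \sum_(f : {ffun I -> T}) (\prod_i w i (f i)) * F f.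

Definition upd f (i : I) (s : T) : {ffun I -> T} :=
  [ffun j => if j == i then s else f j].

Lemma updE f i s j : upd f i s j = if j == i then s else f j.
Proof. by rewrite ffunE. Qed.

Lemma upd_same f i s : upd f i s i = s.
Proof. by rewrite updE eqxx. Qed.

Lemma upd_neq f i s j : j != i -> upd f i s j = f j.
Proof. by rewrite updE => /negPf->. Qed.

Lemma updK f i s : upd (upd f i s) i (f i) = f.
Proof. by apply/ffunP => j; rewrite !updE; case: eqP => // ->. Qed.

Lemma prod_upd w f i s :
  (\prod_j w j (upd f i s j)) * w i (f i) = (\prod_j w j (f j)) * w i s.
Proof.
rewrite [in LHS](bigD1 i) //= [in RHS](bigD1 i) //= upd_same.
rewrite (eq_bigr (fun j => w j (f j))) => [|j ne_ji]; first by ring.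
by rewrite upd_neq.
Qed.

(** Resampling one coordinate leaves an expectation unchanged. This is the substitute for
    conditioning on all other coordinates. *)
Lemma pE_upd w i (F : {ffun I -> T} -> R) : \sum_s w i s = 1 ->
  pE w F = pE w (fun f => \sum_s w i s * F (upd f i s)).
Proof.
move=> w1; symmetry; rewrite /pE.
under eq_bigr do rewrite mulr_sumr.
(* Exchanging the value at [i] with the fresh sample is an involution on pairs, and by [prod_upd] it
   preserves the joint weight. *)
pose h (p : {ffun I -> T} * T) := (upd p.1 i p.2, p.1 i).
have hK : involutive h by case=> f s; rewrite /h /= updK upd_same.
rewrite pair_big /= (reindex_inj (inv_inj hK)) /=.
rewrite -(pair_big xpredT xpredT (fun f s => (\prod_j w j (upd f i s j)) *
   (w i (f i) * F (upd (upd f i s) i (f i))))) /=.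
apply: eq_bigr => f _; under eq_bigr do rewrite updK mulrA prod_upd.
by rewrite -mulr_suml -mulr_sumr w1 mulr1.
Qed.

Lemma eq_pE w F G : F =1 G -> pE w F = pE w G.
Proof. by move=> eqFG; apply: eq_bigr => f _; rewrite eqFG. Qed.

Lemma pE_sum (J : finType) (Q : pred J) w (F : J -> {ffun I -> T} -> R) :
  pE w (fun f => \sum_(j | Q j) F j f) = \sum_(j | Q j) pE w (F j).
Proof. by rewrite exchange_big /=; apply: eq_bigr => f _; rewrite mulr_sumr. Qed.

Lemma pEZ w c F : pE w (fun f => c * F f) = c * pE w F.
Proof. by rewrite /pE mulr_sumr; apply: eq_bigr => f _; rewrite mulrCA. Qed.

Lemma pED w F G : pE w (fun f => F f + G f) = pE w F + pE w G.
Proof. by rewrite /pE -big_split; apply: eq_bigr => f _; rewrite mulrDr. Qed.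

Lemma pE_cst w c : (forall i, \sum_s w i s = 1) -> pE w (fun=> c) = c.
Proof.
move=> w1; rewrite /pE -mulr_suml -(bigA_distr_bigA w).
by rewrite (eq_bigr (fun=> 1)) ?big1 ?mul1r.
Qed.

Lemma le_pE w F G : (forall i s, 0 <= w i s) ->
  (forall f, (forall i, w i (f i) != 0) -> F f <= G f) -> pE w F <= pE w G.
Proof.
move=> w0 leFG; apply: ler_sum => f _.
have [/forallP supp|] := boolP [forall i, w i (f i) != 0].
  by rewrite ler_wpM2l ?prodr_ge0 ?leFG.
rewrite negb_forall => /existsP[i]; rewrite negbK => /eqP wi0.
by rewrite (bigD1 i) //= wi0 !mul0r.
Qed.

Lemma pE_ge0 w F : (forall i s, 0 <= w i s) ->
  (forall f, (forall i, w i (f i) != 0) -> 0 <= F f) -> 0 <= pE w F.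
Proof.
move=> w0 F0; have <- : pE w (fun=> 0) = 0 by rewrite /pE big1 // => f _; rewrite mulr0.
exact: le_pE.
Qed.

(* The functions [h j] may depend on the other coordinates of [f], but neither
   they nor [G] see the coordinates in [B], which are therefore independent. *)
Lemma pE_indep w (B : seq I) G (h : I -> {ffun I -> T} -> T -> R) :
  (forall i, \sum_s w i s = 1) -> uniq B ->
  (forall f j s, j \in B -> G (upd f j s) = G f) ->
  (forall i f j s, i \in B -> j \in B -> h i (upd f j s) =1 h i f) ->
  pE w (fun f => G f * \prod_(j <- B) h j f (f j)) =
  pE w (fun f => G f * \prod_(j <- B) \sum_s w j s * h j f s).
Proof.
move=> w1; elim: B G => [|j B IH] G.
  by move=> _ _ _; apply: eq_pE => f; rewrite !big_nil.
move=> /= /andP[jB uB] Gupd hupd.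
transitivity (pE w (fun f => (G f * \sum_s w j s * h j f s) *
                             \prod_(i <- B) h i f (f i))).
  rewrite (pE_upd _ (w1 j)) [RHS](pE_upd _ (w1 j)); apply: eq_pE => f.
  pose c := G f * \prod_(i <- B) h i f (f i).
  have prodB s : \prod_(i <- B) h i (upd f j s) (upd f j s i) =
                 \prod_(i <- B) h i f (f i).
    apply: eq_big_seq => i iB; rewrite hupd ?mem_head ?inE ?iB ?orbT //.
    by rewrite upd_neq //; apply: contraNneq jB => <-.
  transitivity (\sum_s w j s * h j f s * c).
    apply: eq_bigr => s _; rewrite Gupd ?mem_head // big_cons prodB.
    by rewrite hupd ?mem_head // upd_same /c; ring.
  transitivity (\sum_s w j s * (c * \sum_s w j s * h j f s)).
    by rewrite -!mulr_suml w1 /c; ring.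
  apply: eq_bigr => s _; rewrite Gupd ?mem_head // prodB.
  have -> : \sum_s' w j s' * h j (upd f j s) s' = \sum_s' w j s' * h j f s'.
    by apply: eq_bigr => s' _; rewrite hupd ?mem_head.
  by rewrite /c; ring.
rewrite IH //.
- by apply: eq_pE => f; rewrite big_cons mulrA.
- move=> f i s iB; rewrite Gupd ?inE ?iB ?orbT //; congr (_ * _).
  by apply: eq_bigr => s' _; rewrite hupd ?inE ?eqxx ?iB ?orbT.
- by move=> i f i' s iB i'B; apply: hupd; rewrite inE ?iB ?i'B orbT.
Qed.

Lemma pE_indep_set w (B : {set I}) G (h : I -> {ffun I -> T} -> T -> R) :
  (forall i, \sum_s w i s = 1) ->
  (forall f j s, j \in B -> G (upd f j s) = G f) ->
  (forall i f j s, i \in B -> j \in B -> h i (upd f j s) =1 h i f) ->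
  pE w (fun f => G f * \prod_(j in B) h j f (f j)) =
  pE w (fun f => G f * \prod_(j in B) \sum_s w j s * h j f s).
Proof.
move=> w1 Gupd hupd; under eq_pE do rewrite -big_enum.
rewrite pE_indep ?enum_uniq //.
- by apply: eq_pE => f; rewrite big_enum.
- by move=> f j s; rewrite mem_enum => /Gupd.
- by move=> i f j s; rewrite !mem_enum => iB jB; apply: hupd.
Qed.

End ProductExpectation.

(** * Uniform random subsets *)

Lemma bin_bin (P K j : nat) : (j <= K)%N -> (K <= P)%N ->
  ('C(P, K) * 'C(K, j) = 'C(P, j) * 'C(P - j, K - j))%N.
Proof.
move=> jK KP; have jP := leq_trans jK KP.
have c0 : (0 < j`! * (K - j)`! * (P - K)`!)%N by rewrite !muln_gt0 !fact_gt0.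
apply/eqP; rewrite -(eqn_pmul2r c0); apply/eqP.
have e1 := bin_fact KP; have e2 := bin_fact jK; have e3 := bin_fact jP.
have KjPj : (K - j <= P - j)%N by rewrite leq_sub2r.
have := bin_fact KjPj; rewrite (_ : P - j - (K - j) = P - K)%N; last by lia.
move=> e4; transitivity (P`!).
  by rewrite -e1 -e2; ring.
by rewrite -e3 -e4; ring.
Qed.

Lemma bin_ratio_le (P t j : nat) : (t <= P)%N ->
  ('C(t, j) * P ^ j <= 'C(P, j) * t ^ j)%N.
Proof.
move=> tP; rewrite -(leq_pmul2r (fact_gt0 j)).
rewrite mulnAC bin_ffact [leqRHS]mulnAC bin_ffact.
elim: j => [|j IH]; first by rewrite !ffactn0.
rewrite !ffactnSr !expnS.
have h : ((t - j) * P <= (P - j) * t)%N by nia.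
have := leq_mul IH h.
by congr (_ <= _)%N; ring.
Qed.

Lemma card_supersets (T : finType) (W : {set T}) (K : nat) : (#|W| <= K)%N ->
  #|[set S : {set T} | (W \subset S) && (#|S| == K)]| = 'C(#|T| - #|W|, K - #|W|).
Proof.
move=> WK; have -> : (#|T| - #|W| = #|~: W|)%N by rewrite [RHS]cardsCs setCK.
rewrite -cards_draws.
rewrite -(card_in_imset (f := fun S => S :\: W) (D := [set S : {set T} | (W \subset S) && (#|S| == K)])).
  apply: eq_card => S; rewrite inE; apply/imsetP/andP => [[S' + ->]|[SW /eqP cS]].
    rewrite inE => /andP[WS' /eqP <-]; split.
      by rewrite subsetE; apply/pred0P => z /=; rewrite !inE; case: (z \in W).
    by rewrite cardsD (setIidPr WS').
  exists (W :|: S).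
    rewrite inE subsetUl cardsU cS.
    have -> : W :&: S = set0.
      by apply/setP => z; rewrite !inE; apply/negP => /andP[zW /(subsetP SW)]; rewrite inE zW.
    by rewrite cards0 subn0 subnKC ?eqxx.
  apply/setP => z; rewrite !inE; case zW: (z \in W) => //=.
  by apply/negP => /(subsetP SW); rewrite inE zW.
move=> S S'; rewrite !inE => /andP[WS _] /andP[WS' _] e; apply/setP => z.
have := congr1 (fun A : {set T} => z \in A) e; rewrite !inE.
by case zW: (z \in W) => //= _; rewrite (subsetP WS) // (subsetP WS').
Qed.

Section Uniform.
Local Open Scope ring_scope.
Variables (R : realFieldType) (T : finType) (K : nat).
Let P := #|T|.
Hypothesis KP : (K <= P)%N.
Implicit Types (S W U : {set T}).

Definition unif S : R := (#|S| == K)%:R / 'C(#|T|, K)%:R.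

Lemma binPK_gt0 : 0 < 'C(P, K)%:R :> R.
Proof. by rewrite ltr0n bin_gt0. Qed.

Lemma unif_ge0 S : 0 <= unif S.
Proof. by rewrite divr_ge0 ?ler0n. Qed.

Lemma unif_neq0 S : unif S != 0 -> #|S| = K.
Proof. by rewrite /unif; case: (#|S| =P K) => // _; rewrite mul0r eqxx. Qed.

Lemma sum_unifE g : \sum_(S : {set T}) unif S * g S = (\sum_(S : {set T} | #|S| == K) g S) / 'C(P, K)%:R.
Proof.
rewrite mulr_suml [RHS]big_mkcond; apply: eq_bigr => S _.
by rewrite /unif; case: eqP => _ /=; rewrite ?mulr0n ?mulr1n ?mul0r ?mul1r 1?mulrC.
Qed.

Lemma sum_unif_pred (Q : pred {set T}) :
  \sum_(S : {set T}) unif S * (Q S)%:R = #|[set S | (Q S) && (#|S| == K)]|%:R / 'C(P, K)%:R.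
Proof.
rewrite sum_unifE; congr (_ / _); rewrite -sum1_card natr_sum.
rewrite big_mkcond [RHS]big_mkcond; apply: eq_bigr => S _; rewrite inE.
by case: (Q S); case: eqP.
Qed.

Lemma sum_unif : \sum_(S : {set T}) unif S = 1.
Proof.
have := sum_unif_pred predT; under eq_bigr do rewrite mulr1.
move=> ->; rewrite (_ : [set S | _] = [set S : {set T} | #|S| == K]).
  by rewrite card_draws divff // gt_eqF // binPK_gt0.
by apply/setP => S; rewrite !inE.
Qed.

Lemma unif_sup W :
  \sum_(S : {set T}) unif S * (W \subset S)%:R = 'C(K, #|W|)%:R / 'C(P, #|W|)%:R.
Proof.
rewrite sum_unif_pred; have [WK|KW] := leqP #|W| K; last first.
  rewrite (bin_small KW) mul0r (_ : [set S | _] = set0) ?cards0 ?mulr0n ?mul0r //.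
  apply/setP => S; rewrite !inE; apply/negP => /andP[/subset_leq_card + /eqP cS].
  by rewrite cS leqNgt KW.
rewrite card_supersets //.
have bPj : 'C(P, #|W|)%:R != 0 :> R by rewrite pnatr_eq0 -lt0n bin_gt0 max_card.
have bPK : 'C(P, K)%:R != 0 :> R by rewrite gt_eqF ?binPK_gt0.
apply: (mulfI bPj); apply: (mulfI bPK).
have := congr1 (fun m => m%:R : R) (bin_bin WK KP); rewrite /= !natrM => e.
transitivity ('C(P, #|W|)%:R * 'C(P - #|W|, K - #|W|)%:R : R); first by field.
by rewrite -e; field.
Qed.

Lemma bin_ratio_leR (t j : nat) : (t <= P)%N -> (j <= P)%N ->
  'C(t, j)%:R / 'C(P, j)%:R <= (t%:R / P%:R) ^+ j :> R.
Proof.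
move=> tP jP; have bPj : 0 < 'C(P, j)%:R :> R by rewrite ltr0n bin_gt0.
have [P0|P0] := posnP P.
  by move: tP jP; rewrite P0 !leqn0 => /eqP-> /eqP->; rewrite !bin0 divr1 expr0.
rewrite expr_div_n ler_pdivrMr // mulrAC ler_pdivlMr ?exprn_gt0 ?ltr0n //.
by rewrite -!natrX -!natrM ler_nat [leqRHS]mulnC bin_ratio_le.
Qed.

Lemma unif_sup_le W :
  \sum_(S : {set T}) unif S * (W \subset S)%:R <= (K%:R / P%:R) ^+ #|W|.
Proof. by rewrite unif_sup bin_ratio_leR ?max_card. Qed.

Lemma sum_by_card (U : {set T}) (psi : nat -> R) :
  \sum_(W : {set T} | W \subset U) psi #|W| =
  \sum_(j < P.+1) 'C(#|U|, j)%:R * psi j.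
Proof.
rewrite (partition_big (fun W : {set T} => inord #|W| : 'I_P.+1) xpredT) //=.
apply: eq_bigr => j _; rewrite -cards_draws -sum1_card natr_sum mulr_suml.
have cW (W : {set T}) : (inord #|W| == j :> 'I_P.+1) = (#|W| == j).
  by rewrite -val_eqE /= inordK // ltnS max_card.
rewrite (eq_bigl (fun W => W \in [set A : {set T} | A \subset U & #|A| == j])).
  by apply: eq_bigr => W; rewrite inE => /andP[_ /eqP->]; rewrite mul1r.
by move=> W; rewrite inE cW.
Qed.

Lemma expr_setD (S U : {set T}) (th : R) : #|S| = K ->
  th ^+ #|S :\: U| =
  \sum_(W : {set T} | W \subset U) (W \subset S)%:R * ((1 - th) ^+ #|W| * th ^+ (K - #|W|)).
Proof.
move=> cS.
(* A point of [S] contributes (1 - th) + th if it lies in [U] and th otherwise; a point outside [S]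
   contributes 1. *)
pose F i := if i \in S :&: U then 1 - th else 0.
pose G i := if i \in S then th else 1.
transitivity (\prod_i (F i + G i)).
  rewrite -prodr_const big_mkcond; apply: eq_bigr => i _.
  by rewrite /F /G !inE; case: (i \in U); case: (i \in S) => /=; ring.
rewrite bigA_distr [RHS]big_mkcond /=; apply: eq_big => // W _.
have [WU|/subsetPn[i iW iU]] := boolP (W \subset U); last first.
  by rewrite (bigD1 i) //= iW /F inE (negPf iU) andbF mul0r.
have [WS|/subsetPn[i iW iS]] := boolP (W \subset S); last first.
  by rewrite (bigD1 i) //= iW /F inE (negPf iS) mul0r mul0r.
rewrite mul1r; transitivity (\prod_(i in W) (1 - th) * \prod_(i in S :\: W) th).
  rewrite [\prod_(i in W) _]big_mkcond [\prod_(i in S :\: W) _]big_mkcond -big_split /=.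
  apply: eq_bigr => i _; rewrite /F /G !inE; case: ifP => iW /=.
    by rewrite (subsetP WU) ?(subsetP WS) // mulr1.
  by case: (i \in S); rewrite mul1r.
by rewrite !prodr_const cardsD (setIidPr WS) cS.
Qed.

(* Sampling without replacement is dominated by sampling with replacement:
   [th ^ |S \ U|] is expanded over the subsets of [S :&: U]. *)
Lemma unif_expr_le (U : {set T}) (th : R) : 0 <= th <= 1 ->
  \sum_(S : {set T}) unif S * th ^+ #|S :\: U| <=
  (th + (1 - th) * (#|U|%:R / P%:R)) ^+ K.
Proof.
move=> /andP[th0 th1]; have nth0 : 0 <= 1 - th by rewrite subr_ge0.
pose phi j := (1 - th) ^+ j * th ^+ (K - j).
have phi0 j : 0 <= phi j by rewrite mulr_ge0 ?exprn_ge0.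
pose psi j := phi j * ('C(K, j)%:R / 'C(P, j)%:R).
have -> : \sum_(S : {set T}) unif S * th ^+ #|S :\: U| =
          \sum_(W : {set T} | W \subset U) psi #|W|.
  transitivity (\sum_(S : {set T}) \sum_(W : {set T} | W \subset U)
      phi #|W| * (unif S * (W \subset S)%:R)).
    apply: eq_bigr => S _; have [u0|/unif_neq0 cS] := eqVneq (unif S) 0.
      by rewrite u0 mul0r big1 // => W _; rewrite mul0r mulr0.
    rewrite (expr_setD _ _ cS) mulr_sumr; apply: eq_bigr => W _.
    by rewrite /phi; ring.
  rewrite exchange_big /=; apply: eq_bigr => W _.
  by rewrite -mulr_sumr unif_sup.
rewrite sum_by_card exprDn.
rewrite [leRHS](big_ord_widen P.+1 (fun i : nat => (th ^+ (K - i) *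
   ((1 - th) * (#|U|%:R / P%:R)) ^+ i) *+ 'C(K, i))) ?ltnS //.
rewrite [leRHS]big_mkcond; apply: ler_sum => j _.
have jP : (j <= P)%N by rewrite -ltnS.
rewrite ltnS /psi; case: (leqP j K) => [jK|Kj]; last by rewrite (bin_small Kj) mul0r !mulr0.
have := bin_ratio_leR (max_card U) jP => h.
have c0 : 0 <= phi j * 'C(K, j)%:R by rewrite mulr_ge0.
rewrite exprMn -mulr_natr; have := ler_wpM2l c0 h; rewrite /phi.
set z := (#|U|%:R / P%:R) ^+ j; set b := 'C(P, j)%:R^-1.
by congr (_ <= _); ring.
Qed.

Definition missp (U : {set T}) : R :=
  \sum_(S : {set T}) unif S * (S :&: U == set0)%:R.
Definition hitp (U : {set T}) : R :=
  \sum_(S : {set T}) unif S * (S :&: U != set0)%:R.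

Lemma hitpE U : hitp U = 1 - missp U.
Proof.
rewrite -sum_unif -sumrB; apply: eq_bigr => S _.
by case: eqP => _ /=; ring.
Qed.

Lemma missp_ge0 U : 0 <= missp U.
Proof. by apply: sumr_ge0 => S _; rewrite mulr_ge0 ?unif_ge0. Qed.

Lemma hitp_ge0 U : 0 <= hitp U.
Proof. by apply: sumr_ge0 => S _; rewrite mulr_ge0 ?unif_ge0. Qed.

Lemma missp_card U : missp U = 'C(P - #|U|, K)%:R / 'C(P, K)%:R.
Proof.
rewrite /missp (sum_unif_pred (fun S => S :&: U == set0)); congr (_%:R / _).
have -> : (P - #|U| = #|~: U|)%N by rewrite [RHS]cardsCs setCK.
rewrite -cards_draws; apply: eq_card => S; rewrite !inE.
by rewrite setI_eq0 disjoints_subset.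
Qed.

(** The case th = 0 of [unif_expr_le]: since 0 ^ 0 = 1, the power becomes the indicator of
    [S \subset U]. *)
Lemma unif_subset_le (U : {set T}) :
  \sum_(S : {set T}) unif S * (S \subset U)%:R <= (#|U|%:R / P%:R) ^+ K.
Proof.
have := @unif_expr_le U 0; rewrite lexx ler01 => /(_ isT).
rewrite add0r subr0 mul1r; congr (_ <= _); apply: eq_bigr => S _.
by rewrite expr0n cards_eq0 setD_eq0.
Qed.

Lemma missp_le U : missp U <= (1 - #|U|%:R / P%:R) ^+ K.
Proof.
have [P0|P0] := posnP P.
  have K0 : K = 0%N by apply/eqP; rewrite -leqn0 -P0.
  rewrite K0 expr0 -sum_unif; apply: ler_sum => S _.
  by rewrite ler_piMr ?unif_ge0 // lern1 leq_b1.
have := unif_subset_le (~: U); rewrite (_ : #|~: U|%:R / P%:R = 1 - #|U|%:R / P%:R).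
  congr (_ <= _); apply: eq_bigr => S _.
  by rewrite -disjoints_subset setI_eq0.
have -> : P%:R = #|U|%:R + #|~: U|%:R :> R by rewrite -natrD cardsC.
have : (#|U|%:R + #|~: U|%:R : R) != 0 by rewrite -natrD cardsC pnatr_eq0 -lt0n.
by move=> ?; field.
Qed.

(** Bernoulli's inequality. The exponent is now linear in |U|, so the probability that many nodes
    avoid [U] takes the form th ^ |U|, which [unif_expr_le] can average. *)
Lemma missp_le_exp U : missp U <= (1 - P%:R^-1) ^+ (K * #|U|).
Proof.
have [P0|P0] := posnP P.
  have K0 : K = 0%N by apply/eqP; rewrite -leqn0 -P0.
  by apply: le_trans (missp_le U) _; rewrite K0.
apply: le_trans (missp_le U) _; rewrite mulnC exprM.
have uP : #|U|%:R / P%:R <= 1 :> R by rewrite ler_pdivrMr ?ltr0n // mul1r ler_nat max_card.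
rewrite lerXn2r ?nnegrE ?subr_ge0 ?exprn_ge0 //.
  by rewrite subr_ge0 invf_le1 ?ltr0n // ler1n.
have P1 : P%:R^-1 <= 1 :> R by rewrite invf_le1 ?ltr0n // ler1n.
elim: #|U| => [|u IH]; first by rewrite mul0r subr0 expr0.
have p0 : 0 <= P%:R^-1 :> R by rewrite invr_ge0.
rewrite exprS; apply: le_trans (ler_wpM2l _ IH); last by rewrite subr_ge0.
rewrite -[u.+1]addn1 natrD; have u0 : 0 <= u%:R :> R by [].
by set p := P%:R^-1 in P1 p0 *; nra.
Qed.

(* Hitting the pairwise disjoint sets [U i] needs one new point in each. *)
Lemma unif_hits_le (J : eqType) (h : seq J) (U : J -> {set T}) (W : {set T}) :
  uniq h -> (forall i j, i \in h -> j \in h -> i != j -> [disjoint U i & U j]) ->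
  (forall i, i \in h -> [disjoint W & U i]) ->
  \sum_(S : {set T}) unif S * ((W \subset S)%:R * \prod_(i <- h) (S :&: U i != set0)%:R) <=
  (K%:R / P%:R) ^+ #|W| * \prod_(i <- h) (#|U i|%:R * (K%:R / P%:R)).
Proof.
elim: h W => [|i h IH] W.
  move=> _ _ _; rewrite big_nil mulr1; under eq_bigr do rewrite big_nil mulr1.
  exact: unif_sup_le.
move=> /= /andP[ih uh] dU dW; rewrite big_cons.
have step (S : {set T}) : (S :&: U i != set0)%:R <= \sum_(t in U i) (t \in S)%:R :> R.
  case: set0Pn => [[t]|] /=; last by rewrite sumr_ge0.
  rewrite inE => /andP[tS tU]; rewrite (bigD1 t) //= tS lerDl.
  by rewrite sumr_ge0.
apply: (@le_trans _ _ (\sum_(t in U i) \sum_(S : {set T})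
   unif S * (((t |: W) \subset S)%:R * \prod_(i <- h) (S :&: U i != set0)%:R))).
  rewrite exchange_big /=; apply: ler_sum => S _; rewrite -mulr_sumr.
  rewrite ler_wpM2l ?unif_ge0 // big_cons -mulr_suml mulrA.
  rewrite ler_wpM2r ?prodr_ge0 //.
  apply: le_trans (ler_wpM2l _ (step S)) _ => //.
  rewrite mulr_sumr; apply: ler_sum => t _; rewrite subUset sub1set.
  by rewrite -natrM mulnb andbC.
have -> : (K%:R / P%:R) ^+ #|W| *
    (#|U i|%:R * (K%:R / P%:R) * \prod_(j <- h) (#|U j|%:R * (K%:R / P%:R))) =
    \sum_(t in U i) (K%:R / P%:R) ^+ #|W|.+1 * \prod_(j <- h) (#|U j|%:R * (K%:R / P%:R)) :> R.
  by rewrite sumr_const -mulr_natl exprS; ring.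
apply: ler_sum => t tU; have tW : t \notin W.
  by apply: contraTN tU => /(disjointFr (dW i _)) ->; rewrite ?mem_head.
rewrite (_ : #|W|.+1 = #|t |: W|); last by rewrite cardsU1 tW.
apply: IH => // [j j' jh j'h|j jh].
  by apply: dU; rewrite inE ?jh ?j'h orbT.
rewrite -setI_eq0 setIUl setU_eq0 !setI_eq0 dW ?inE ?jh ?orbT // andbT.
rewrite disjoints1; have := dU i j; rewrite !inE eqxx jh orbT => /(_ isT isT).
have -> : i != j by apply: contraNneq ih => ->.
by move=> /(_ isT)/disjointFr ->.
Qed.

Lemma hitp_le U : hitp U <= #|U|%:R * (K%:R / P%:R).
Proof.
have := @unif_hits_le unit [:: tt] (fun=> U) set0 isT.
rewrite cards0 expr0 mul1r big_seq1 => h; apply: le_trans (h _ _).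
- apply: ler_sum => S _; rewrite big_seq1 sub0set mul1r //.
- by move=> [] [].
- by move=> _ _; rewrite -setI_eq0 set0I.
Qed.

Lemma exprD_sub_le (a b : R) (m : nat) : 0 <= a -> 0 <= b ->
  (a + b) ^+ m - a ^+ m <= m%:R * b * (a + b) ^+ m.-1.
Proof.
move=> a0 b0; elim: m => [|m IH]; first by rewrite !expr0 subrr !mul0r.
have am : a ^+ m <= (a + b) ^+ m by rewrite lerXn2r ?nnegrE ?addr_ge0 // lerDl.
have -> : (a + b) ^+ m.+1 - a ^+ m.+1 = b * a ^+ m + (a + b) * ((a + b) ^+ m - a ^+ m).
  by rewrite !exprS; ring.
have -> : m.+1%:R * b * (a + b) ^+ m = b * (a + b) ^+ m + m%:R * b * (a + b) ^+ m.
  by rewrite -[m.+1]addn1 natrD; ring.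
apply: lerD; first exact: ler_wpM2l.
case: m {am} IH => [|m] IH; first by rewrite !expr0 subrr mulr0 !mul0r.
apply: le_trans (ler_wpM2l _ IH) _; first exact: addr_ge0.
by rewrite /= [in leRHS]exprS mulrCA.
Qed.

(** A set missing [U] has |S \ U| = K, so its share th ^ K * missp is subtracted exactly. What
    remains is (th + y) ^ K - th ^ K and a hitting term, with y = K / P; both carry the factor K y,
    the price of an edge, but only the power K - 1. *)
Lemma unif_hit_expr_le U (th : R) : #|U| = K -> (0 < K)%N -> 0 <= th <= 1 ->
  \sum_(S : {set T}) unif S * ((S :&: U != set0)%:R * th ^+ #|S :\: U|) <=
  2 * (K%:R * (K%:R / P%:R)) * (th + K%:R / P%:R) ^+ K.-1.
Proof.
move=> cU K0 th01; have /andP[th0 th1] := th01.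
set y := K%:R / P%:R.
have y0 : 0 <= y by rewrite divr_ge0.
have -> : \sum_(S : {set T}) unif S * ((S :&: U != set0)%:R * th ^+ #|S :\: U|) =
  \sum_(S : {set T}) unif S * th ^+ #|S :\: U| - th ^+ K * missp U.
  rewrite /missp mulr_sumr -sumrB; apply: eq_bigr => S _.
  have [u0|/unif_neq0 cS] := eqVneq (unif S) 0; first by rewrite u0; ring.
  have [e|_] := eqVneq (S :&: U) set0; last by rewrite /=; ring.
  by rewrite /= cardsD e cards0 subn0 cS; ring.
have -> : missp U = 1 - hitp U by rewrite hitpE; ring.
have h1 : \sum_(S : {set T}) unif S * th ^+ #|S :\: U| <= (th + y) ^+ K.
  apply: le_trans (unif_expr_le U th01) _; rewrite cU -/y lerXn2r ?nnegrE //.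
  - by rewrite addr_ge0 // mulr_ge0 ?subr_ge0.
  - exact: addr_ge0.
  - by rewrite lerD2l ler_piMl // lerBlDr lerDl.
have h2 := hitp_le U; rewrite cU -/y in h2.
have h3 := exprD_sub_le K th0 y0.
have tK : th ^+ K <= (th + y) ^+ K.-1.
  rewrite -[in leLHS](prednK K0) exprS.
  apply: le_trans (ler_piMl _ th1) _; first exact: exprn_ge0.
  by rewrite lerXn2r ?nnegrE ?addr_ge0 // lerDl.
have tK0 : 0 <= th ^+ K by rewrite exprn_ge0.
have Ky : 0 <= K%:R * y by rewrite mulr_ge0.
have h4 : th ^+ K * hitp U <= (th + y) ^+ K.-1 * (K%:R * y).
  by apply: ler_pM => //; apply: hitp_ge0.
set z := (th + y) ^+ K.-1 in h3 h4 tK *; set A := (th + y) ^+ K in h1 h3.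
by set B := th ^+ K in h3 h4 *; set c := K%:R * y in h3 h4 *; lra.
Qed.

End Uniform.

(** * Random key assignments *)

Section RandomAssignment.
Local Open Scope ring_scope.
Variables (R : realFieldType) (I T : finType) (K : nat).
Let P := #|T|.
Hypothesis KP : (K <= P)%N.
Implicit Types (A B D : {set I}) (S U W : {set T}) (f : {ffun I -> {set T}}).

Definition unifE (F : {ffun I -> {set T}} -> R) : R :=
  pE (fun _ : I => unif R K) F.

Lemma unifE_w1 (i : I) : \sum_(S : {set T}) unif R K S = 1.
Proof. exact: sum_unif. Qed.

Lemma unifE_upd i F :
  unifE F = unifE (fun f => \sum_(S : {set T}) unif R K S * F (upd f i S)).
Proof. by rewrite {1}/unifE (pE_upd (i := i)) // sum_unif. Qed.

Lemma le_unifE F G : (forall f, (forall i, #|f i| = K) -> F f <= G f) ->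
  unifE F <= unifE G.
Proof.
move=> FG; apply: le_pE => [i S|f supp]; first exact: unif_ge0.
by apply: FG => i; apply: unif_neq0 (supp i).
Qed.

Lemma unifE_ge0 F : (forall f, (forall i, #|f i| = K) -> 0 <= F f) -> 0 <= unifE F.
Proof.
move=> F0; apply: pE_ge0 => [i S|f supp]; first exact: unif_ge0.
by apply: F0 => i; apply: unif_neq0 (supp i).
Qed.

Lemma unifEZ c F : unifE (fun f => c * F f) = c * unifE F.
Proof. exact: pEZ. Qed.

Lemma unifE_cst c : unifE (fun=> c) = c.
Proof. exact: pE_cst unifE_w1. Qed.

Lemma unifE_union (J : finType) (Q : pred J) (F : J -> pred {ffun I -> {set T}})
    (G : pred {ffun I -> {set T}}) :
  (forall f, (forall i, #|f i| = K) -> G f -> exists2 j, Q j & F j f) ->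
  unifE (fun f => (G f)%:R) <= \sum_(j | Q j) unifE (fun f => (F j f)%:R).
Proof.
move=> GF; rewrite /unifE -pE_sum; apply: le_unifE => f cf.
have [/(GF f cf)[j Qj Fj]|_] := boolP (G f); last exact: sumr_ge0.
by rewrite (bigD1 j) //= Fj lerDl sumr_ge0.
Qed.

Lemma unifE_indep D (G : {ffun I -> {set T}} -> R)
    (h : I -> {ffun I -> {set T}} -> {set T} -> R) :
  (forall f j S, j \in D -> G (upd f j S) = G f) ->
  (forall i f j S, i \in D -> j \in D -> h i (upd f j S) =1 h i f) ->
  unifE (fun f => G f * \prod_(j in D) h j f (f j)) =
  unifE (fun f => G f * \prod_(j in D) \sum_(S : {set T}) unif R K S * h j f S).
Proof. by move=> Gu hu; apply: pE_indep_set => //; apply: unifE_w1. Qed.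

Definition keys f A : {set T} := \bigcup_(i in A) f i.

Lemma keys_upd f A j S : j \notin A -> keys (upd f j S) A = keys f A.
Proof.
move=> jA; apply: eq_bigr => i iA; rewrite upd_neq //.
by apply: contraNneq jA => <-.
Qed.

Lemma keysU1 f i A : keys f (i |: A) = f i :|: keys f A.
Proof.
apply/setP => z; rewrite inE; apply/bigcupP/orP.
  by case=> j; rewrite !inE => /orP[/eqP->|jA zj]; [left|right; apply/bigcupP; exists j].
case=> [zi|/bigcupP[j jA zj]]; first by exists i; rewrite ?inE ?eqxx.
by exists j; rewrite // inE jA orbT.
Qed.

Lemma keys0 f : keys f set0 = set0.
Proof. by rewrite /keys big_set0. Qed.

Lemma card_keys f A : (forall i, #|f i| = K) -> (#|keys f A| <= #|A| * K)%N.
Proof.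
move=> cf; rewrite -sum_nat_const /keys; elim/big_rec2: _ => [|i m B _ IH]; first by rewrite cards0.
by apply: leq_trans (leq_card_setU _ _).1 _; rewrite cf leq_add2l.
Qed.

Lemma keysI_eq0 f A S : (S :&: keys f A == set0) = [forall i in A, S :&: f i == set0].
Proof.
rewrite setI_eq0; apply/idP/forall_inP => [dS i iA|dS].
  by rewrite setI_eq0; apply: disjointWr dS; apply: bigcup_sup iA.
rewrite -setI_eq0 -subset0; apply/subsetP => z; rewrite inE => /andP[zS /bigcupP[i iA zi]].
by rewrite -(eqP (dS i iA)) inE zS zi.
Qed.

(* With [K] = X_n and [P] = Y_n: [yK] is X/Y and [xK] is X^2/Y, an upper bound of the
   edge probability. *)
Definition yK : R := K%:R / P%:R.
Definition xK : R := K%:R * yK.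

Lemma yK_ge0 : 0 <= yK. Proof. by rewrite divr_ge0. Qed.
Lemma xK_ge0 : 0 <= xK. Proof. by rewrite mulr_ge0 ?yK_ge0. Qed.

(** At most r K keys are held so far, so a key of the new node is old with probability at most r K /
    P and otherwise costs a factor th. [G] carries events already fixed, such as an edge inside the
    set. *)
Lemma unifE_grow1 G A i (th : R) (r : nat) : i \notin A -> (#|A| <= r)%N -> 0 <= th <= 1 ->
  (forall f, 0 <= G f) -> (forall f S, G (upd f i S) = G f) ->
  unifE (fun f => G f * th ^+ #|keys f (i |: A)|) <=
  unifE (fun f => G f * th ^+ #|keys f A|) * (th + r%:R * yK) ^+ K.
Proof.
move=> iA Ar th01 G0 Gupd; have /andP[th0 th1] := th01.
rewrite mulrC (unifE_upd i) -unifEZ; apply: le_unifE => f cf.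
pose U := keys f A; have cU : (#|U| <= r * K)%N.
  by apply: leq_trans (card_keys A cf) _; rewrite leq_mul2r Ar orbT.
have -> : \sum_(S : {set T}) unif R K S * (G (upd f i S) * th ^+ #|keys (upd f i S) (i |: A)|) =
    (\sum_(S : {set T}) unif R K S * th ^+ #|S :\: U|) * (G f * th ^+ #|U|).
  rewrite mulr_suml; apply: eq_bigr => S _; rewrite Gupd keysU1 upd_same keys_upd // -/U.
  have -> : #|S :|: U| = (#|S :\: U| + #|U|)%N.
    by rewrite -(cardsID U (S :|: U)) (setIidPr (subsetUr S U)) setDUl setDv setU0 addnC.
  by rewrite exprD; ring.
rewrite ler_wpM2r ?mulr_ge0 ?exprn_ge0 //.
apply: le_trans (unif_expr_le KP U th01) _.
have y0 := yK_ge0; have P0 : 0 <= P%:R^-1 :> R by rewrite invr_ge0.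
have e : #|U|%:R / P%:R <= r%:R * yK.
  by rewrite /yK mulrA -natrM ler_wpM2r // ler_nat.
have e0 : 0 <= #|U|%:R / P%:R :> R by rewrite mulr_ge0.
rewrite lerXn2r ?nnegrE ?addr_ge0 ?mulr_ge0 ?subr_ge0 //.
rewrite lerD2l; apply: le_trans e.
by rewrite ler_piMl // lerBlDr lerDl.
Qed.

Lemma unifE_grow G A B (th : R) (r : nat) : [disjoint A & B] ->
  (#|A| + #|B| <= r)%N -> 0 <= th <= 1 ->
  (forall f, 0 <= G f) -> (forall f i S, i \in B -> G (upd f i S) = G f) ->
  unifE (fun f => G f * th ^+ #|keys f (A :|: B)|) <=
  unifE (fun f => G f * th ^+ #|keys f A|) * (th + r%:R * yK) ^+ (K * #|B|).
Proof.
move=> dAB ABr th01 G0 Gupd; have /andP[th0 _] := th01.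
have [m] := ubnP #|B|; elim: m B dAB ABr Gupd => // m IH B dAB ABr Gupd Bm.
have [->|[i iB]] := set_0Vmem B; first by rewrite setU0 cards0 muln0 expr0 mulr1.
have cB := cardsD1 i B; rewrite iB /= add1n in cB.
have dAB' : [disjoint A & B :\ i].
  by apply: disjointWr dAB; apply: subD1set.
have iA : i \notin A by rewrite (disjointFl dAB iB).
have := IH (B :\ i) dAB'; rewrite cB in ABr Bm *.
move=> {}IH.
have -> : A :|: B = i |: (A :|: (B :\ i)) by rewrite setUCA setD1K.
have cU : (#|A :|: B :\ i| <= r)%N.
  by apply: leq_trans (leq_card_setU _ _).1 _; rewrite (leq_trans _ ABr) // leq_add2l.
have iU : i \notin A :|: B :\ i by rewrite !inE (negPf iA) eqxx.
apply: le_trans (unifE_grow1 iU cU th01 G0 (fun f S => Gupd f i S iB)) _.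
rewrite mulnS exprD mulrA mulrAC ler_wpM2r //.
  by rewrite exprn_ge0 // addr_ge0 // mulr_ge0 ?yK_ge0.
apply: IH => //; first by rewrite (leq_trans _ ABr) // leq_add2l.
by move=> f j S; rewrite inE => /andP[_ /Gupd].
Qed.

Definition noedge f A D := [forall j in D, f j :&: keys f A == set0].

Definition hits f A D := [set j in D | f j :&: keys f A != set0].

(* Bounds the probability that a fixed key belongs to none of the [m] nodes' key sets:
   1 - K/P <= (1 - 1/P)^K. *)
Definition avoid (m : nat) : R := (1 - P%:R^-1) ^+ (K * m).

Lemma avoid_base01 : 0 <= (1 - P%:R^-1 : R) <= 1.
Proof.
have P0 : 0 <= P%:R^-1 :> R by rewrite invr_ge0.
rewrite subr_ge0 lerBlDr lerDl P0 andbT.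
by case: P => [|p]; [rewrite invr0 | rewrite invf_le1 ?ltr0n // ler1n].
Qed.

Lemma avoid01 m : 0 <= avoid m <= 1.
Proof. by have /andP[h0 h1] := avoid_base01; rewrite exprn_ge0 //= exprn_ile1. Qed.

Lemma avoid_le a b : (a <= b)%N -> avoid b <= avoid a.
Proof.
have /andP[h0 h1] := avoid_base01.
by move=> ab; apply: ler_wiXn2l => //; rewrite leq_mul2l ab orbT.
Qed.

Lemma natr_forall D (Q : pred I) : ([forall j in D, Q j])%:R = \prod_(j in D) (Q j)%:R :> R.
Proof.
have [/forall_inP QD|] := boolP [forall j in D, Q j].
  by rewrite big1 // => j /QD ->.
rewrite negb_forall => /existsP[j]; rewrite negb_imply => /andP[jD /negPf Qj].
by rewrite (bigD1 j) //= Qj mul0r.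
Qed.

Lemma missp_exp_le f A D :
  missp R K (keys f A) ^+ #|D| <= avoid #|D| ^+ #|keys f A|.
Proof.
rewrite /avoid -exprM mulnAC exprM lerXn2r ?nnegrE ?missp_ge0 ?missp_le_exp //.
have /andP[+ _] := avoid01 #|keys f A|; by rewrite /avoid.
Qed.

Lemma unifE_noedge_le G A D : [disjoint A & D] ->
  (forall f, 0 <= G f) -> (forall f j S, j \in D -> G (upd f j S) = G f) ->
  unifE (fun f => G f * (noedge f A D)%:R) <=
  unifE (fun f => G f * avoid #|D| ^+ #|keys f A|).
Proof.
move=> dAD G0 Gupd.
have -> : unifE (fun f => G f * (noedge f A D)%:R) =
          unifE (fun f => G f * \prod_(j in D) (f j :&: keys f A == set0)%:R).
  by apply: eq_pE => f; rewrite natr_forall.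
rewrite (unifE_indep (h := fun _ f S => (S :&: keys f A == set0)%:R)) //.
  apply: le_unifE => f _; rewrite prodr_const ler_wpM2l //.
  exact: missp_exp_le.
by move=> i f j S _ jD S'; rewrite keys_upd // (disjointFl dAD jD).
Qed.

(** Averaging over the nodes of [D] leaves th ^ |keys| with th = [avoid]; the set [A] is then built
    up from the empty set by [unifE_grow]. *)
Lemma prob_noedge_le A D : [disjoint A & D] ->
  unifE (fun f => (noedge f A D)%:R) <= (avoid #|D| + #|A|%:R * yK) ^+ (K * #|A|).
Proof.
move=> dAD.
have := @unifE_noedge_le (fun=> 1) A D dAD (fun=> ler01) (fun _ _ _ _ => erefl).
rewrite (_ : unifE (fun f => 1 * _) = unifE (fun f => (noedge f A D)%:R)); last first.
  by apply: eq_pE => f; rewrite mul1r.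
move=> h; apply: le_trans h _.
have d0 : [disjoint set0 & A] by rewrite -setI_eq0 set0I.
have := @unifE_grow (fun=> 1) set0 A (avoid #|D|) #|A| d0.
rewrite cards0 set0U => /(_ (leqnn _) (avoid01 _) (fun=> ler01) (fun _ _ _ _ => erefl)).
rewrite (_ : unifE (fun f => 1 * _ ^+ #|keys f set0|) = 1) ?mul1r // -[RHS](unifE_cst 1).
by apply: eq_pE => f; rewrite keys0 cards0 expr0 mulr1.
Qed.

(** Exponential Markov bound: the indicator of at most m hits is below t ^ (hits - m). A node of [D]
    averages to miss + t hit <= miss (1 + 2 t |A| x), because the hypothesis on |A| x forces miss >=
    1/2. *)
Lemma unifE_hits_le G A D (m : nat) (t : R) : [disjoint A & D] -> 0 < t <= 1 ->
  #|A|%:R * xK <= 2^-1 ->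
  (forall f, 0 <= G f) -> (forall f j S, j \in D -> G (upd f j S) = G f) ->
  unifE (fun f => G f * (#|hits f A D| <= m)%N%:R) <=
  t ^- m * (1 + 2 * #|A|%:R * t * xK) ^+ #|D| *
    unifE (fun f => G f * avoid #|D| ^+ #|keys f A|).
Proof.
move=> dAD /andP[t0 t1] Ax G0 Gupd; have x0 := xK_ge0.
pose h (_ : I) f (S : {set T}) : R := if S :&: keys f A == set0 then 1 else t.
apply: (@le_trans _ _ (t ^- m * unifE (fun f => G f * \prod_(j in D) h j f (f j)))).
  rewrite -unifEZ; apply: le_unifE => f _; rewrite mulrCA ler_wpM2l //.
  have -> : \prod_(j in D) h j f (f j) = t ^+ #|hits f A D|.
    rewrite -prodr_const big_mkcond [RHS]big_mkcond; apply: eq_bigr => j _.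
    by rewrite inE /h; case: (j \in D) => //=; case: eqP.
  have tm : 0 < t ^- m by rewrite invr_gt0 exprn_gt0.
  case: leqP => [hm|_] /=; last by rewrite mulr_ge0 ?ltW // exprn_gt0.
  rewrite mulrC ler_pdivlMr ?exprn_gt0 // mul1r.
  by apply: ler_wiXn2l => //; apply: ltW.
have t0' := ltW t0; rewrite -mulrA ler_wpM2l ?invr_ge0 ?exprn_ge0 //.
rewrite (unifE_indep (h := h)) //; last first.
  by move=> i f j S _ jD S'; rewrite /h keys_upd // (disjointFl dAD jD).
rewrite -unifEZ; apply: le_unifE => f cf; rewrite mulrCA ler_wpM2l //.
under eq_bigr => j _.
  have -> : \sum_(S : {set T}) unif R K S * h j f S =
            missp R K (keys f A) + t * hitp R K (keys f A).
    rewrite /missp /hitp mulr_sumr -big_split; apply: eq_bigr => S _ /=.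
    by rewrite /h; case: eqP => _ /=; ring.
  over.
have hx : hitp R K (keys f A) <= #|A|%:R * xK.
  apply: le_trans (hitp_le R KP _) _; rewrite -/P -/yK /xK mulrA -natrM.
  by rewrite ler_wpM2r ?yK_ge0 // ler_nat card_keys.
have hm := hitpE R KP (keys f A); have h0 := hitp_ge0 R K (keys f A).
have m0 := missp_ge0 R K (keys f A).
rewrite prodr_const mulrC; apply: le_trans (ler_wpM2l _ (missp_exp_le f A D)).
  rewrite -exprMn lerXn2r ?nnegrE //.
  - by rewrite addr_ge0 // mulr_ge0.
  - by rewrite mulr_ge0 // addr_ge0 // mulr_ge0 // mulr_ge0 // mulr_ge0.
  have h1 : t * hitp R K (keys f A) <= t * (#|A|%:R * xK) by rewrite ler_wpM2l.
  set q := hitp R K (keys f A) in hx hm h0 h1 *; set v := missp R K (keys f A) in hm m0 *.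
  have v2 : 2^-1 <= v by lra.
  set c := #|A|%:R * xK in Ax hx h1.
  have -> : 2 * #|A|%:R * t * xK = 2 * (t * c) by rewrite /c; ring.
  have tc : 0 <= t * c by rewrite mulr_ge0 // mulr_ge0.
  by set w := t * c in tc h1 *; nra.
by rewrite exprn_ge0 // addr_ge0 // mulr_ge0 // mulr_ge0 // mulr_ge0.
Qed.

Lemma unifE_edge_le i j (th : R) : i != j -> (0 < K)%N -> 0 <= th <= 1 ->
  unifE (fun f => (f i :&: f j != set0)%:R * th ^+ #|keys f [set i; j]|) <=
  th ^+ K * (2 * xK * (th + yK) ^+ K.-1).
Proof.
move=> ij K0 th01; rewrite (unifE_upd i) -[leRHS]unifE_cst; apply: le_unifE => f cf.
apply: le_trans (_ : th ^+ K * \sum_(S : {set T}) unif R K S *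
    ((S :&: f j != set0)%:R * th ^+ #|S :\: f j|) <= _).
  rewrite mulr_sumr; apply: ler_sum => S _; rewrite [leRHS]mulrCA ler_wpM2l ?unif_ge0 //.
  rewrite upd_same upd_neq 1?eq_sym // keysU1 upd_same keys_upd ?inE //.
  have -> : keys f [set j] = f j by rewrite /keys big_set1.
  rewrite -[in leLHS](cardsID (f j) (S :|: f j)) (setIidPr (subsetUr S (f j))).
  by rewrite setDUl setDv setU0 cf exprD mulrCA.
rewrite ler_wpM2l ?exprn_ge0 //; first by case/andP: th01.
exact: unif_hit_expr_le.
Qed.

(** The pair {i, j} is paid for by [unifE_edge_le]; the other |A| - 2 nodes are then added by
    [unifE_grow], each with a full K-th power. *)
Lemma prob_edge_hits_le i j A D (m : nat) (t : R) :
  [disjoint A & D] -> i \in A -> j \in A -> i != j -> (0 < K)%N -> 0 < t <= 1 ->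
  #|A|%:R * xK <= 2^-1 ->
  unifE (fun f => ((f i :&: f j != set0) && (#|hits f A D| <= m)%N)%:R) <=
  t ^- m * (1 + 2 * #|A|%:R * t * xK) ^+ #|D| *
  (avoid #|D| ^+ K * (2 * xK * (avoid #|D| + yK) ^+ K.-1) *
   (avoid #|D| + #|A|%:R * yK) ^+ (K * (#|A| - 2))).
Proof.
move=> dAD iA jA ij K0 t01 Ax; have /andP[t0 t1] := t01.
have -> : unifE (fun f => ((f i :&: f j != set0) && (#|hits f A D| <= m)%N)%:R) =
    unifE (fun f => (f i :&: f j != set0)%:R * (#|hits f A D| <= m)%N%:R).
  by apply: eq_pE => f; rewrite -natrM mulnb.
have iD : i \notin D by rewrite (disjointFr dAD iA).
have jD : j \notin D by rewrite (disjointFr dAD jA).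
have hh := @unifE_hits_le (fun f => (f i :&: f j != set0)%:R) A D m t dAD t01 Ax.
apply: le_trans (hh _ _) _ => //.
  move=> f l S lD; rewrite !upd_neq //.
    by apply: contraNneq jD => ->.
  by apply: contraNneq iD => ->.
have c0 : 0 <= t ^- m * (1 + 2 * #|A|%:R * t * xK) ^+ #|D|.
  have t0' := ltW t0; have x0 := xK_ge0.
  by rewrite mulr_ge0 ?invr_ge0 ?exprn_ge0 // addr_ge0 // mulr_ge0 // mulr_ge0 // mulr_ge0.
rewrite ler_wpM2l //.
pose B := A :\: [set i; j].
have ijA : [set i; j] \subset A by rewrite subUset !sub1set iA.
have eA : [set i; j] :|: B = A by rewrite -[RHS](setID A [set i; j]) (setIidPr ijA).
have cB : #|B| = (#|A| - 2)%N by rewrite cardsD (setIidPr ijA) cards2 ij.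
have dB : [disjoint [set i; j] & B].
  by rewrite disjoints_subset setCD subsetUr.
have cAB : (#|[set i; j]| + #|B| <= #|A|)%N.
  by rewrite cB cards2 ij /= subnKC // (leq_trans _ (subset_leq_card ijA)) // cards2 ij.
have := @unifE_grow (fun f => (f i :&: f j != set0)%:R) _ _ (avoid #|D|) #|A| dB cAB (avoid01 _).
rewrite eA cB => h; apply: le_trans (h _ _) _ => //.
  move=> f l S; rewrite !inE negb_or => /andP[/andP[li lj] _].
  by rewrite !upd_neq // eq_sym.
rewrite ler_wpM2r ?unifE_edge_le ?avoid01 //.
have /andP[a0 _] := avoid01 #|D|.
by rewrite exprn_ge0 // addr_ge0 // mulr_ge0 ?yK_ge0.
Qed.

End RandomAssignment.

(** * Union bounds over sets of keys *)

Lemma ex_superset (T : finType) (X : {set T}) (u : nat) : (#|X| <= u)%N -> (u <= #|T|)%N ->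
  exists2 U : {set T}, #|U| = u & X \subset U.
Proof.
move=> Xu uT; have : (0 < #|[set S : {set T} | (X \subset S) && (#|S| == u)]|)%N.
  by rewrite card_supersets // bin_gt0 leq_sub2r.
by case/card_gt0P => U; rewrite inE => /andP[XU /eqP cU]; exists U.
Qed.

Lemma ratio_le1 (R : realFieldType) (a b : nat) : (a <= b)%N -> (a%:R / b%:R <= 1 :> R)%R.
Proof.
move=> ab; have [b0|b0] := posnP b; first by rewrite b0 invr0 mulr0.
by rewrite ler_pdivrMr ?ltr0n // mul1r ler_nat.
Qed.

Section Unions.
Local Open Scope ring_scope.
Variables (R : realFieldType) (I T : finType) (K : nat).
Let P := #|T|.
Hypothesis KP : (K <= P)%N.
Implicit Types (A B D : {set I}) (S U W : {set T}) (f : {ffun I -> {set T}}).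
Local Notation unifE := (@unifE R I T K).

Lemma unifE_all (D : {set I}) (Q : I -> pred {set T}) :
  unifE (fun f => ([forall j in D, Q j (f j)])%:R) =
  \prod_(j in D) \sum_(S : {set T}) unif R K S * (Q j S)%:R.
Proof.
rewrite -[RHS](unifE_cst I KP).
transitivity (unifE (fun f => 1 * \prod_(j in D) (Q j (f j))%:R)).
  by apply: eq_pE => f; rewrite mul1r natr_forall.
rewrite (unifE_indep KP (h := fun j _ S => (Q j S)%:R)) //.
by apply: eq_pE => f; rewrite mul1r.
Qed.

Lemma prob_within_le A U :
  unifE (fun f => ([forall a in A, f a \subset U])%:R) <= (#|U|%:R / P%:R) ^+ (K * #|A|).
Proof.
rewrite (unifE_all A (fun _ S => S \subset U)) prodr_const exprM.
rewrite lerXn2r ?nnegrE ?exprn_ge0 ?divr_ge0 //; last exact: unif_subset_le.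
by apply: sumr_ge0 => S _; rewrite mulr_ge0 ?unif_ge0.
Qed.

Lemma prob_few_keys_le A (u : nat) : (u <= P)%N ->
  unifE (fun f => (#|keys f A| <= u)%N%:R) <= 'C(P, u)%:R * (u%:R / P%:R) ^+ (K * #|A|).
Proof.
move=> uP; have h := @unifE_union R I T K {set T} (fun U => #|U| == u)
  (fun U f => [forall a in A, f a \subset U]) (fun f => #|keys f A| <= u)%N.
apply: le_trans (h _) _.
  move=> f _ /ex_superset/(_ uP)[U cU sU]; exists U; first by rewrite cU.
  by apply/forall_inP => a aA; apply: subset_trans sU; apply: bigcup_sup aA.
apply: (@le_trans _ _ (\sum_(U : {set T} | #|U| == u) (u%:R / P%:R) ^+ (K * #|A|))).
  by apply: ler_sum => U /eqP <-; apply: prob_within_le.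
rewrite sumr_const -[leLHS]mulr_natl ler_wpM2r ?exprn_ge0 ?divr_ge0 // ler_nat.
by rewrite -card_draws subset_leq_card //; apply/subsetP => U; rewrite inE.
Qed.

(** For sets [A] too large for the generating function: either all keys of [A] fit into one of the
    u-sets of keys, or every node of [D] avoids more than u keys. *)
Lemma prob_noedge_le2 A D (u : nat) : (u <= P)%N -> [disjoint A & D] ->
  unifE (fun f => (noedge f A D)%:R) <=
  'C(P, u)%:R * (u%:R / P%:R) ^+ (K * #|A|) + (1 - u%:R / P%:R) ^+ (K * #|D|).
Proof.
move=> uP dAD.
apply: (@le_trans _ _ (unifE (fun f => (#|keys f A| <= u)%N%:R) +
  unifE (fun f => (u < #|keys f A|)%N%:R * \prod_(j in D) (f j :&: keys f A == set0)%:R))).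
  rewrite /unifE -pED; apply: le_unifE => // f _; rewrite -natr_forall.
  by rewrite -/(noedge f A D) ltnNge; case: (_ <= _)%N => /=; case: noedge => /=; lra.
apply: lerD; first exact: prob_few_keys_le.
rewrite (unifE_indep KP (h := fun _ f S => (S :&: keys f A == set0)%:R)) //; last 2 first.
- by move=> f j S jD; rewrite keys_upd // (disjointFl dAD jD).
- by move=> i f j S _ jD S'; rewrite keys_upd // (disjointFl dAD jD).
rewrite -[leRHS](unifE_cst I KP); apply: le_unifE => // f _.
have u1 : 0 <= 1 - u%:R / P%:R :> R.
  by rewrite subr_ge0 ratio_le1.
case: ltnP => uk; last by rewrite mul0r exprn_ge0.
rewrite mul1r prodr_const exprM lerXn2r ?nnegrE ?missp_ge0 ?exprn_ge0 //.
apply: le_trans (missp_le R KP _) _.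
rewrite lerXn2r ?nnegrE ?subr_ge0 ?ratio_le1 ?max_card //.
by rewrite lerD2l lerN2 ler_wpM2r ?invr_ge0 // ler_nat ltnW.
Qed.

(** The set cut off does not occur, only the keys [U] that it would hold. Choosing [U] instead of a
    set of nodes is cheaper when the pool is small. *)
Lemma prob_split_le U (S0 : {set I}) :
  unifE (fun f => ([forall j in ~: S0, (f j \subset U) || (f j :&: U == set0)])%:R) <=
  ((#|U|%:R / P%:R) ^+ K + (1 - #|U|%:R / P%:R) ^+ K) ^+ #|~: S0|.
Proof.
rewrite (unifE_all _ (fun _ S => (S \subset U) || (S :&: U == set0))) prodr_const.
have h0 : 0 <= \sum_(S : {set T}) unif R K S * ((S \subset U) || (S :&: U == set0))%:R.
  by apply: sumr_ge0 => S _; rewrite mulr_ge0 ?unif_ge0.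
suff h : \sum_(S : {set T}) unif R K S * ((S \subset U) || (S :&: U == set0))%:R <=
   (#|U|%:R / P%:R) ^+ K + (1 - #|U|%:R / P%:R) ^+ K.
  by rewrite lerXn2r ?nnegrE // (le_trans h0 h).
apply: le_trans (lerD (unif_subset_le R KP U) (missp_le R KP U)).
rewrite /missp -big_split /=; apply: ler_sum => S _; rewrite -mulrDr.
by rewrite ler_wpM2l ?unif_ge0 //; case: (_ \subset _); case: eqP => _ /=; lra.
Qed.

End Unions.

(** * Nodes with pairwise disjoint key sets and prescribed neighbourhoods *)

Section Tuples.
Local Open Scope ring_scope.
Variables (R : realFieldType) (I T : finType) (K : nat).
Let P := #|T|.
Hypothesis KP : (K <= P)%N.
Implicit Types (A B D : {set I}) (S U W : {set T}) (f : {ffun I -> {set T}}).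
Implicit Types (M : {ffun I -> {set I}}).
Local Notation unifE := (@unifE R I T K).
Local Notation xK := (@xK R T K).
Local Notation yK := (@yK R T K).

Definition nb f (i : I) D : {set I} := [set j in D | f j :&: f i != set0].

(** The type [J] varies because the predicate is applied both to key sets and to families of
    neighbourhoods, which are sets of nodes. *)
Definition disj (J : finType) (f : {ffun I -> {set J}}) A :=
  [forall i in A, forall j in A, (i != j) ==> (f i :&: f j == set0)].

Definition qK : R := 1 - 'C(P - K, K)%:R / 'C(P, K)%:R.

Lemma hitp_qK U : #|U| = K -> hitp R K U = qK.
Proof. by move=> cU; rewrite (hitpE _ KP) missp_card cU. Qed.

Lemma disjP (J : finType) (f : {ffun I -> {set J}}) A :
  reflect {in A &, forall i j, i != j -> f i :&: f j = set0} (disj f A).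
Proof.
apply: (iffP forall_inP) => [h i j iA jA ij|h i iA].
  by have /forall_inP/(_ j jA) := h i iA; rewrite ij => /eqP.
by apply/forall_inP => j jA; apply/implyP => ij; rewrite h.
Qed.

Lemma card_keys_disj (J : finType) (f : {ffun I -> {set J}}) A (m : nat) :
  disj f A -> {in A, forall i, #|f i| = m} -> #|keys f A| = (#|A| * m)%N.
Proof.
move=> /disjP dA cf; rewrite -sum_nat_const -(eq_bigr _ cf).
under [RHS]eq_bigr do rewrite -sum1_card big_mkcond.
rewrite exchange_big /= -sum1_card big_mkcond; apply: eq_bigr => z _.
case: ifP => [/bigcupP[i iA zi]|/bigcupP nz].
  rewrite (bigD1 i) //= zi big1 // => j /andP[jA ji].
  case: ifP => // zj; have := dA i j iA jA; rewrite eq_sym => /(_ ji)/setP/(_ z).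
  by rewrite !inE zi zj.
rewrite big1 // => i iA; case: ifP => // zi.
by case: nz; exists i.
Qed.

(** Reads the prescription of the neighbourhoods [M i] node by node over [D], which turns it into a
    product of independent conditions ([matchesP]). *)
Definition matches M A f (j : I) (S : {set T}) :=
  [forall i in A, (S :&: f i != set0) == (j \in M i)].

Lemma disj_upd f A j S : j \notin A -> disj (upd f j S) A = disj f A.
Proof.
move=> jA; apply: eq_forallb => i; case iA: (i \in A) => //=.
apply: eq_forallb => i'; case i'A: (i' \in A) => //=.
by rewrite !upd_neq //; apply: contraNneq jA => <-.
Qed.

Lemma matches_upd M A f j S i : j \notin A -> matches M A (upd f j S) i =1 matches M A f i.
Proof.
move=> jA S'; apply: eq_forallb => i'; case i'A: (i' \in A) => //=.
by rewrite upd_neq //; apply: contraNneq jA => <-.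
Qed.

Lemma matchesP M A D f : {in A, forall i, M i \subset D} ->
  [forall j in D, matches M A f j (f j)] = [forall i in A, M i == nb f i D].
Proof.
move=> MD; apply/forall_inP/forall_inP => [h i iA|h j jD].
  apply/eqP/setP => j; rewrite inE; case jD: (j \in D) => /=.
    by have /forall_inP/(_ i iA)/eqP := h j jD.
  by apply/negP => /(subsetP (MD i iA)); rewrite jD.
by apply/forall_inP => i iA; rewrite (eqP (h i iA)) inE jD eqxx.
Qed.

Lemma prob_matches M A D : [disjoint A & D] ->
  unifE (fun f => (disj f A)%:R * \prod_(j in D) (matches M A f j (f j))%:R) =
  unifE (fun f => (disj f A)%:R *
    \prod_(j in D) \sum_(S : {set T}) unif R K S * (matches M A f j S)%:R).
Proof.
move=> dAD; apply: (unifE_indep KP (h := fun j f S => (matches M A f j S)%:R)).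
  by move=> f j S jD; rewrite disj_upd // (disjointFl dAD jD).
by move=> i f j S _ jD S'; rewrite matches_upd // (disjointFl dAD jD).
Qed.

Lemma sum_card_swap M A D : {in A, forall i, M i \subset D} ->
  (\sum_(j in D) #|[set i in A | j \in M i]| = \sum_(i in A) #|M i|)%N.
Proof.
move=> MD; transitivity (\sum_(j in D) \sum_(i in A | j \in M i) 1)%N.
  by apply: eq_bigr => j _; rewrite -sum1_card; apply: eq_bigl => i; rewrite inE.
rewrite (exchange_big_dep (mem A)) /=; last by move=> j i _ /andP[].
apply: eq_bigr => i iA; rewrite -sum1_card; apply: eq_bigl => j; rewrite iA /=.
by case jM: (j \in M i); rewrite ?andbF // (subsetP (MD i iA)).
Qed.

(** A node of [D] lying in h >= 1 of the sets [M i] must hit h disjoint key sets, with probability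
    at most x ^ h; by double counting these powers multiply to the product over [A]. At most |A| k
    nodes are of this kind, and each remaining one must avoid all |A| K keys. *)
Lemma prob_disj_matches_le M A D (k : nat) : [disjoint A & D] ->
  {in A, forall i, M i \subset D} -> {in A, forall i, (#|M i| < k)%N} ->
  unifE (fun f => (disj f A && [forall i in A, M i == nb f i D])%:R) <=
  (\prod_(i in A) xK ^+ #|M i|) *
    ((1 - P%:R^-1) ^+ (K * (#|A| * K))) ^+ (#|D| - #|A| * k).
Proof.
move=> dAD MD Mk; pose a : R := (1 - P%:R^-1) ^+ (K * (#|A| * K)).
have x0 : 0 <= xK by apply: xK_ge0.
have /andP[a0 a1] : 0 <= a <= 1 := avoid01 R T K _.
have -> : unifE (fun f => (disj f A && [forall i in A, M i == nb f i D])%:R) =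
    unifE (fun f => (disj f A)%:R * \prod_(j in D) (matches M A f j (f j))%:R).
  by apply: eq_pE => f; rewrite -natr_forall (matchesP _ MD) -natrM mulnb.
rewrite prob_matches // -[leRHS](unifE_cst I KP); apply: le_unifE => f cf.
case df: (disj f A); last first.
  rewrite mul0r; apply: mulr_ge0; last exact: exprn_ge0.
  by apply: prodr_ge0 => i _; apply: exprn_ge0.
rewrite mul1r; pose H j := [set i in A | j \in M i].
have cU : #|keys f A| = (#|A| * K)%N by apply: card_keys_disj.
apply: (@le_trans _ _ (\prod_(j in D) (xK ^+ #|H j| * (if H j == set0 then a else 1)))).
  apply: ler_prod => j jD; apply/andP; split.
    by apply: sumr_ge0 => S _; rewrite mulr_ge0 ?unif_ge0.
  case: eqP => Hj.
    rewrite Hj cards0 expr0 mul1r /a -cU; apply: le_trans _ (missp_le_exp R KP (keys f A)).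
    apply: ler_sum => S _; rewrite ler_wpM2l ?unif_ge0 // ler_nat keysI_eq0.
    case: (boolP (matches M A f j S)) => //= /forall_inP mS.
    suff -> : [forall i in A, S :&: f i == set0] by [].
    apply/forall_inP => i iA; rewrite -[_ == _]negbK (eqP (mS i iA)).
    by apply/negP => jM; move/setP/(_ i): Hj; rewrite !inE iA jM.
  have hh := @unif_hits_le R T K KP I (enum (H j)) f set0 (enum_uniq _) _ _.
  rewrite mulr1; apply: le_trans (_ : \sum_(S : {set T}) unif R K S *
    ((set0 \subset S)%:R * \prod_(i <- enum (H j)) (S :&: f i != set0)%:R) <= _); last first.
    apply: le_trans (hh _ _) _.
    - move=> i i'; rewrite !mem_enum !inE => /andP[iA _] /andP[i'A _] ii'.
      by rewrite -setI_eq0 (disjP _ _ df).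
    - by move=> i _; rewrite -setI_eq0 set0I.
    rewrite cards0 expr0 mul1r big_enum /= (eq_bigr (fun=> xK)) ?prodr_const //.
    by move=> i _; rewrite cf.
  apply: ler_sum => S _; rewrite ler_wpM2l ?unif_ge0 // sub0set mul1r.
  case: (boolP (matches M A f j S)) => /= [/forall_inP mS|_]; last exact: prodr_ge0.
  rewrite big_enum /= big1 // => i; rewrite inE => /andP[iA jM].
  by rewrite (eqP (mS i iA)) jM.
rewrite big_split /= ler_pM ?prodr_ge0 //.
- by move=> j _; rewrite exprn_ge0.
- by move=> j _; case: ifP.
- rewrite prodrXr prodrXr.
  have -> : (\sum_(j in D) #|H j| = \sum_(i in A) #|M i|)%N by apply: sum_card_swap.
  exact: lexx.
rewrite -big_mkcondr /= -/a.
rewrite (eq_bigl (fun j => j \in D :\: keys M A)).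
  rewrite prodr_const; apply: ler_wiXn2l => //.
  have := subset_leq_card (subsetIr D (keys M A)); rewrite cardsD.
  have : (#|keys M A| <= #|A| * k)%N.
    rewrite -sum_nat_const /keys; elim/big_rec2: _ => [|i m B iA IH]; first by rewrite cards0.
    by apply: leq_trans (leq_card_setU _ _).1 _; rewrite leq_add // ltnW // Mk.
  by lia.
move=> j; rewrite !inE andbC; case: (j \in D); rewrite ?andbF ?andbT //=.
apply/eqP/negP => [Hj /bigcupP[i iA jM]|nb0].
  by move/setP/(_ i): Hj; rewrite !inE iA jM.
apply/setP => i; rewrite !inE; apply/negP => /andP[iA jM].
by case: nb0; apply/bigcupP; exists i.
Qed.

(** Summing over all families of small neighbourhoods: by distributivity the sum of products over
    [A] is the power of a single sum. *)
Lemma prob_disj_low_le A D (k : nat) : [disjoint A & D] ->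
  unifE (fun f => (disj f A && [forall i in A, #|nb f i D| < k]%N)%:R) <=
  (\sum_(B : {set I} | (B \subset D) && (#|B| < k)%N) xK ^+ #|B|) ^+ #|A| *
    ((1 - P%:R^-1) ^+ (K * (#|A| * K))) ^+ (#|D| - #|A| * k).
Proof.
move=> dAD; pose Q := [pred B : {set I} | (B \subset D) && (#|B| < k)%N].
rewrite -prodr_const (big_distr_big set0) /= mulr_suml.
have hh := @unifE_union R I T K {ffun I -> {set I}} (fun M => M \in pffun_on set0 (mem A) Q)
   (fun M f => disj f A && [forall i in A, M i == nb f i D])
   (fun f => disj f A && [forall i in A, #|nb f i D| < k]%N).
apply: le_trans (hh _) _ => [f cf /andP[df /forall_inP lf]|].
  exists [ffun i => if i \in A then nb f i D else set0]; last first.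
    by rewrite df; apply/forall_inP => i iA; rewrite ffunE iA.
  apply/pfamilyP; split.
    by apply/supportP => i iA; rewrite ffunE (negPf iA).
  move=> i iA; rewrite ffunE iA inE lf // andbT.
  by apply/subsetP => j; rewrite inE => /andP[].
apply: ler_sum => M /pfamilyP[_ MQ].
by apply: prob_disj_matches_le => // i iA; have := MQ i iA; rewrite inE => /andP[].
Qed.


Lemma prob_edge_le i j : i != j ->
  unifE (fun f => (f i :&: f j != set0)%:R) <= xK.
Proof.
move=> ij; rewrite (unifE_upd KP i) -[leRHS](unifE_cst I KP); apply: le_unifE => f cf.
have ji : j != i by rewrite eq_sym.
under eq_bigr do rewrite upd_same upd_neq //.
by apply: le_trans (hitp_le R KP (f j)) _; rewrite cf.
Qed.

Lemma prob_disj_ge A : 1 - (#|A| ^ 2)%:R * xK <= unifE (fun f => (disj f A)%:R).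
Proof.
rewrite lerBlDr -[leLHS](unifE_cst I KP) addrC -lerBlDr.
have h := @unifE_union R I T K (I * I)%type
  (fun p => [&& p.1 \in A, p.2 \in A & p.1 != p.2])
  (fun p f => f p.1 :&: f p.2 != set0) (fun f => ~~ disj f A).
have -> : unifE (fun=> 1) - unifE (fun f => (disj f A)%:R) = unifE (fun f => (~~ disj f A)%:R).
  rewrite -[X in _ - X]mul1r -mulN1r mulrA mulr1 -unifEZ -pED; apply: eq_pE => f.
  by case: disj => /=; ring.
apply: le_trans (h _) _ => [f _|].
  rewrite /disj => /forall_inPn[i iA /forall_inPn[j jA]]; rewrite negb_imply => /andP[ij fij].
  by exists (i, j) => //=; rewrite iA jA.
apply: (@le_trans _ _ (\sum_(p : I * I | (p.1 \in A) && (p.2 \in A)) xK)).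
  rewrite [leLHS]big_mkcond [leRHS]big_mkcond; apply: ler_sum => -[i j] _ /=.
  case: (i \in A); case: (j \in A) => //=; case: eqP => //= [_|/eqP ij]; first exact: xK_ge0.
  exact: prob_edge_le.
rewrite sumr_const -[leLHS]mulr_natl ler_wpM2r ?xK_ge0 // ler_nat.
rewrite (_ : #|_| = (#|A| ^ 2)%N) // expnS expn1 -cardsX.
by apply: eq_card => -[i j]; rewrite !inE.
Qed.

Lemma missp_keys_ge f A : (forall i, #|f i| = K) ->
  1 - #|A|%:R * qK <= missp R K (keys f A).
Proof.
move=> cf; have := hitpE R KP (keys f A).
have : hitp R K (keys f A) <= \sum_(i in A) hitp R K (f i).
  rewrite /hitp exchange_big /=; apply: ler_sum => S _; rewrite -mulr_sumr.
  rewrite ler_wpM2l ?unif_ge0 // keysI_eq0.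
  have [//|/forall_inPn[i iA Si]] := boolP [forall i in A, S :&: f i == set0].
    by rewrite sumr_ge0.
  by rewrite (bigD1 i) //= Si lerDl sumr_ge0.
rewrite (eq_bigr (fun=> qK)) => [|i _]; last exact: hitp_qK.
by rewrite sumr_const -mulr_natl; lra.
Qed.

(** From the probability of hitting [f i], that of hitting also some other [f i'] is subtracted; it
    is at most x ^ 2 for each i', the key sets being disjoint. *)
Lemma hit_one_ge f A i : disj f A -> (forall i, #|f i| = K) -> i \in A ->
  qK - #|A|%:R * xK ^+ 2 <= \sum_(S : {set T}) unif R K S *
    ((S :&: f i != set0) && [forall i' in A :\ i, S :&: f i' == set0])%:R.
Proof.
move=> /disjP df cf iA; rewrite -(hitp_qK (cf i)) lerBlDr.
have x0 : 0 <= xK by apply: xK_ge0.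
apply: (@le_trans _ _ (\sum_(S : {set T}) unif R K S *
    ((S :&: f i != set0) && [forall i' in A :\ i, S :&: f i' == set0])%:R +
  \sum_(i' in A :\ i) \sum_(S : {set T}) unif R K S *
    ((set0 \subset S)%:R * \prod_(j <- [:: i; i']) (S :&: f j != set0)%:R))).
  have t0 j (S : {set T}) : 0 <= (set0 \subset S)%:R * \prod_(l <- [:: i; j]) (S :&: f l != set0)%:R :> R.
    by rewrite mulr_ge0 ?prodr_ge0.
  rewrite exchange_big -big_split /=; apply: ler_sum => S _.
  rewrite -mulr_sumr -mulrDr ler_wpM2l ?unif_ge0 //.
  have [_|Si] := eqVneq (S :&: f i) set0; first by rewrite /= add0r sumr_ge0.
  case: (boolP [forall i' in _, _]) => /= [_|/forall_inPn[i' i'A Si']].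
    by rewrite lerDl sumr_ge0.
  rewrite add0r (bigD1 i') //= sub0set !big_cons big_nil Si Si' !mulr1 lerDl.
  by rewrite sumr_ge0 // => l _; rewrite mulr_ge0 ?prodr_ge0.
rewrite lerD2l; apply: (@le_trans _ _ (\sum_(i' in A :\ i) xK ^+ 2)); last first.
  by rewrite sumr_const -[leLHS]mulr_natl ler_wpM2r ?exprn_ge0 // ler_nat subset_leq_card // subD1set.
apply: ler_sum => i'; rewrite !inE => /andP[ii' i'A].
have uii' : uniq [:: i; i'] by rewrite /= inE eq_sym ii'.
have hh := @unif_hits_le R T K KP I [:: i; i'] f set0 uii'.
apply: le_trans (hh _ _) _.
- move=> j j'; rewrite !inE => jh j'h jj'; rewrite -setI_eq0 df //.
  + by case/orP: jh => /eqP->.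
  + by case/orP: j'h => /eqP->.
- by move=> j _; rewrite -setI_eq0 set0I.
by rewrite cards0 expr0 mul1r !big_cons big_nil !cf mulr1 expr2.
Qed.

(** With the [M i] pairwise disjoint, the |A| k nodes of their union must hit exactly one key set of
    [A], and all other nodes of [D] must miss every one. *)
Lemma prob_matches_ge M A D (k : nat) : [disjoint A & D] ->
  disj M A -> {in A, forall i, M i \subset D} -> {in A, forall i, #|M i| = k} ->
  0 <= qK - #|A|%:R * xK ^+ 2 -> 0 <= 1 - #|A|%:R * qK -> 0 <= qK ->
  unifE (fun f => (disj f A)%:R) *
   ((qK - #|A|%:R * xK ^+ 2) ^+ (#|A| * k) * (1 - #|A|%:R * qK) ^+ #|D|) <=
  unifE (fun f => (disj f A && [forall i in A, M i == nb f i D])%:R).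
Proof.
move=> dAD dM MD Mk c0 d0 q0; set c := qK - _ in c0 *; set d := 1 - _ in d0 *.
have d1 : d <= 1 by rewrite /d lerBlDr lerDl mulr_ge0.
have -> : unifE (fun f => (disj f A && [forall i in A, M i == nb f i D])%:R) =
    unifE (fun f => (disj f A)%:R * \prod_(j in D) (matches M A f j (f j))%:R).
  by apply: eq_pE => f; rewrite -natr_forall (matchesP _ MD) -natrM mulnb.
rewrite prob_matches // mulrC -unifEZ; apply: le_unifE => f cf.
case df: (disj f A); rewrite ?mulr1 ?mul1r ?mulr0 ?mul0r //.
have sMD : keys M A \subset D by apply/bigcupsP.
apply: (@le_trans _ _ (\prod_(j in D) (if j \in keys M A then c else d))).
  rewrite (big_setID (keys M A)) /= (setIidPr sMD).
  rewrite (eq_bigr (fun=> c)) => [|j ->] //; rewrite prodr_const (card_keys_disj dM Mk).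
  rewrite (eq_bigr (fun=> d)) => [|j]; last by rewrite inE => /andP[/negPf->].
  rewrite prodr_const ler_wpM2l ?exprn_ge0 //; apply: ler_wiXn2l => //.
  exact: subset_leq_card (subsetDl _ _).
apply: ler_prod => j jD; apply/andP; split; first by case: ifP.
case: ifP => [/bigcupP[i iA jM]|/negP jM].
  apply: le_trans (hit_one_ge df cf iA) _; apply: ler_sum => S _.
  rewrite ler_wpM2l ?unif_ge0 // ler_nat; case: (boolP (_ && _)) => //= /andP[Si /forall_inP So].
  suff -> : matches M A f j S by [].
  apply/forall_inP => i' i'A; have [->|ii'] := eqVneq i' i; first by rewrite Si jM.
  rewrite So ?inE ?ii' //; apply/eqP; symmetry; apply/negP => jM'.
  have := disjP _ _ dM i i' iA i'A; rewrite eq_sym ii' => /(_ isT)/setP/(_ j).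
  by rewrite !inE jM jM'.
apply: le_trans (missp_keys_ge A cf) _; apply: ler_sum => S _.
rewrite ler_wpM2l ?unif_ge0 // ler_nat keysI_eq0; case: (boolP [forall i in A, _]) => //= /forall_inP So.
suff -> : matches M A f j S by [].
apply/forall_inP => i' i'A; rewrite So //=; apply/eqP; symmetry; apply/negP => jM'.
by apply: jM; apply/bigcupP; exists i'.
Qed.

End Tuples.

(** * Lower bounds for the probability of low degrees *)

Section LowDegree.
Local Open Scope ring_scope.

Lemma pE_swap (R : realFieldType) (I T J U : finType) (w : I -> T -> R) (v : J -> U -> R)
    (F : {ffun I -> T} -> {ffun J -> U} -> R) :
  pE w (fun f => pE v (fun g => F f g)) = pE v (fun g => pE w (fun f => F f g)).
Proof.
rewrite /pE; under eq_bigr do rewrite mulr_sumr.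
rewrite exchange_big /=; apply: eq_bigr => g _; rewrite mulr_sumr.
by apply: eq_bigr => f _; rewrite mulrCA.
Qed.

Variables (R : realFieldType) (I T : finType) (K : nat).
Let P := #|T|.
Hypothesis KP : (K <= P)%N.
Implicit Types (A B D : {set I}) (S U W : {set T}) (f : {ffun I -> {set T}}).
Local Notation unifI := (@unifE R I I).
Local Notation xI := (@xK R I).
Local Notation unifE := (@unifE R I T K).
Local Notation xK := (@xK R T K).
Local Notation qK := (@qK R T K).

(* The neighbourhoods of the nodes of [A] are compared with a uniformly random
   family [M] of [k]-sets of nodes. *)
Lemma prob_low_ge A D (k : nat) : (k <= #|I|)%N -> [disjoint A & D] ->
  0 <= qK - #|A|%:R * xK ^+ 2 -> 0 <= 1 - #|A|%:R * qK -> 0 <= qK ->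
  'C(#|I|, k)%:R ^+ #|A| *
  unifI k (fun M : {ffun I -> {set I}} => (disj M A && [forall i in A, M i \subset D])%:R) *
  (unifE (fun f => (disj f A)%:R) *
   ((qK - #|A|%:R * xK ^+ 2) ^+ (#|A| * k) * (1 - #|A|%:R * qK) ^+ #|D|)) <=
  unifE (fun f => (disj f A && [forall i in A, #|nb f i D| == k])%:R).
Proof.
move=> kI dAD c0 d0 q0; set c := unifE _ * _.
have C0 : 0 < 'C(#|I|, k)%:R :> R by rewrite ltr0n bin_gt0.
(* The binomial power goes to the right-hand side: its inverse is the probability that a uniform
   family [M] equals the actual neighbourhoods, when these have size k. *)
rewrite -mulrA mulrC -ler_pdivlMr ?exprn_gt0 // mulrC -unifEZ.
pose F (M : {ffun I -> {set I}}) f : R := (disj f A && [forall i in A, M i == nb f i D])%:R.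
apply: (@le_trans _ _ (unifI k (fun M : {ffun I -> {set I}} => unifE (fun f => F M f)))).
  apply: le_unifE => M cM; case: (boolP (_ && _)) => [/andP[dM /forall_inP MD]|_].
    by rewrite mulr1; apply: prob_matches_ge => // i iA; apply: cM.
  by rewrite mulr0; apply: unifE_ge0.
rewrite /unifI pE_swap mulrC -pEZ; apply: le_unifE => f cf.
case df: (disj f A); last first.
  by rewrite /= mulr0 -/(unifI k _) -(unifE_cst I kI 0); apply: le_unifE => M _; rewrite /F df.
rewrite andTb; apply: (@le_trans _ _ (pE (fun _ : I => unif R k) (fun M : {ffun I -> {set I}} =>
    ([forall i in A, M i == nb f i D])%:R))).
  by apply: le_unifE => M _; rewrite /F df.
rewrite -/(unifI k _) (unifE_all R kI A (fun i (S : {set I}) => S == nb f i D)).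
have e i : \sum_(S : {set I}) unif R k S * (S == nb f i D)%:R = unif R k (nb f i D).
  by rewrite (bigD1 (nb f i D)) //= eqxx mulr1 big1 ?addr0 // => S /negPf ->; rewrite mulr0.
under eq_bigr do rewrite e.
have [/forall_inP lf|/forall_inPn[i iA lf]] := boolP [forall i in A, #|nb f i D| == k].
  rewrite mulr1 (eq_bigr (fun=> 'C(#|I|, k)%:R^-1)) => [|i iA].
    by rewrite prodr_const exprVn.
  by rewrite /unif lf // mul1r.
by rewrite (bigD1 i) //= /unif (negPf lf) !mul0r mulr0.
Qed.

(** For fixed |A| and k, a uniform family meets [A] or overlaps itself with probability O(1 / n), so
    almost every family is admissible in [prob_low_ge]. *)
Lemma prob_good_ge A (k : nat) : (k <= #|I|)%N ->
  1 - (#|A| ^ 2 * k)%:R / #|I|%:R - (#|A| ^ 2 * k ^ 2)%:R / #|I|%:R <=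
  unifI k (fun M : {ffun I -> {set I}} => (disj M A && [forall i in A, M i \subset ~: A])%:R) :> R.
Proof.
move=> kI.
have dM := @prob_disj_ge R I I k kI A.
have bM : unifI k (fun M : {ffun I -> {set I}} => (~~ [forall i in A, M i \subset ~: A])%:R)
    <= (#|A| ^ 2 * k)%:R / #|I|%:R :> R.
  have h := @unifE_union R I I k I (fun i => i \in A) (fun i M => M i :&: A != set0)
    (fun M => ~~ [forall i in A, M i \subset ~: A]).
  apply: le_trans (h _) _ => [M _ /forall_inPn[i iA]|].
    by rewrite -disjoints_subset -setI_eq0 => Mi; exists i.
  apply: (@le_trans _ _ (\sum_(i in A) #|A|%:R * (k%:R / #|I|%:R))).
    apply: ler_sum => i iA; rewrite (unifE_upd kI i) -[leRHS](unifE_cst I kI).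
    apply: le_unifE => M _; under eq_bigr do rewrite upd_same.
    exact: (hitp_le R kI).
  rewrite sumr_const -[leLHS]mulr_natl expnS expn1 !natrM.
  by rewrite -!mulrA lexx.
have e : unifI k (fun M : {ffun I -> {set I}} => (disj M A)%:R) <=
    unifI k (fun M : {ffun I -> {set I}} => (disj M A && [forall i in A, M i \subset ~: A])%:R) +
    unifI k (fun M : {ffun I -> {set I}} => (~~ [forall i in A, M i \subset ~: A])%:R) :> R.
  rewrite /unifI -pED; apply: le_unifE => M _.
  by case: disj => /=; case: [forall i in A, _] => /=; lra.
have xE : (#|A| ^ 2)%:R * xI k = (#|A| ^ 2 * k ^ 2)%:R / #|I|%:R :> R.
  by rewrite /xI /yK !natrM !mulrA.
by rewrite xE in dM; lra.
Qed.


Lemma qK01 : 0 <= qK <= 1.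
Proof.
have [U cU _] : exists2 U : {set T}, #|U| = K & set0 \subset U.
  by apply: ex_superset; rewrite ?cards0.
rewrite -(hitp_qK R KP cU) hitp_ge0 hitpE //.
by have := missp_ge0 R K U; lra.
Qed.

(** Whatever the key set of [i], the nodes of [D] are adjacent to [i] independently with probability
    exactly q. A neighbourhood B is weighted with (1 - q) ^ |D| in place of (1 - q) ^ (|D| -
    |B|). *)
Lemma prob_low1_ge (i : I) D (k : nat) : i \notin D ->
  (\sum_(B : {set I} | (B \subset D) && (#|B| < k)%N) qK ^+ #|B|) * (1 - qK) ^+ #|D| <=
  unifE (fun f => (#|nb f i D| < k)%N%:R).
Proof.
move=> iD; have /andP[q0 q1] := qK01.
apply: (@le_trans _ _ (\sum_(B : {set I} | (B \subset D) && (#|B| < k)%N)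
    unifE (fun f => 1 * \prod_(j in D) ((f j :&: f i != set0) == (j \in B))%:R))); last first.
  rewrite /unifE -pE_sum; apply: le_unifE => f _.
  have -> : \sum_(B : {set I} | (B \subset D) && (#|B| < k)%N)
       1 * \prod_(j in D) ((f j :&: f i != set0) == (j \in B))%:R =
    \sum_(B : {set I} | (B \subset D) && (#|B| < k)%N) (B == nb f i D)%:R :> R.
    apply: eq_bigr => B /andP[BD _]; rewrite mul1r -natr_forall; congr (_%:R); congr nat_of_bool.
    apply/forall_inP/eqP => [h|-> j jD]; last by rewrite inE jD eqxx.
    apply/setP => j; rewrite inE; case jD: (j \in D) => /=; first by rewrite (eqP (h j jD)).
    by apply/negP => /(subsetP BD); rewrite jD.
  case: (ltnP #|nb f i D| k) => nk; last first.
    rewrite big1 // => B /andP[_ Bk]; case: eqP => // e.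
    by move: Bk; rewrite e ltnNge nk.
  rewrite (bigD1 (nb f i D)) /=.
    by rewrite eqxx big1 ?addr0 // => B /andP[_ /negPf->].
  by rewrite nk andbT; apply/subsetP => j; rewrite inE => /andP[].
rewrite mulr_suml; apply: ler_sum => B /andP[BD _].
rewrite (unifE_indep KP (h := fun j f S => ((S :&: f i != set0) == (j \in B))%:R)) //; last first.
  move=> j f j' S jD j'D S'; rewrite upd_neq //; by apply: contraNneq iD => ->.
rewrite -[leLHS](unifE_cst I KP); apply: le_unifE => f cf; rewrite mul1r.
have e j : \sum_(S : {set T}) unif R K S * ((S :&: f i != set0) == (j \in B))%:R =
    if j \in B then qK else 1 - qK.
  rewrite -(hitp_qK R KP (cf i)); case: ifP => _.
    by apply: eq_bigr => S _; rewrite eqb_id.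
  rewrite hitpE // opprB addrC subrK; apply: eq_bigr => S _.
  by rewrite eqbF_neg negbK.
under eq_bigr do rewrite e.
rewrite (big_setID B) /= (setIidPr BD) (eq_bigr (fun=> qK)) => [|j ->] //.
rewrite prodr_const (eq_bigr (fun=> 1 - qK)) => [|j]; last by rewrite inE => /andP[/negPf->].
rewrite prodr_const ler_wpM2l ?exprn_ge0 //; apply: ler_wiXn2l; rewrite ?subr_ge0 //.
  by rewrite lerBlDr lerDl.
exact: subset_leq_card (subsetDl _ _).
Qed.

End LowDegree.

(** * Cuts in the key graph *)

Section Graphs.
Variables (n : nat) (e : rel 'I_n).
Hypotheses (e_sym : symmetric e) (e_irr : irreflexive e).

(** Deleting fewer than k neighbours would isolate a node. The condition k < n leaves a node to
    separate it from: a complete graph on at most k nodes survives every deletion although its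
    degrees are below k. *)
Lemma k_connected_min_degree (k : nat) : (k < n)%N -> k_connected e k -> min_degree_ge e k.
Proof.
move=> kn /forallP kc; apply/forallP => i; rewrite leqNgt; apply/negP => di.
pose S := [set j | e i j]; have iS : i \in ~: S by rewrite !inE e_irr.
have [v vS vi] : exists2 v, v \in ~: S & v != i.
  have : (0 < #|(~: S) :\ i|)%N.
    have := cardsD1 i (~: S); have := cardsC S; rewrite iS card_ord.
    by have : (#|S| < k)%N := di; lia.
  by case/card_gt0P => v; rewrite !inE => /andP[vi vS]; exists v; rewrite ?inE.
have /implyP/(_ di)/forall_inP/(_ i iS)/forall_inP/(_ v vS) := kc S.
case/connectP => -[|w p] /=; first by move=> _ vi'; rewrite vi' eqxx in vi.
by case/andP => /and3P[_ + eiw] _ _; rewrite !inE eiw.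
Qed.

(** No edge joins the component of [u] to the rest outside [S]; the smaller of the two sides is
    taken as [A], whence 2 |A| + |S| <= n. *)
Lemma not_k_connected_cut (k : nat) : ~~ k_connected e k ->
  exists S A : {set 'I_n}, [/\ (#|S| < k)%N, A != set0, [disjoint A & S],
    (2 * #|A| + #|S| <= n)%N &
    forall i j, i \in A -> j \notin A :|: S -> ~~ e i j].
Proof.
case/forallPn => S; rewrite negb_imply => /andP[Sk].
case/forall_inPn => u uS /forall_inPn[v vS nuv].
pose eS := (fun a b => [&& a \in ~: S, b \in ~: S & e a b]).
have sym : connect_sym eS.
  by apply: sym_connect_sym => a b; rewrite /eS e_sym; case: (a \in _); case: (b \in _).
pose A := [set w in ~: S | connect eS u w].
pose B := [set w in ~: S | ~~ connect eS u w].
have AS : [disjoint A & S].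
  by rewrite -setI_eq0; apply/eqP/setP => w; rewrite !inE; case: (w \in S); rewrite ?andbF.
have BS : [disjoint B & S].
  by rewrite -setI_eq0; apply/eqP/setP => w; rewrite !inE; case: (w \in S); rewrite ?andbF.
have cAB : (#|A| + #|B| + #|S| = n)%N.
  have dAB : A :&: B = set0.
    by apply/setP => w; rewrite !inE; case: (connect _ _ _); rewrite ?andbF.
  have : A :|: B = ~: S.
    by apply/setP => w; rewrite !inE; case: (connect _ _ _); rewrite ?andbF ?andbT ?orbF.
  move/(congr1 (fun X : {set 'I_n} => #|X|)); rewrite cardsU dAB cards0 subn0 => ->.
  by rewrite addnC cardsC card_ord.
have AB i j : i \in A -> j \in B -> ~~ e i j.
  rewrite !inE => /andP[iS ui] /andP[jS]; apply: contra => eij.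
  by apply: connect_trans ui (connect1 _); rewrite /eS !inE iS jS.
have [AleB|BleA] := leqP #|A| #|B|.
  exists S, A; split => //.
  - by apply/set0Pn; exists u; rewrite inE uS connect0.
  - by lia.
  - move=> i j iA; rewrite !inE negb_or => /andP[jA jS]; apply: AB => //.
    by rewrite !inE jS /=; move: jA; rewrite jS.
exists S, B; split => //.
- by apply/set0Pn; exists v; rewrite inE vS.
- by lia.
- move=> i j iB; rewrite !inE negb_or => /andP[jB jS]; rewrite e_sym; apply: AB => //.
  by move: jB; rewrite !inE jS /= negbK.
Qed.

End Graphs.

Section KeyGraph.
Variables (n Y : nat).
Implicit Type f : key_assign n Y.

Lemma rkg_adj_sym f : symmetric (rkg_adj f).
Proof. by move=> i j; rewrite /rkg_adj eq_sym setIC. Qed.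

Lemma rkg_adj_irr f : irreflexive (rkg_adj f).
Proof. by move=> i; rewrite /rkg_adj eqxx. Qed.

(** Stands in for the small components: neither the component nor the separator is mentioned, so the
    union bound runs over n ^ 2 pairs only. *)
Definition edge_with_few_hits f (m : nat) : bool :=
  [exists i, exists j, [&& i != j, f i :&: f j != set0 &
     (#|hits f [set i; j] (~: [set i; j])| <= m)%N]].

Definition cut f (k : nat) (A S : {set 'I_n}) : bool :=
  [&& (#|S| < k)%N, (2 * #|A| + #|S| <= n)%N, [disjoint A & S] & noedge f A (~: (A :|: S))].

(** A node of [A] has at least k > |S| neighbours, hence one outside [S], which must lie in [A]. All
    neighbours of this pair are in [A :|: S], so there are at most |A| + k of them. *)
Lemma not_k_connected_dichotomy f (k m : nat) :
  min_degree_ge (rkg_adj f) k -> ~~ k_connected (rkg_adj f) k ->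
  edge_with_few_hits f m \/ exists S A : {set 'I_n}, (m < #|A| + k)%N /\ cut f k A S.
Proof.
move=> /forallP md /(not_k_connected_cut (@rkg_adj_sym f))[S [A [Sk A0 dAS cA nAS]]].
have ne : noedge f A (~: (A :|: S)).
  apply/forall_inP => j; rewrite inE => jAS; rewrite keysI_eq0; apply/forall_inP => i iA.
  have := nAS i j iA jAS; rewrite /rkg_adj negb_and negbK setIC => /orP[/eqP ij|].
    by move: jAS; rewrite -ij inE iA.
  by rewrite negbK.
have [Am|] := leqP (#|A| + k) m; last first.
  by move=> mA; right; exists S, A; rewrite /cut Sk cA dAS ne.
left; case/set0Pn: A0 => i iA.
have [j eij jS] : exists2 j, rkg_adj f i j & j \notin S.
  have /subsetPn[j] : ~~ ([set j | rkg_adj f i j] \subset S).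
    by apply/negP => /subset_leq_card; rewrite leqNgt (leq_trans Sk (md i)).
  by rewrite inE; exists j.
have jA : j \in A.
  by apply/negPn/negP => jA; have := nAS i j iA; rewrite inE negb_or jA jS => /(_ isT); rewrite eij.
have /andP[ij fij] := eij.
apply/existsP; exists i; apply/existsP; exists j; rewrite ij fij /=.
apply: leq_trans Am; apply: leq_trans (_ : #|A :|: S| <= _)%N; last first.
  by apply: leq_trans (leq_card_setU _ _).1 _; rewrite leq_add2l ltnW.
apply: subset_leq_card; apply/subsetP => w; rewrite inE => /andP[].
rewrite inE => wij; apply: contraR => wAS.
have /forall_inP/(_ w) := ne; rewrite inE wAS => /(_ isT).
rewrite !keysI_eq0 => /forall_inP h; apply/forall_inP => l.
by rewrite !inE => /orP[] /eqP ->; apply: h.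
Qed.

End KeyGraph.

(** * Union bounds over edges and cuts *)

Lemma leq_bin_expn (n s : nat) : ('C(n, s) <= n ^ s)%N.
Proof.
apply: (@leq_trans ('C(n, s) * s`!)); first by rewrite leq_pmulr ?fact_gt0.
rewrite bin_ffact; elim: s => [|s IH]; first by rewrite ffactn0.
by rewrite ffactnSr expnSr leq_mul // leq_subr.
Qed.

Lemma card_small_sets_le (I : finType) (k : nat) : (0 < #|I|)%N ->
  (#|[set S : {set I} | (#|S| < k)%N]| <= k * #|I| ^ k)%N.
Proof.
move=> I0; rewrite -sum1_card.
rewrite (eq_bigl (fun S : {set I} => (#|S| < k)%N)); last by move=> S; rewrite inE.
rewrite (partition_big (fun S : {set I} => inord #|S| : 'I_k.-1.+1) xpredT) //=.
case: k => [|k] /=; first by rewrite big1 // => j _; rewrite big1 // => S /andP[].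
apply: (@leq_trans (\sum_(j < k.+1) #|I| ^ k.+1)); last by rewrite sum_nat_const card_ord.
apply: leq_sum => j _.
apply: (@leq_trans #|[set S : {set I} | #|S| == j]|).
  rewrite sum1_card subset_leq_card //; apply/subsetP => S.
  by rewrite unfold_in inE => /andP[Sk /eqP <-]; rewrite inordK.
rewrite card_draws; apply: leq_trans (leq_bin_expn _ _) _.
by rewrite leq_pexp2l // ltnW.
Qed.

Lemma cardsCU_ge (n : nat) (A S : {set 'I_n}) : (n - #|A| - #|S| <= #|~: (A :|: S)|)%N.
Proof.
have := cardsC (A :|: S); rewrite card_ord; have := (leq_card_setU A S).1.
lia.
Qed.

Section UnionBounds.
Local Open Scope ring_scope.
Variables (R : realFieldType) (n Y K : nat).
Hypotheses (KY : (K <= Y)%N) (K0 : (0 < K)%N).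
Let KP : (K <= #|'I_Y|)%N. Proof. by rewrite card_ord. Qed.
Local Notation unifE := (@unifE R 'I_n 'I_Y K).
Local Notation xK := (@xK R 'I_Y K).
Local Notation yK := (@yK R 'I_Y K).
Local Notation avoid := (@avoid R 'I_Y K).
Implicit Types f : key_assign n Y.

Lemma prob_edge_few_hits_le (m : nat) (t : R) : 0 < t <= 1 -> 2 * xK <= 2^-1 ->
  unifE (fun f => (edge_with_few_hits f m)%:R) <=
  (n ^ 2)%:R * (t ^- m * (1 + 4 * t * xK) ^+ n *
    (avoid (n - 2) ^+ K * (2 * xK * (avoid (n - 2) + yK) ^+ K.-1))).
Proof.
move=> t01 x2; have /andP[t0 t1] := t01; have x0 : 0 <= xK by apply: xK_ge0.
have h := @unifE_union R 'I_n 'I_Y K ('I_n * 'I_n)%type (fun p => p.1 != p.2)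
  (fun p f => (f p.1 :&: f p.2 != set0) &&
     (#|hits f [set p.1; p.2] (~: [set p.1; p.2])| <= m)%N) (fun f => edge_with_few_hits f m).
apply: le_trans (h _) _ => [f _ /existsP[i /existsP[j /and3P[ij fij hm]]]|].
  by exists (i, j); rewrite //= fij.
pose b := t ^- m * (1 + 4 * t * xK) ^+ n *
    (avoid (n - 2) ^+ K * (2 * xK * (avoid (n - 2) + yK) ^+ K.-1)).
have [a0 a1] := andP (avoid01 R 'I_Y K (n - 2)).
have t0' := ltW t0.
have c0 : 0 <= t ^- m by rewrite invr_ge0 exprn_ge0.
have ay : 0 <= avoid (n - 2) + yK by apply: addr_ge0 a0 (yK_ge0 _ _ _).
have d0 : 0 <= avoid (n - 2) ^+ K * (2 * xK * (avoid (n - 2) + yK) ^+ K.-1).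
  apply: mulr_ge0; first exact: exprn_ge0.
  by apply: mulr_ge0; [apply: mulr_ge0 | apply: exprn_ge0].
have tx : 0 <= 4 * t * xK by apply: mulr_ge0 => //; apply: mulr_ge0.
have e0 : 0 <= (1 + 4 * t * xK) ^+ n by apply: exprn_ge0; apply: addr_ge0.
have b0 : 0 <= b by apply: mulr_ge0 => //; apply: mulr_ge0.
apply: (@le_trans _ _ (\sum_(p : 'I_n * 'I_n) b)); last first.
  by rewrite sumr_const card_prod card_ord -[leLHS]mulr_natl mulnn.
rewrite big_mkcond; apply: ler_sum => -[i j] _ /=; case: ifP => // ij.
have cij : #|[set i; j]| = 2%N by rewrite cards2 ij.
have dij : [disjoint [set i; j] & ~: [set i; j]].
  by rewrite disjoints_subset setCK.
have cD : #|~: [set i; j]| = (n - 2)%N.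
  by rewrite -[n in RHS]card_ord -(cardsC [set i; j]) cij addKn.
have hh := @prob_edge_hits_le R _ _ K KP i j _ _ m t dij (set21 _ _) (set22 _ _) ij K0 t01.
rewrite cij cD subnn muln0 expr0 mulr1 in hh.
apply: le_trans (hh x2) _; rewrite /b ler_wpM2r // ler_wpM2l //.
rewrite (_ : 2 * 2%:R * t * xK = 4 * t * xK); last by ring.
by apply: ler_weXn2l; [rewrite lerDl | rewrite leq_subr].
Qed.

Definition cut_in f (k r1 r2 : nat) :=
  [exists A : {set 'I_n}, exists S : {set 'I_n},
     [&& (r1 <= #|A|)%N, (#|A| <= r2)%N & cut f k A S]].

Lemma prob_cut_in_le (k r1 r2 : nat) (bound : nat -> R) : (0 < n)%N ->
  (forall r, 0 <= bound r) ->
  (forall A D : {set 'I_n}, (r1 <= #|A| <= r2)%N -> [disjoint A & D] ->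
     (n - #|A| - k <= #|D|)%N -> (2 * #|A| <= n)%N ->
     unifE (fun f => (noedge f A D)%:R) <= bound #|A|) ->
  unifE (fun f => (cut_in f k r1 r2)%:R) <=
  \sum_(r < n.+1 | (r1 <= r <= r2)%N && (2 * r <= n)%N) 'C(n, r)%:R * (k * n ^ k)%:R * bound r.
Proof.
move=> n0 b0 hb.
have h := @unifE_union R 'I_n 'I_Y K ({set 'I_n} * {set 'I_n})%type
  (fun p => [&& (r1 <= #|p.1| <= r2)%N, (2 * #|p.1| <= n)%N, (#|p.2| < k)%N &
      [disjoint p.1 & p.2]])
  (fun p f => cut f k p.1 p.2) (fun f => cut_in f k r1 r2).
apply: le_trans (h _) _ => [f _ /existsP[A /existsP[S /and3P[rA Ar cu]]]|].
  exists (A, S) => //=; rewrite rA Ar /=; case/and4P: cu => -> c2 -> _.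
  by rewrite andbT (leq_trans _ c2) // leq_addr.
apply: (@le_trans _ _ (\sum_(A : {set 'I_n} | (r1 <= #|A| <= r2)%N && (2 * #|A| <= n)%N)
    \sum_(S : {set 'I_n} | (#|S| < k)%N) bound #|A|)).
  rewrite [leRHS]pair_big /= [leLHS]big_mkcond [leRHS]big_mkcond; apply: ler_sum => -[A S] _ /=.
  case: (boolP ((r1 <= #|A|)%N && (#|A| <= r2)%N)) => //= rA.
  case: (boolP (2 * #|A| <= n)%N) => //= cA.
  case: (boolP (#|S| < k)%N) => //= Sk; case: (boolP [disjoint A & S]) => // dAS.
  have dAD : [disjoint A & ~: (A :|: S)].
    by rewrite disjoints_subset setCK subsetUl.
  apply: (@le_trans _ _ (unifE (fun f => (noedge f A (~: (A :|: S)))%:R))).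
    apply: le_unifE => f _; rewrite ler_nat /cut.
    by case: noedge; rewrite ?andbF //; case: (_ && _).
  apply: hb => //; apply: leq_trans (cardsCU_ge A S).
  by rewrite leq_sub2l // ltnW.
apply: (@le_trans _ _ (\sum_(A : {set 'I_n} | (r1 <= #|A| <= r2)%N && (2 * #|A| <= n)%N)
    (k * n ^ k)%:R * bound #|A|)).
  apply: ler_sum => A _; rewrite sumr_const -[leLHS]mulr_natl ler_wpM2r // ler_nat.
  have := @card_small_sets_le 'I_n k; rewrite card_ord => /(_ n0); apply: leq_trans.
  by rewrite subset_leq_card //; apply/subsetP => S; rewrite inE.
have cn (A : {set 'I_n}) : (#|A| < n.+1)%N by rewrite ltnS -[n in leqRHS]card_ord max_card.
rewrite (partition_big (fun A : {set 'I_n} => inord #|A| : 'I_n.+1)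
   (fun r : 'I_n.+1 => (r1 <= r <= r2)%N && (2 * r <= n)%N)) => [|A]; last by rewrite inordK.
apply: ler_sum => r rr.
rewrite (eq_bigr (fun=> (k * n ^ k)%:R * bound r)) => [|A /andP[_ /eqP <-]]; last by rewrite inordK.
rewrite sumr_const -[leLHS]mulr_natl mulrA ler_wpM2r // ler_wpM2r // ler_nat.
rewrite -[n in 'C(n, _)]card_ord -card_draws subset_leq_card //; apply/subsetP => A.
by rewrite unfold_in inE => /andP[_ /eqP <-]; rewrite inordK.
Qed.

Lemma prob_cut_sparse_le (k r1 r2 : nat) : (0 < n)%N ->
  unifE (fun f => (cut_in f k r1 r2)%:R) <=
  \sum_(r < n.+1 | (r1 <= r <= r2)%N && (2 * r <= n)%N)
    'C(n, r)%:R * (k * n ^ k)%:R * (avoid (n - r - k) + r%:R * yK) ^+ (K * r).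
Proof.
move=> n0; apply: (prob_cut_in_le (bound := fun r => (avoid (n - r - k) + r%:R * yK) ^+ (K * r))) => //.
  move=> r; apply: exprn_ge0; apply: addr_ge0; first by case/andP: (avoid01 R 'I_Y K (n - r - k)).
  by apply: mulr_ge0 => //; apply: yK_ge0.
move=> A D _ dAD cD _; apply: le_trans (prob_noedge_le R KP dAD) _.
have [a0 _] := andP (avoid01 R 'I_Y K #|D|).
have [b0 _] := andP (avoid01 R 'I_Y K (n - #|A| - k)).
have ay : 0 <= #|A|%:R * yK by apply: mulr_ge0 => //; apply: yK_ge0.
by apply: lerXn2r; rewrite ?nnegrE ?addr_ge0 // lerD2r avoid_le.
Qed.

Lemma prob_cut_dense_le (k r1 r2 : nat) (u : nat -> nat) : (0 < n)%N ->
  (forall r, (u r <= Y)%N) ->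
  unifE (fun f => (cut_in f k r1 r2)%:R) <=
  \sum_(r < n.+1 | (r1 <= r <= r2)%N && (2 * r <= n)%N)
    'C(n, r)%:R * (k * n ^ k)%:R *
    ('C(Y, u r)%:R * ((u r)%:R / Y%:R) ^+ (K * r) + (1 - (u r)%:R / Y%:R) ^+ (K * (n - r - k))).
Proof.
move=> n0 uY; have u01 r : 0 <= ((u r)%:R / Y%:R : R) <= 1 by rewrite divr_ge0 ?ratio_le1.
apply: (prob_cut_in_le (bound := fun r => 'C(Y, u r)%:R * ((u r)%:R / Y%:R) ^+ (K * r) +
  (1 - (u r)%:R / Y%:R) ^+ (K * (n - r - k)))) => // [r|A D _ dAD cD _].
  have /andP[? ?] := u01 r.
  by rewrite addr_ge0 ?mulr_ge0 ?exprn_ge0 // ?subr_ge0.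
have /andP[v0 v1] := u01 #|A|.
have := @prob_noedge_le2 R _ _ K KP A D (u #|A|); rewrite card_ord => /(_ (uY _) dAD) h.
apply: le_trans h _; rewrite lerD2l; apply: ler_wiXn2l.
- by rewrite subr_ge0.
- by rewrite lerBlDr lerDl.
- by rewrite leq_mul2l cD orbT.
Qed.

(** The keys U of [A] split the nodes outside [S]: those of [A] have all their keys in U, the others
    none. If U or its complement has at most u1 keys, it contains all keys of one side, and both
    sides have at least r1 nodes. Otherwise the smaller of U and its complement serves. *)
Lemma cut_small_pool f k (A S : {set 'I_n}) (r1 u1 : nat) : (r1 <= #|A|)%N -> cut f k A S ->
  [exists B : {set 'I_n}, (#|B| == r1) && (#|keys f B| <= u1)%N] \/
  exists (U : {set 'I_Y}) (S : {set 'I_n}), [/\ (u1 < #|U|)%N, (2 * #|U| <= Y)%N, (#|S| < k)%N &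
    [forall j in ~: S, (f j \subset U) || (f j :&: U == set0)]].
Proof.
move=> rA /and4P[Sk c2 dAS /forall_inP ne].
have sub (B : {set 'I_n}) : (r1 <= #|B|)%N -> (#|keys f B| <= u1)%N ->
    [exists B : {set 'I_n}, (#|B| == r1) && (#|keys f B| <= u1)%N].
  move=> rB ku; have [B' B'B cB'] : exists2 B' : {set 'I_n}, B' \subset B & #|B'| = r1.
    have : (0 < #|[set B' : {set 'I_n} | B' \subset B & #|B'| == r1]|)%N.
      by rewrite cards_draws bin_gt0.
    by case/card_gt0P => B'; rewrite inE => /andP[sB /eqP cB]; exists B'.
  apply/existsP; exists B'; rewrite cB' eqxx (leq_trans _ ku) // subset_leq_card //.
  by apply/bigcupsP => i iB; apply: bigcup_sup (subsetP B'B i iB).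
pose U := keys f A.
have side j : j \in ~: S -> (f j \subset U) \/ (f j :&: U = set0).
  rewrite inE => jS; case jA: (j \in A); first by left; apply: bigcup_sup jA.
  by right; apply/eqP/ne; rewrite !inE jA.
have cU : (#|U| + #|~: U| = Y)%N by rewrite cardsC card_ord.
have [Uu|uU] := leqP #|U| u1; first by left; apply: (sub A).
have [U'u|uU'] := leqP #|~: U| u1.
  left; apply: (sub (~: (A :|: S))).
    apply: leq_trans (cardsCU_ge A S); rewrite -subnDA leq_subRL.
      by apply: leq_trans c2; lia.
    by apply: leq_trans c2; lia.
  apply: leq_trans U'u; apply: subset_leq_card; apply/bigcupsP => j jB.
  by rewrite -disjoints_subset -setI_eq0 ne.
right; have [h|h] := leqP (2 * #|U|) Y.
  exists U, S; split => //; apply/forall_inP => j /side[->//|->].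
  by rewrite eqxx orbT.
exists (~: U), S; split => //; first by lia.
apply/forall_inP => j /side[fU|fU].
  by rewrite -[f j :&: _]setDE setD_eq0 fU orbT.
by rewrite -disjoints_subset -setI_eq0 fU eqxx.
Qed.

Lemma prob_cut_small_pool_le (k r1 u1 : nat) : (0 < n)%N -> (u1 <= Y)%N ->
  unifE (fun f => (cut_in f k r1 n)%:R) <=
  'C(n, r1)%:R * ('C(Y, u1)%:R * (u1%:R / Y%:R) ^+ (K * r1)) +
  \sum_(u < Y.+1 | (u1 < u)%N && (2 * u <= Y)%N)
    'C(Y, u)%:R * (k * n ^ k)%:R * ((u%:R / Y%:R) ^+ K + (1 - u%:R / Y%:R) ^+ K) ^+ (n - k).
Proof.
move=> n0 uY.
pose G1 f := [exists B : {set 'I_n}, (#|B| == r1) && (#|keys f B| <= u1)%N].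
pose G2 f := [exists U : {set 'I_Y}, exists S : {set 'I_n},
  [&& (u1 < #|U|)%N, (2 * #|U| <= Y)%N, (#|S| < k)%N &
    [forall j in ~: S, (f j \subset U) || (f j :&: U == set0)]]].
apply: (@le_trans _ _ (unifE (fun f => (G1 f)%:R) + unifE (fun f => (G2 f)%:R))).
  rewrite /unifE -pED; apply: le_unifE => f _.
  have [/existsP[A /existsP[S /and3P[rA _ cu]]]|_] := boolP (cut_in f k r1 n); last by rewrite addr_ge0.
  case: (cut_small_pool u1 rA cu) => [g1|[U [S' [h1 h2 h3 h4]]]].
    by rewrite /G1 g1 lerDl.
  suff -> : G2 f by rewrite lerDr.
  by apply/existsP; exists U; apply/existsP; exists S'; rewrite h1 h2 h3.
apply: lerD.
  have h := @unifE_union R 'I_n 'I_Y K {set 'I_n} (fun B => #|B| == r1)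
    (fun B f => (#|keys f B| <= u1)%N) G1.
  apply: le_trans (h _) _ => [f _ /existsP[B /andP[cB kB]]|]; first by exists B.
  apply: (@le_trans _ _ (\sum_(B : {set 'I_n} | #|B| == r1) 'C(Y, u1)%:R * (u1%:R / Y%:R) ^+ (K * r1))).
    apply: ler_sum => B /eqP <-; have := @prob_few_keys_le R _ _ K KP B u1.
    by rewrite card_ord => /(_ uY).
  rewrite sumr_const -[leLHS]mulr_natl ler_wpM2r ?mulr_ge0 ?exprn_ge0 ?divr_ge0 // ler_nat.
  rewrite -[n in 'C(n, _)]card_ord -card_draws subset_leq_card //; apply/subsetP => B.
  by rewrite inE.
have h := @unifE_union R 'I_n 'I_Y K ({set 'I_Y} * {set 'I_n})%type
  (fun p => [&& (u1 < #|p.1|)%N, (2 * #|p.1| <= Y)%N & (#|p.2| < k)%N])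
  (fun p f => [forall j in ~: p.2, (f j \subset p.1) || (f j :&: p.1 == set0)]) G2.
apply: le_trans (h _) _ => [f _ /existsP[U /existsP[S /and4P[h1 h2 h3 h4]]]|].
  by exists (U, S); rewrite //= h1 h2.
pose phi (u : nat) : R := (u%:R / Y%:R) ^+ K + (1 - u%:R / Y%:R) ^+ K.
have phi0 u : (u <= Y)%N -> 0 <= phi u.
  move=> uY'; rewrite addr_ge0 // ?exprn_ge0 ?divr_ge0 //.
  by rewrite subr_ge0 ratio_le1.
(* Being at most 1 allows the exponent to be lowered from the number of nodes outside [S] to n -
   k. *)
have phi1 u : (u <= Y)%N -> phi u <= 1.
  move=> uY'; rewrite /phi -(prednK K0) !exprS.
  have v1 : u%:R / Y%:R <= 1 :> R by rewrite ratio_le1.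
  have v0 : 0 <= u%:R / Y%:R :> R by rewrite divr_ge0.
  set v := u%:R / Y%:R in v0 v1 *.
  have w1 : v ^+ K.-1 <= 1 by rewrite exprn_ile1.
  have z1 : (1 - v) ^+ K.-1 <= 1 by rewrite exprn_ile1 // ?subr_ge0 // lerBlDr lerDl.
  set w := v ^+ _ in w1 *; set z := (1 - v) ^+ _ in z1 *.
  have := ler_wpM2l v0 w1; have := @ler_wpM2l _ (1 - v) _ _ _ z1.
  by rewrite subr_ge0 => /(_ v1); lra.
have cY (U : {set 'I_Y}) : (#|U| <= Y)%N by rewrite -[Y in leqRHS]card_ord max_card.
apply: (@le_trans _ _ (\sum_(U : {set 'I_Y} | (u1 < #|U|)%N && (2 * #|U| <= Y)%N)
    \sum_(S : {set 'I_n} | (#|S| < k)%N) phi #|U| ^+ (n - k))).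
  rewrite [leRHS]pair_big /= (eq_bigl (fun p : {set 'I_Y} * {set 'I_n} =>
     [&& (u1 < #|p.1|)%N && (2 * #|p.1| <= Y)%N & (#|p.2| < k)%N])) => [|p]; last by rewrite andbA.
  apply: ler_sum => -[U S] /= /andP[_ Sk].
  have := @prob_split_le R _ _ K KP U S; rewrite card_ord -/(phi #|U|) => h'.
  apply: le_trans h' _; apply: ler_wiXn2l; rewrite ?phi0 ?phi1 //.
  by have := cardsCU_ge S set0; rewrite setU0 cards0 subn0; apply: leq_trans; rewrite leq_sub2l // ltnW.
apply: (@le_trans _ _ (\sum_(U : {set 'I_Y} | (u1 < #|U|)%N && (2 * #|U| <= Y)%N)
    (k * n ^ k)%:R * phi #|U| ^+ (n - k))).
  apply: ler_sum => U _; rewrite sumr_const -[leLHS]mulr_natl ler_wpM2r ?exprn_ge0 ?phi0 // ler_nat.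
  have := @card_small_sets_le 'I_n k; rewrite card_ord => /(_ n0); apply: leq_trans.
  by rewrite subset_leq_card //; apply/subsetP => S; rewrite inE.
have cY' (U : {set 'I_Y}) : (#|U| < Y.+1)%N by rewrite ltnS.
rewrite (partition_big (fun U : {set 'I_Y} => inord #|U| : 'I_Y.+1)
   (fun u : 'I_Y.+1 => (u1 < u)%N && (2 * u <= Y)%N)) => [|U]; last by rewrite inordK.
apply: ler_sum => u uu; have uY' : (u <= Y)%N by rewrite -ltnS.
rewrite (eq_bigr (fun=> (k * n ^ k)%:R * phi u ^+ (n - k))) => [|U /andP[_ /eqP <-]]; last by rewrite inordK.
rewrite sumr_const -[leLHS]mulr_natl mulrA ler_wpM2r ?exprn_ge0 ?phi0 // ler_wpM2r // ler_nat.
rewrite -[Y in 'C(Y, _)]card_ord -card_draws subset_leq_card //; apply/subsetP => U.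
by rewrite unfold_in inE => /andP[_ /eqP <-]; rewrite inordK.
Qed.

End UnionBounds.

(** * Splitting the keys of the pool *)

Section Monotonicity.
Local Open Scope ring_scope.

(** Every j-set lies in the same number of K-sets, and every K-set contains the same number of
    j-sets; summing phi J <= phi S over all inclusions compares the two means. *)
Lemma unif_sum_mono (R : realFieldType) (T : finType) (K : nat) (phi : {set T} -> R) (j : nat) :
  (j <= K)%N -> (K <= #|T|)%N ->
  (forall J S : {set T}, J \subset S -> phi J <= phi S) ->
  \sum_(J : {set T} | #|J| == j) phi J <=
  'C(#|T|, j)%:R * \sum_(S : {set T}) unif R K S * phi S.
Proof.
move=> jK KT mono; have jT := leq_trans jK KT.
have Bp : 0 < 'C(#|T| - j, K - j)%:R :> R by rewrite ltr0n bin_gt0 leq_sub2r.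
rewrite -(ler_pM2r Bp) sum_unifE.
have Cp : 'C(#|T|, K)%:R != 0 :> R by rewrite pnatr_eq0 -lt0n bin_gt0.
have -> : 'C(#|T|, j)%:R * ((\sum_(S : {set T} | #|S| == K) phi S) / 'C(#|T|, K)%:R) *
    'C(#|T| - j, K - j)%:R = 'C(K, j)%:R * (\sum_(S : {set T} | #|S| == K) phi S).
  have := congr1 (fun z => z%:R : R) (bin_bin jK KT); rewrite /= !natrM => e.
  transitivity ('C(#|T|, j)%:R * 'C(#|T| - j, K - j)%:R / 'C(#|T|, K)%:R *
     \sum_(S : {set T} | #|S| == K) phi S); first by field.
  by rewrite -e; field.
apply: (@le_trans _ _ (\sum_(S : {set T} | #|S| == K)
    \sum_(J : {set T} | (J \subset S) && (#|J| == j)) phi J)).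
  rewrite (exchange_big_dep (fun J : {set T} => #|J| == j)) /=; last by move=> S J _ /andP[].
  rewrite mulr_suml; apply: ler_sum => J /eqP cJ; rewrite cJ eqxx sumr_const.
  have <- : #|[set S : {set T} | (J \subset S) && (#|S| == K)]| = 'C(#|T| - j, K - j).
    by rewrite card_supersets cJ.
  rewrite mulr_natr le_eqVlt; apply/orP; left; apply/eqP; congr (_ *+ _).
  by apply: eq_card => S; rewrite inE unfold_in andbT andbC.
rewrite mulr_sumr; apply: ler_sum => S /eqP cS.
apply: (@le_trans _ _ (\sum_(J : {set T} | (J \subset S) && (#|J| == j)) phi S)).
  by apply: ler_sum => J /andP[JS _]; apply: mono.
have <- : #|[set J : {set T} | J \subset S & #|J| == j]| = 'C(K, j) by rewrite cards_draws cS.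
rewrite sumr_const -[leLHS]mulr_natl le_eqVlt; apply/orP; left; apply/eqP; congr (_%:R * _).
by apply: eq_card => J; rewrite inE unfold_in.
Qed.

Section Fibers.
Variables (R : realFieldType) (T T' : finType) (pi : T' -> T) (m K : nat).
Hypothesis fib : forall t, #|[set t' | pi t' == t]| = m.

Definition images (J : {set T}) : nat := #|[set S : {set T'} | (pi @: S == J) && (#|S| == K)]|.

Lemma sum_images (J : {set T}) :
  (\sum_(J' : {set T} | J' \subset J) images J' = 'C(m * #|J|, K))%N.
Proof.
have <- : #|pi @^-1: J| = (m * #|J|)%N.
  rewrite -sum1_card (partition_big pi (mem J)) /=; last by move=> t'; rewrite inE.
  rewrite mulnC -sum_nat_const; apply: eq_bigr => t tJ; rewrite sum1_card -(fib t).
  apply: eq_card => t'; rewrite unfold_in !inE; case: eqP => [->|]; last by rewrite andbF.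
  by rewrite tJ.
rewrite -cards_draws -sum1_card (partition_big (fun S : {set T'} => pi @: S) (fun J' => J' \subset J)).
  apply: eq_bigr => J' J'J; rewrite /images -sum1_card; apply: eq_bigl => S.
  rewrite !inE; case: (pi @: S =P J') => [e|_]; last by rewrite andbF.
  by rewrite andbT -sub_imset_pre e J'J.
by move=> S; rewrite inE -sub_imset_pre => /andP[].
Qed.

(* By inclusion-exclusion the number of [K]-sets with image [J] only depends on [#|J|]. *)
Lemma images_card : exists nu : nat -> nat, forall J : {set T}, images J = nu #|J|.
Proof.
suff h c : exists nu : nat -> nat, forall J : {set T}, (#|J| < c)%N -> images J = nu #|J|.
  by have [nu hnu] := h #|T|.+1; exists nu => J; apply: hnu; rewrite ltnS max_card.
elim: c => [|c [nu IH]]; first by exists id.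
have [J0 cJ0|none] := pickP [pred J : {set T} | #|J| == c]; last first.
  by exists nu => J; rewrite ltnS leq_eqVlt => /orP[cJ|/IH//]; have := none J; rewrite /= cJ.
exists (fun j => if j == c then images J0 else nu j) => J; rewrite ltnS leq_eqVlt.
case: eqP => [cJ _|_ /= /IH //].
pose lower (J1 : {set T}) := (\sum_(J' : {set T} | (J' \subset J1) && (#|J'| < c)%N) nu #|J'|)%N.
have s0 (J1 : {set T}) : #|J1| = c -> (images J1 + lower J1 = 'C(m * c, K))%N.
  move=> c1; rewrite -[in RHS]c1 -sum_images (bigD1 J1) //=; congr addn; apply: eq_big => J'.
    by rewrite -c1 -properEcard properEneq andbC.
  by move=> /andP[_ /IH ->].
suff e (J1 : {set T}) : #|J1| = c -> lower J1 = (\sum_(j < #|T|.+1 | (j < c)%N) 'C(c, j) * nu j)%N.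
  by apply/(@addIn (lower J)); rewrite s0 // (e J) // -(e J0) ?s0 //; apply/eqP.
move=> c1; rewrite /lower (partition_big (fun J' : {set T} => inord #|J'| : 'I_#|T|.+1)
   (fun j : 'I_#|T|.+1 => (j < c)%N)) => [|J' /andP[_ ?]]; last by rewrite inordK // ltnS max_card.
apply: eq_bigr => j jc; rewrite -c1 -cards_draws -sum_nat_const.
apply: eq_big => J'.
  rewrite inE -val_eqE /= inordK ?ltnS ?max_card // -andbA; congr andb.
  by case: (#|J'| =P j) => [->|_]; rewrite ?andbF // c1 jc.
by move=> /andP[_]; rewrite -val_eqE /= inordK ?ltnS ?max_card // => /eqP->.
Qed.

(** Given its size, which is at most K, the image of a uniform K-set is uniform by [images_card];
    [unif_sum_mono] then applies to each size. *)
Lemma unif_image_le (phi : {set T} -> R) : (K <= #|T'|)%N -> (K <= #|T|)%N ->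
  (forall J S : {set T}, J \subset S -> phi J <= phi S) ->
  \sum_(S : {set T'}) unif R K S * phi (pi @: S) <= \sum_(S : {set T}) unif R K S * phi S.
Proof.
move=> KT' KT mono; have [nu hnu] := images_card.
have Cp : 0 < 'C(#|T'|, K)%:R :> R by rewrite ltr0n bin_gt0.
rewrite sum_unifE ler_pdivrMr //; set E := \sum_(S : {set T}) _.
have part (psi : {set T} -> R) : \sum_(S : {set T'} | #|S| == K) psi (pi @: S) =
    \sum_(j < K.+1) (nu j)%:R * \sum_(J : {set T} | #|J| == j) psi J.
  rewrite (partition_big (fun S : {set T'} => inord #|pi @: S| : 'I_K.+1) xpredT) //=.
  apply: eq_bigr => j _; rewrite mulr_sumr.
  rewrite (partition_big (fun S : {set T'} => pi @: S) (fun J => #|J| == j)) => [|S /andP[/eqP cS]]; last first.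
    by rewrite -val_eqE /= inordK // ltnS -cS leq_imset_card.
  apply: eq_bigr => J /eqP cJ; rewrite (eq_bigr (fun=> psi J)) => [|S /andP[_ /eqP->]] //.
  rewrite sumr_const mulr_natl -cJ -hnu; congr (_ *+ _); apply: eq_card => S.
  rewrite unfold_in !inE; case: (pi @: S =P J) => [e|_]; last by rewrite andbF.
  case: (#|S| =P K) => //= cS.
  have lt : (#|pi @: S| < K.+1)%N by rewrite ltnS -cS leq_imset_card.
  by rewrite -val_eqE /= inordK // e cJ eqxx.
have -> : 'C(#|T'|, K)%:R = \sum_(S : {set T'} | #|S| == K) (1 : R).
  rewrite sumr_const -card_draws; congr (_%:R); apply: eq_card => S.
  by rewrite inE unfold_in.
rewrite (part (fun=> 1)) part mulr_sumr; apply: ler_sum => j _.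
rewrite sumr_const mulrCA ler_wpM2l // mulrC.
have jK : (j <= K)%N by rewrite -ltnS.
apply: le_trans (unif_sum_mono jK KT mono) _; rewrite -/E le_eqVlt; apply/orP; left; apply/eqP.
rewrite -card_draws; congr (_%:R * _); apply: eq_card => S.
by rewrite inE unfold_in.
Qed.


Variable I : finType.

Lemma unifE_image_le (F : {ffun I -> {set T}} -> R) : (K <= #|T'|)%N -> (K <= #|T|)%N ->
  (forall f g : {ffun I -> {set T}}, (forall i, f i \subset g i) -> F f <= F g) ->
  unifE K (fun f' : {ffun I -> {set T'}} => F [ffun i => pi @: f' i]) <= unifE K F.
Proof.
move=> KT' KT mono.
(* Hybrid argument: coordinates in [s] already carry a K-set of [T], the others still the image of a
   K-set of [T']. One coordinate is exchanged at a time. *)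
pose hyb (s : seq I) (f' : {ffun I -> {set T'}}) (f : {ffun I -> {set T}}) : {ffun I -> {set T}} :=
  [ffun i => if i \in s then f i else pi @: f' i].
have step s : unifE K (fun f' => F [ffun i => pi @: f' i]) <=
    unifE K (fun f' => unifE K (fun f => F (hyb s f' f))).
  elim: s => [|i s IH].
    apply: le_unifE => f' _; rewrite -[leLHS](unifE_cst I KT); apply: le_unifE => f _.
    by apply: mono => i; rewrite !ffunE.
  apply: le_trans IH _.
  have [is_s|is_s] := boolP (i \in s).
    apply: le_unifE => f' _; apply: le_unifE => f _; apply: mono => j; rewrite !ffunE inE.
    by case: eqP => [->|_] //=; rewrite is_s.
  have hyb_l f' f S : hyb s (upd f' i S) f = upd (hyb s f' f) i (pi @: S).
    apply/ffunP => j; rewrite !ffunE; have [->|//] := eqVneq j i.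
    by rewrite (negPf is_s).
  have hyb_r f' f S : hyb (i :: s) f' (upd f i S) = upd (hyb s f' f) i S.
    by apply/ffunP => j; rewrite !ffunE inE; case: (j == i).
  have -> : unifE K (fun f' => unifE K (fun f => F (hyb s f' f))) =
      unifE K (fun f => unifE K (fun f' =>
        \sum_(S : {set T'}) unif R K S * F (upd (hyb s f' f) i (pi @: S)))).
    rewrite /unifE pE_swap; apply: eq_pE => f.
    rewrite -/(unifE K _) (unifE_upd KT' i); apply: eq_pE => f'.
    by apply: eq_bigr => S _; rewrite hyb_l.
  have -> : unifE K (fun f' => unifE K (fun f => F (hyb (i :: s) f' f))) =
      unifE K (fun f => unifE K (fun f' =>
        \sum_(S : {set T}) unif R K S * F (upd (hyb s f' f) i S))).
    rewrite /unifE [RHS]pE_swap; apply: eq_pE => f'.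
    rewrite -/(unifE K _) (unifE_upd KT i); apply: eq_pE => f.
    by apply: eq_bigr => S _; rewrite hyb_r.
  apply: le_unifE => f _; apply: le_unifE => f' _.
  apply: (unif_image_le (phi := fun J => F (upd (hyb s f' f) i J))) => // J S JS.
  by apply: mono => j; rewrite !updE; case: eqP.
apply: le_trans (step (enum I)) _; rewrite -[leRHS](unifE_cst I KT').
apply: le_unifE => f' _; rewrite le_eqVlt; apply/orP; left; apply/eqP.
by apply: eq_pE => f; congr F; apply/ffunP => j; rewrite ffunE mem_enum.
Qed.

End Fibers.
End Monotonicity.

Lemma connected_on_sub (n : nat) (e e' : rel 'I_n) (V : {set 'I_n}) :
  subrel e e' -> connected_on e V -> connected_on e' V.
Proof.
move=> ee' /forall_inP h; apply/forall_inP => u uV; apply/forall_inP => v vV.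
have := forall_inP (h u uV) v vV; apply: connect_sub => a b /and3P[aV bV eab].
by apply: connect1; rewrite aV bV ee'.
Qed.

Lemma k_connected_sub (n : nat) (e e' : rel 'I_n) (k : nat) :
  subrel e e' -> k_connected e k -> k_connected e' k.
Proof.
move=> ee' /forallP h; apply/forallP => S; apply/implyP => Sk.
by apply: connected_on_sub ee' _; apply: (implyP (h S)).
Qed.

Lemma rkg_adj_sub (n Y : nat) (f g : key_assign n Y) :
  (forall i, f i \subset g i) -> subrel (rkg_adj f) (rkg_adj g).
Proof.
move=> fg i j /andP[ij fij]; rewrite /rkg_adj ij /=; apply: contraNneq fij => gij.
by rewrite -subset0 -gij setISS.
Qed.

Section PoolSplitting.
Local Open Scope ring_scope.

(* Merging the keys of a pool of size [m * Y] in groups of size [m] only creates edges. *)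
Lemma prob_k_connected_pool (R : realFieldType) (n Y m K k : nat) : (0 < m)%N -> (K <= Y)%N ->
  unifE K (fun f : key_assign n (m * Y) => (k_connected (rkg_adj f) k)%:R) <=
  unifE K (fun f : key_assign n Y => (k_connected (rkg_adj f) k)%:R) :> R.
Proof.
move=> m0 KY; have [Y0|Y0] := posnP Y.
  have mY : (m * Y)%N = Y by rewrite Y0 muln0.
  by rewrite mY.
have cmY : #|{: 'I_m * 'I_Y}| = (m * Y)%N by rewrite card_prod !card_ord.
(* The large pool is identified with pairs of a copy number and a key; [pi] forgets the copy number,
   so that all fibres have m elements. *)
pose h (x : 'I_(m * Y)) : 'I_m * 'I_Y := enum_val (cast_ord (esym cmY) x).
have hbij : bijective h.
  exists (fun p => cast_ord cmY (enum_rank p)) => [x|p].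
    by rewrite /h enum_valK cast_ordKV.
  by rewrite /h cast_ordK enum_rankK.
pose pi x := (h x).2.
have fib t : #|[set x | pi x == t]| = m.
  have -> : [set x | pi x == t] = h @^-1: (setX setT [set t]).
    by apply/setP => x; rewrite !inE.
  rewrite on_card_preimset; last exact: onW_bij.
  by rewrite cardsX cardsT cards1 card_ord muln1.
pose F (f : key_assign n Y) : R := (k_connected (rkg_adj f) k)%:R.
have := @unifE_image_le R _ _ pi m K fib 'I_n F; rewrite !card_ord => main.
apply: le_trans (main _ KY _).
- apply: le_unifE => f _; rewrite ler_nat /F; case: (boolP (k_connected _ _)) => // kc.
  rewrite (k_connected_sub _ kc) // => i j /andP[ij /set0Pn[z]]; rewrite inE => /andP[zi zj].
  rewrite /rkg_adj ij /=; apply/set0Pn; exists (pi z).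
  by rewrite inE !ffunE !imset_f.
- by rewrite (leq_trans KY) // leq_pmull.
- move=> f g fg; rewrite /F ler_nat; case: (boolP (k_connected _ _)) => // kc.
  by rewrite (k_connected_sub (rkg_adj_sub fg) kc).
Qed.

End PoolSplitting.

(** * Nodes of low degree *)

Section LowNodes.
Local Open Scope ring_scope.
Variables (R : realFieldType) (n Y K k : nat).
Hypotheses (KY : (K <= Y)%N) (k0 : (0 < k)%N).
Let KP : (K <= #|'I_Y|)%N. Proof. by rewrite card_ord. Qed.
Local Notation unifE := (@unifE R 'I_n 'I_Y K).
Local Notation xK := (@xK R 'I_Y K).
Local Notation yK := (@yK R 'I_Y K).
Local Notation qK := (@qK R 'I_Y K).
Local Notation avoid := (@avoid R 'I_Y K).
Implicit Types (f : key_assign n Y) (A : {set 'I_n}).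

Definition low f : {set 'I_n} := [set i | (#|[set j | rkg_adj f i j]| < k)%N].

Lemma min_degree_low f : min_degree_ge (rkg_adj f) k = (low f == set0).
Proof.
apply/forallP/eqP => [h|h i]; first by apply/setP => i; rewrite !inE ltnNge h.
by rewrite leqNgt; apply/negP => hi; have := in_set0 i; rewrite -h inE hi.
Qed.

Lemma nb_neighbors f i A : i \in A ->
  nb f i (~: A) = [set j | rkg_adj f i j] :\: A.
Proof.
move=> iA; apply/setP => j; rewrite !inE /rkg_adj setIC.
by case jA: (j \in A) => //=; rewrite (_ : i != j) //; apply: contraFneq jA => <-.
Qed.

Lemma nb_low f i A : i \in A -> i \in low f -> (#|nb f i (~: A)| < k)%N.
Proof.
move=> iA; rewrite inE nb_neighbors //; apply: leq_ltn_trans.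
by rewrite subset_leq_card // subsetDl.
Qed.

Lemma disj_nb_low f i A : i \in A -> disj f A -> (#|nb f i (~: A)| < k)%N -> i \in low f.
Proof.
move=> iA /disjP dA; rewrite inE nb_neighbors //; congr (_ < _)%N; congr #|pred_of_set _|.
apply/setP => j; rewrite !inE; case jA: (j \in A) => //=.
by apply/esym/negP => /andP[ij]; rewrite dA // eqxx.
Qed.

Lemma hits_low f A : A \subset low f -> (#|hits f A (~: A)| <= #|A| * k)%N.
Proof.
move=> Al; apply: (@leq_trans #|\bigcup_(i in A) nb f i (~: A)|).
  apply: subset_leq_card; apply/subsetP => j; rewrite inE => /andP[jA].
  rewrite keysI_eq0 => /forall_inPn[i iA ji]; apply/bigcupP; exists i => //.
  by rewrite inE jA.
rewrite -sum_nat_const; elim/big_rec2: _ => [|i m B iA IH]; first by rewrite cards0.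
apply: leq_trans (leq_card_setU _ _).1 _; rewrite leq_add // ltnW // nb_low //.
exact: (subsetP Al).
Qed.

(** If all nodes of [A] are low, either their key sets are disjoint or there is an edge inside [A];
    in the latter case [A] still has at most |A| k neighbours outside, and the double sum is an
    error term. *)
Lemma prob_low_le A :
  unifE (fun f => (A \subset low f)%:R) <=
  unifE (fun f => (disj f A && [forall i in A, #|nb f i (~: A)| < k]%N)%:R) +
  \sum_(p : 'I_n * 'I_n | [&& p.1 \in A, p.2 \in A & p.1 != p.2])
    unifE (fun f => ((f p.1 :&: f p.2 != set0) && (#|hits f A (~: A)| <= #|A| * k)%N)%:R).
Proof.
rewrite /unifE -pE_sum -pED; apply: le_unifE => f _.
case Al: (A \subset low f); last by rewrite addr_ge0 // sumr_ge0.
case df: (disj f A).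
  rewrite (_ : [forall i in A, _] = true) /= ?lerDl ?sumr_ge0 //.
  by apply/forall_inP => i iA; rewrite nb_low // (subsetP Al).
move/negbT: df; rewrite /disj => /forall_inPn[i iA /forall_inPn[j jA]].
rewrite negb_imply => /andP[ij fij]; rewrite add0r (bigD1 (i, j)) /=.
  by rewrite fij hits_low //= lerDl sumr_ge0.
by rewrite iA jA ij.
Qed.

Lemma prob_low_ge_disj A :
  unifE (fun f => (disj f A && [forall i in A, #|nb f i (~: A)| == k.-1])%:R) <=
  unifE (fun f => (A \subset low f)%:R).
Proof.
apply: le_unifE => f _; rewrite ler_nat; case: (boolP (_ && _)) => // /andP[df /forall_inP h].
suff -> : A \subset low f by [].
apply/subsetP => i iA; apply: (disj_nb_low iA df).
by rewrite (eqP (h i iA)) prednK.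
Qed.

(** For w > 0 the alternating sum up to m equals (-1) ^ m 'C(w - 1, m), by Pascal's rule. *)
Lemma bonferroni (w m : nat) :
  `|(w == 0%N)%:R - \sum_(l < m.+1) (-1) ^+ l * 'C(w, l)%:R| <= 'C(w, m.+1)%:R :> R.
Proof.
case: w => [|w].
  rewrite big_ord_recl bin0 expr0 mul1r big1 => [|l _]; last by rewrite bin0n mulr0.
  by rewrite addr0 subrr normr0.
have -> : \sum_(l < m.+1) (-1) ^+ l * 'C(w.+1, l)%:R = (-1) ^+ m * 'C(w, m)%:R :> R.
  elim: m => [|m IH]; first by rewrite big_ord_recl big_ord0 !bin0 addr0.
  by rewrite big_ord_recr IH /= binS natrD exprS; ring.
rewrite /= sub0r normrN normrM normrX normrN1 expr1n mul1r normr_nat ler_nat.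
by rewrite binS leq_addl.
Qed.

Lemma sum_subset_bin f (l : nat) :
  \sum_(A : {set 'I_n} | #|A| == l) (A \subset low f)%:R = 'C(#|low f|, l)%:R :> R.
Proof.
rewrite -cards_draws -sum1_card natr_sum big_mkcond [RHS]big_mkcond /=.
by apply: eq_bigr => A _; rewrite inE; case: (_ \subset _); case: (_ == _).
Qed.

Lemma prob_no_low_bonferroni (m : nat) :
  `|unifE (fun f => (low f == set0)%:R) -
    \sum_(l < m.+1) (-1) ^+ l *
      \sum_(A : {set 'I_n} | #|A| == l) unifE (fun f => (A \subset low f)%:R)| <=
  \sum_(A : {set 'I_n} | #|A| == m.+1) unifE (fun f => (A \subset low f)%:R).
Proof.
have e l : \sum_(A : {set 'I_n} | #|A| == l) unifE (fun f => (A \subset low f)%:R) =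
    unifE (fun f => 'C(#|low f|, l)%:R).
  by rewrite /unifE -pE_sum; apply: eq_pE => f; apply: sum_subset_bin.
under eq_bigr do rewrite e; rewrite e.
have -> : unifE (fun f => (low f == set0)%:R) -
    \sum_(l < m.+1) (-1) ^+ l * unifE (fun f => 'C(#|low f|, l)%:R) =
  unifE (fun f => (#|low f| == 0%N)%:R - \sum_(l < m.+1) (-1) ^+ l * 'C(#|low f|, l)%:R).
  rewrite /unifE; under [in LHS]eq_bigr do rewrite -pEZ.
  rewrite -pE_sum -[X in _ - X]mul1r -mulNr -pEZ -pED; apply: eq_pE => f.
  by rewrite mulN1r cards_eq0.
have nle (F G : key_assign n Y -> R) : (forall f, `|F f| <= G f) -> `|unifE F| <= unifE G.
  move=> FG; rewrite ler_norml; apply/andP; split.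
    rewrite -mulN1r -unifEZ; apply: le_unifE => f _; rewrite mulN1r.
    by have := FG f; rewrite ler_norml => /andP[].
  by apply: le_unifE => f _; have := FG f; rewrite ler_norml => /andP[].
by apply: nle => f; apply: bonferroni.
Qed.

(* An edge at a low node is counted at most [k] times per low node, so adjacent
   pairs contribute little to the second moment. *)
Lemma prob_no_low_second_moment (mu B2 : R) : (1 < n)%N ->
  mu = \sum_(i : 'I_n) unifE (fun f => (i \in low f)%:R) ->
  (forall i j : 'I_n, i != j ->
    unifE (fun f => (disj f [set i; j] && [forall l in [set i; j], #|nb f l (~: [set i; j])| < k]%N)%:R) <= B2) ->
  unifE (fun f => (low f == set0)%:R) * mu ^+ 2 <=
  (1 + k%:R) * mu + (n ^ 2)%:R * B2 - mu ^+ 2.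
Proof.
move=> n1 muE hB2; pose W f : R := #|low f|%:R.
have EW : unifE W = mu.
  rewrite muE /unifE -pE_sum; apply: eq_pE => f.
  by rewrite /W -sum1_card natr_sum [LHS]big_mkcond; apply: eq_bigr => i _; case: ifP.
have B20 : 0 <= B2.
  have i01 : Ordinal (ltnW n1) != Ordinal n1 by [].
  by apply: le_trans (hB2 _ _ i01); apply: unifE_ge0.
(* Chebyshev's argument: without low nodes the square of W - mu is mu ^ 2. *)
apply: (@le_trans _ _ (unifE (fun f => (W f - mu) ^+ 2))).
  rewrite mulrC -unifEZ; apply: le_unifE => f _; case: eqP => [lf|_].
    by rewrite /W lf cards0 sub0r sqrrN mulr1.
  by rewrite mulr0 sqr_ge0.
have -> : unifE (fun f => (W f - mu) ^+ 2) = unifE (fun f => W f ^+ 2) - mu ^+ 2.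
  transitivity (unifE (fun f => W f ^+ 2) + (- 2 * mu) * unifE W + unifE (fun=> mu ^+ 2)).
    rewrite -unifEZ /unifE -!pED; apply: eq_pE => f; ring.
  by rewrite EW unifE_cst //; ring.
rewrite lerD2r.
pose G f (i j : 'I_n) : R := (disj f [set i; j] &&
   [forall l in [set i; j], #|nb f l (~: [set i; j])| < k]%N)%:R.
have pw f : W f ^+ 2 <= (1 + k%:R) * W f + \sum_(p : 'I_n * 'I_n | p.1 != p.2) G f p.1 p.2.
  have WE : W f = \sum_i (i \in low f)%:R.
    by rewrite /W -sum1_card natr_sum [LHS]big_mkcond; apply: eq_bigr => i _; case: ifP.
  rewrite expr2 {1 2}WE mulr_suml.
  have -> : \sum_(p : 'I_n * 'I_n | p.1 != p.2) G f p.1 p.2 =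
      \sum_i \sum_(j | i != j) G f i j by rewrite pair_big_dep.
  rewrite WE mulr_sumr -big_split /=; apply: ler_sum => i _.
  have [il|il] := boolP (i \in low f); last by rewrite mul0r mulr0 add0r sumr_ge0.
  rewrite mul1r mulr1 (bigD1 i) //= il -addrA lerD2l.
  have := il; rewrite inE => di.
  apply: (@le_trans _ _ (\sum_(j | i != j) (rkg_adj f i j)%:R + \sum_(j | i != j) G f i j)).
    rewrite -big_split /= (eq_bigl (fun j => i != j)) => [|j]; last by rewrite eq_sym.
    apply: ler_sum => j ij; case jl: (j \in low f); last by rewrite addr_ge0.
    rewrite /rkg_adj ij /=; case: (f i :&: f j =P set0) => [fij|_] /=; last by rewrite lerDl.
    rewrite add0r /G (_ : disj _ _ && _ = true) //; apply/andP; split.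
      apply/disjP => a b; rewrite !inE => /orP[] /eqP-> /orP[] /eqP-> //; rewrite ?eqxx //.
      by rewrite setIC.
    apply/forall_inP => l lij; apply: nb_low => //.
    by move: lij; rewrite in_set2 => /orP[] /eqP->.
  rewrite lerD2r; apply: (@le_trans _ _ #|[set j | rkg_adj f i j]|%:R).
    rewrite -sum1_card natr_sum [leLHS]big_mkcond [leRHS]big_mkcond.
    by apply: ler_sum => j _; rewrite inE; case: eqP => //; case: rkg_adj.
  by rewrite ler_nat ltnW.
apply: (@le_trans _ _ (unifE (fun f => (1 + k%:R) * W f + \sum_(p : 'I_n * 'I_n | p.1 != p.2) G f p.1 p.2))).
  exact: le_unifE.
rewrite /unifE pED pEZ -/(unifE W) EW lerD2l pE_sum.
apply: (@le_trans _ _ (\sum_(p : 'I_n * 'I_n | p.1 != p.2) B2)).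
  by apply: ler_sum => -[i j] /= ij; apply: hB2.
rewrite sumr_const -[leLHS]mulr_natl ler_wpM2r // ler_nat.
by rewrite (leq_trans (max_card _)) // card_prod card_ord mulnn.
Qed.

End LowNodes.

(** * Passage to [rkg_prob] and to the Stdlib reals *)

Section Bridge.
Local Open Scope ring_scope.

Lemma rkg_probE (n K Y : nat) (Q : key_assign n Y -> bool) : (K <= Y)%N ->
  rkg_prob K Q = unifE K (fun f : key_assign n Y => (Q f)%:R) :> R.
Proof.
move=> KY; rewrite /rkg_prob !INRE /Rdiv RinvE RmultE.
have cv (f : key_assign n Y) : \prod_i unif R K (f i) =
    (valid_assign K f)%:R / 'C(Y, K)%:R ^+ n.
  have hC (c : R) : \prod_(i < n) c = c ^+ n.
    by rewrite big_const_ord; elim: (n) => //= m ->; rewrite exprS.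
  rewrite /unif big_split /= hC exprVn.
  rewrite card_ord; congr (_ / _).
  have [/forallP vf|/forallPn[i /negPf fi]] := boolP (valid_assign K f).
    by rewrite big1 // => i _; rewrite vf.
  by rewrite (bigD1 i) //= fi mul0r.
have pr (Q' : pred (key_assign n Y)) : unifE K (fun f : key_assign n Y => (Q' f)%:R) =
    #|[set f : key_assign n Y | valid_assign K f && Q' f]|%:R / 'C(Y, K)%:R ^+ n :> R.
  rewrite -sum1_card natr_sum mulr_suml [RHS]big_mkcond; apply: eq_bigr => f _.
  rewrite cv inE; case: valid_assign; case: (Q' f); rewrite /= ?mul0r ?mulr0 //.
  by rewrite mulr1.
have c0 : 'C(Y, K)%:R ^+ n != 0 :> R.
  by rewrite expf_neq0 // pnatr_eq0 -lt0n bin_gt0.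
(* The product law has total mass 1 and gives every valid assignment the same weight; this counts
   the valid assignments. *)
have cN : #|[set f : key_assign n Y | valid_assign K f]|%:R = 'C(Y, K)%:R ^+ n :> R.
  have KP : (K <= #|'I_Y|)%N by rewrite card_ord.
  have := pr predT; rewrite /= (unifE_cst _ KP 1) => /esym/(canRL (mulfVK c0)).
  rewrite mul1r => <-; congr (#|pred_of_set _|%:R); apply/setP => f.
  by rewrite !inE andbT.
by rewrite pr cN.
Qed.

Lemma edge_probE (K Y : nat) : edge_prob K Y = qK R 'I_Y K.
Proof. by rewrite /edge_prob /qK !INRE RminusE RdivE card_ord. Qed.


(** [xk], [yk] and [av] are [xK], [yK] and [avoid] in the operations of the Stdlib reals, in which
    the asymptotic part is written. *)
Definition xk (K Y : nat) : R := Rmult (INR K) (Rdiv (INR K) (INR Y)).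
Definition yk (K Y : nat) : R := Rdiv (INR K) (INR Y).
Definition av (K Y m : nat) : R := pow (Rminus (IZR 1) (Rinv (INR Y))) (K * m).

Lemma IZR2E : IZR 2 = 2%:R. Proof. by rewrite -INRE INR_IZR_INZ. Qed.
Lemma IZR4E : IZR 4 = 4%:R. Proof. by rewrite -INRE INR_IZR_INZ. Qed.

Lemma yKE (K Y : nat) : yK R 'I_Y K = yk K Y.
Proof. by rewrite /yK /yk card_ord RdivE !INRE. Qed.

Lemma xKE (K Y : nat) : xK R 'I_Y K = xk K Y.
Proof. by rewrite /xK yKE /xk /yk RmultE INRE. Qed.

Lemma avoidE (K Y m : nat) : avoid R 'I_Y K m = av K Y m.
Proof. by rewrite /avoid /av card_ord RpowE RminusE RinvE INRE. Qed.

Lemma edge_prob_ge0 (K Y : nat) : (K <= Y)%N -> Rle 0 (edge_prob K Y).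
Proof.
move=> KY; apply/RleP; rewrite edge_probE.
have KP : (K <= #|'I_Y|)%N by rewrite card_ord.
by have /andP[] := qK01 R KP.
Qed.

Lemma edge_prob_le_xk (K Y : nat) : (K <= Y)%N -> Rle (edge_prob K Y) (xk K Y).
Proof.
move=> KY; apply/RleP; have KP : (K <= #|'I_Y|)%N by rewrite card_ord.
have [U cU _] : exists2 U : {set 'I_Y}, #|U| = K & set0 \subset U.
  by apply: ex_superset; rewrite ?cards0.
rewrite edge_probE -xKE -(hitp_qK R KP cU); apply: le_trans (hitp_le R KP U) _.
by rewrite cU.
Qed.

Lemma edge_prob_ge_pow (K Y : nat) : (K <= Y)%N ->
  Rle (Rminus 1 (pow (Rminus 1 (yk K Y)) K)) (edge_prob K Y).
Proof.
move=> KY; apply/RleP; have KP : (K <= #|'I_Y|)%N by rewrite card_ord.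
have [U cU _] : exists2 U : {set 'I_Y}, #|U| = K & set0 \subset U.
  by apply: ex_superset; rewrite ?cards0.
rewrite edge_probE -(hitp_qK R KP cU) hitpE // RminusE RpowE RminusE -yKE lerD2l lerN2.
by have := missp_le R KP U; rewrite cU.
Qed.

Lemma le_sum_ord (F : nat -> R) (P : pred nat) (n : nat) (c : R) : 0 <= c ->
  (forall r, (r < n)%N -> P r -> F r <= c) -> \sum_(r < n | P r) F r <= n%:R * c.
Proof.
move=> c0 Fc; apply: (@le_trans _ _ (\sum_(r < n) c)).
  rewrite [leLHS]big_mkcond; apply: ler_sum => r _; case: ifP => // Pr.
  exact: Fc.
by rewrite sumr_const card_ord -[leLHS]mulr_natl.
Qed.

(** Small components, sparse cuts and dense cuts are separated at [m] and at [r]. A cut escaping the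
    edge event has m < |A| + k, hence the lower size [m.+1 - k]. *)
Lemma prob_mindeg_sub_kconn (n K Y k m r : nat) : (K <= Y)%N -> (k < n)%N ->
  Rle (rkg_prob K (fun f : key_assign n Y => k_connected (rkg_adj f) k))
      (rkg_prob K (fun f : key_assign n Y => min_degree_ge (rkg_adj f) k)) /\
  Rle (rkg_prob K (fun f : key_assign n Y => min_degree_ge (rkg_adj f) k))
   (Rplus (rkg_prob K (fun f : key_assign n Y => k_connected (rkg_adj f) k))
   (Rplus (rkg_prob K (fun f : key_assign n Y => edge_with_few_hits f m))
   (Rplus (rkg_prob K (fun f : key_assign n Y => cut_in f k (m.+1 - k) r))
          (rkg_prob K (fun f : key_assign n Y => cut_in f k r n))))).
Proof.
move=> KY kn; rewrite !rkg_probE //; split; apply/RleP.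
  apply: le_unifE => f _; rewrite ler_nat; case: (boolP (k_connected _ _)) => // kc.
  by rewrite (k_connected_min_degree (@rkg_adj_irr _ _ f) kn kc).
rewrite !RplusE /unifE -!pED; apply: le_unifE => f _.
case: (boolP (min_degree_ge _ _)) => [md|_]; last by rewrite !addr_ge0.
case: (boolP (k_connected _ _)) => [_|nk]; first by rewrite lerDl !addr_ge0.
rewrite add0r; case: (not_k_connected_dichotomy m md nk) => [->|[S [A [mA cA]]]].
  by rewrite lerDl addr_ge0.
have [Ar|rA] := leqP #|A| r.
  rewrite (_ : cut_in f k (m.+1 - k) r) /= ?addrA; last first.
    by apply/existsP; exists A; apply/existsP; exists S; rewrite Ar cA leq_subLR addnC mA.
  by rewrite -addrA addrCA lerDl addr_ge0.
rewrite (_ : cut_in f k r n) /=; last first.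
  apply/existsP; exists A; apply/existsP; exists S; rewrite (ltnW rA) cA.
  by rewrite -[n in leqRHS]card_ord max_card.
by rewrite addrA lerDr addr_ge0.
Qed.

Lemma rkg_prob_edge_few_hits (n K Y m : nat) (t : R) : (K <= Y)%N -> (0 < K)%N ->
  Rlt 0 t -> Rle t 1 -> Rle (Rmult 2 (xk K Y)) (Rinv 2) ->
  Rle (rkg_prob K (fun f : key_assign n Y => edge_with_few_hits f m))
   (Rmult (pow (INR n) 2) (Rmult (Rmult (Rinv (pow t m)) (pow (Rplus 1 (Rmult (Rmult 4 t) (xk K Y))) n))
     (Rmult (pow (av K Y (n - 2)) K)
       (Rmult (Rmult 2 (xk K Y)) (pow (Rplus (av K Y (n - 2)) (yk K Y)) K.-1))))).
Proof.
move=> KY K0 /RltP t0 /RleP t1 /RleP x2; apply/RleP; rewrite rkg_probE //.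
rewrite !(RplusE, RmultE, RpowE, RinvE, INRE, IZR2E, IZR4E) -!xKE -?yKE -?avoidE -?natrX in x2 *.
by apply: prob_edge_few_hits_le => //; apply/andP.
Qed.

Lemma rkg_prob_cut_sparse (n K Y k r1 r2 : nat) (c : R) : (K <= Y)%N -> (0 < n)%N -> Rle 0 c ->
  (forall r, (r1 <= r <= r2)%N -> (2 * r <= n)%N ->
    Rle (Rmult (Rmult (INR 'C(n, r)) (INR (k * n ^ k)))
       (pow (Rplus (av K Y (n - r - k)) (Rmult (INR r) (yk K Y))) (K * r))) c) ->
  Rle (rkg_prob K (fun f : key_assign n Y => cut_in f k r1 r2)) (Rmult (INR n.+1) c).
Proof.
move=> KY n0 /RleP c0 h; apply/RleP; rewrite rkg_probE // RmultE INRE.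
apply: le_trans (prob_cut_sparse_le R KY k r1 r2 n0) _.
apply: (@le_sum_ord (fun r => 'C(n, r)%:R * (k * n ^ k)%:R *
   (avoid R 'I_Y K (n - r - k) + r%:R * yK R 'I_Y K) ^+ (K * r))
   (fun r => (r1 <= r <= r2)%N && (2 * r <= n)%N)) => // r _ /andP[rr rn].
by have /RleP := h r rr rn; rewrite !(RplusE, RmultE, RpowE, INRE) yKE avoidE.
Qed.

Lemma rkg_prob_cut_dense (n K Y k r1 : nat) (u : nat -> nat) (c : R) :
  (K <= Y)%N -> (0 < n)%N -> Rle 0 c -> (forall r, (u r <= Y)%N) ->
  (forall r, (r1 <= r)%N -> (2 * r <= n)%N ->
    Rle (Rmult (Rmult (INR 'C(n, r)) (INR (k * n ^ k)))
       (Rplus (Rmult (INR 'C(Y, u r)) (pow (Rdiv (INR (u r)) (INR Y)) (K * r)))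
              (pow (Rminus 1 (Rdiv (INR (u r)) (INR Y))) (K * (n - r - k))))) c) ->
  Rle (rkg_prob K (fun f : key_assign n Y => cut_in f k r1 n)) (Rmult (INR n.+1) c).
Proof.
move=> KY n0 /RleP c0 uY h; apply/RleP; rewrite rkg_probE // RmultE INRE.
apply: le_trans (prob_cut_dense_le R KY k r1 n n0 uY) _.
apply: (@le_sum_ord (fun r => 'C(n, r)%:R * (k * n ^ k)%:R *
   ('C(Y, u r)%:R * ((u r)%:R / Y%:R) ^+ (K * r) + (1 - (u r)%:R / Y%:R) ^+ (K * (n - r - k))))
   (fun r => (r1 <= r <= n)%N && (2 * r <= n)%N)) => // r _ /andP[/andP[rr _] rn].
by have /RleP := h r rr rn; rewrite !(RplusE, RmultE, RminusE, RdivE, RpowE, INRE).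
Qed.

Lemma rkg_prob_cut_small_pool (n K Y k r1 u1 : nat) (c1 c2 : R) :
  (K <= Y)%N -> (0 < K)%N -> (0 < n)%N -> (u1 <= Y)%N -> Rle 0 c2 ->
  Rle (Rmult (INR 'C(n, r1)) (Rmult (INR 'C(Y, u1)) (pow (Rdiv (INR u1) (INR Y)) (K * r1)))) c1 ->
  (forall u, (u1 < u)%N -> (2 * u <= Y)%N ->
    Rle (Rmult (Rmult (INR 'C(Y, u)) (INR (k * n ^ k)))
      (pow (Rplus (pow (Rdiv (INR u) (INR Y)) K) (pow (Rminus 1 (Rdiv (INR u) (INR Y))) K)) (n - k))) c2) ->
  Rle (rkg_prob K (fun f : key_assign n Y => cut_in f k r1 n)) (Rplus c1 (Rmult (INR Y.+1) c2)).
Proof.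
move=> KY K0 n0 uY /RleP c0 /RleP h1 h; apply/RleP; rewrite rkg_probE // RplusE RmultE INRE.
apply: le_trans (prob_cut_small_pool_le R KY K0 k r1 n0 uY) _; apply: lerD.
  by move: h1; rewrite !(RplusE, RmultE, RminusE, RdivE, RpowE, INRE).
apply: (@le_sum_ord (fun u => 'C(Y, u)%:R * (k * n ^ k)%:R *
    ((u%:R / Y%:R) ^+ K + (1 - u%:R / Y%:R) ^+ K) ^+ (n - k))
   (fun u => (u1 < u)%N && (2 * u <= Y)%N)) => // u _ /andP[uu uY'].
by have /RleP := h u uu uY'; rewrite !(RplusE, RmultE, RminusE, RdivE, RpowE, INRE).
Qed.

End Bridge.

(** * Moments of the number of low nodes through Poisson sums *)

Lemma unifE_compl (R : realFieldType) (I T : finType) (K : nat) (Q : pred {ffun I -> {set T}}) :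
  (K <= #|T|)%N ->
  (1 - unifE K (fun f => (Q f)%:R) = unifE K (fun f => (~~ Q f)%:R) :> R)%R.
Proof.
move=> KP; apply/eqP; rewrite subr_eq; apply/eqP; rewrite -[LHS](unifE_cst I KP) /unifE -pED.
by apply: eq_pE => f; case: (Q f); rewrite /= ?add0r ?addr0.
Qed.

(** Up to the factor exp (- z), the probability that a Poisson variable of mean z is below k, which
    is what a degree below k amounts to. *)
Fixpoint poisson_sum (k : nat) (z : R) : R :=
  if k is k'.+1 then Rplus (poisson_sum k' z) (Rdiv (pow z k') (INR k'`!)) else IZR 0.

Section BridgeLow.
Local Open Scope ring_scope.

Lemma poisson_sumE (k : nat) (z : R) : poisson_sum k z = \sum_(s < k) z ^+ s / (s`!)%:R.
Proof.
elim: k => [|k IH] /=; first by rewrite big_ord0.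
by rewrite big_ord_recr /= -IH RplusE RdivE RpowE INRE.
Qed.

Lemma sum_small_sets (I : finType) (D : {set I}) (k : nat) (psi : nat -> R) :
  \sum_(B : {set I} | (B \subset D) && (#|B| < k)%N) psi #|B| =
  \sum_(s < k) 'C(#|D|, s)%:R * psi s.
Proof.
case: k => [|k]; first by rewrite big_ord0 big1 // => B; rewrite andbF.
rewrite (partition_big (fun B : {set I} => inord #|B| : 'I_k.+1) xpredT) //=.
apply: eq_bigr => s _; rewrite -cards_draws -sum1_card natr_sum mulr_suml.
apply: eq_big => B.
  rewrite inE -andbA; congr andb; case: ltnP => Bk; first by rewrite -val_eqE /= inordK.
  by apply/esym/negP => /eqP e; move: Bk; rewrite e leqNgt ltn_ord.
by move=> /andP[/andP[_ Bk]]; rewrite -val_eqE /= inordK // => /eqP->; rewrite mul1r.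
Qed.

Lemma bin_le_fact (N n s : nat) : (N <= n)%N -> 'C(N, s)%:R <= n%:R ^+ s / (s`!)%:R :> R.
Proof.
move=> Nn; rewrite ler_pdivlMr ?ltr0n ?fact_gt0 // -natrM bin_ffact -natrX ler_nat.
elim: s => [|s IH]; first by rewrite ffactn0.
by rewrite ffactnSr expnSr leq_mul // (leq_trans (leq_subr _ _)).
Qed.

Lemma bin_ge_fact (N m s : nat) : (m + s <= N.+1)%N -> m%:R ^+ s / (s`!)%:R <= 'C(N, s)%:R :> R.
Proof.
move=> mN; rewrite ler_pdivrMr ?ltr0n ?fact_gt0 // -natrM bin_ffact -natrX ler_nat.
elim: s mN => [|s IH] mN; first by rewrite ffactn0.
rewrite ffactnSr expnSr leq_mul //; first by apply: IH; lia.
by lia.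
Qed.

Lemma sum_bin_le_poisson_sum (N n k : nat) (x : R) : 0 <= x -> (N <= n)%N ->
  \sum_(s < k) 'C(N, s)%:R * x ^+ s <= poisson_sum k (n%:R * x).
Proof.
move=> x0 Nn; rewrite poisson_sumE; apply: ler_sum => s _.
rewrite exprMn mulrAC ler_wpM2r ?exprn_ge0 //; exact: bin_le_fact.
Qed.

(** For s < k, every factor of the falling factorial (n - 1) ... (n - s) is at least n - k, which
    explains the argument on the left. *)
Lemma poisson_sum_le_sum_bin (n k : nat) (x : R) : 0 <= x -> (0 < n)%N ->
  poisson_sum k ((n - k)%:R * x) <= \sum_(s < k) 'C(n.-1, s)%:R * x ^+ s.
Proof.
move=> x0 n0; rewrite poisson_sumE; apply: ler_sum => s _.
rewrite exprMn mulrAC ler_wpM2r ?exprn_ge0 //.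
have [nk|kn] := leqP n k.
  have -> : (n - k = 0)%N by lia.
  case: s => -[|s] /= sk; first by rewrite expr0 bin0 fact0 divr1.
  by rewrite exprS mul0r mul0r.
by apply: bin_ge_fact; have := ltn_ord s; lia.
Qed.

Lemma cardsC_ord (n : nat) (A : {set 'I_n}) : #|~: A| = (n - #|A|)%N.
Proof. by rewrite -(addKn #|A| #|~: A|) cardsC card_ord. Qed.

Variables (n K Y k : nat).
Hypotheses (KY : (K <= Y)%N) (k0 : (0 < k)%N) (n0 : (0 < n)%N).
Let KP : (K <= #|'I_Y|)%N. Proof. by rewrite card_ord. Qed.
Local Notation unifE := (@unifE R 'I_n 'I_Y K).
Local Notation xK := (@xK R 'I_Y K).
Local Notation qK := (@qK R 'I_Y K).
Implicit Types (f : key_assign n Y) (A : {set 'I_n}).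

(* Per-node weight of [l] nodes with disjoint key sets and fewer than [k] neighbours
   each: the other [n - l - l * k] nodes at least avoid the [K] keys. *)
Definition low_weight (l : nat) : R :=
  poisson_sum k (Rmult (INR n) (xk K Y)) *
  pow (Rminus (IZR 1) (Rinv (INR Y))) (K * K * (n - l - l * k)).

Lemma prob_disj_low_weight A :
  unifE (fun f => (disj f A && [forall i in A, #|nb f i (~: A)| < k]%N)%:R) <=
  low_weight #|A| ^+ #|A|.
Proof.
have dA : [disjoint A & ~: A] by rewrite disjoints_subset setCK.
apply: le_trans (prob_disj_low_le R KP k dA) _.
have cA := cardsC_ord A.
have x0 : 0 <= xK by apply: xK_ge0.
have P1 : 0 <= 1 - Y%:R^-1 :> R.
  have /andP[] := avoid01 R 'I_Y 1 1; by rewrite /avoid mul1n expr1 card_ord.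
rewrite card_ord cA /low_weight exprMn !(RpowE, RminusE, RinvE, RmultE, INRE) -xKE -!exprM.
rewrite (_ : K * (#|A| * K) * (n - #|A| - #|A| * k) = K * K * (n - #|A| - #|A| * k) * #|A|)%N; last by ring.
rewrite ler_wpM2r ?exprn_ge0 // sum_small_sets cA.
have s0 : 0 <= \sum_(s < k) 'C(n - #|A|, s)%:R * xK ^+ s.
  by apply: sumr_ge0 => s _; rewrite mulr_ge0 ?exprn_ge0.
have le := sum_bin_le_poisson_sum k x0 (leq_subr #|A| n).
by rewrite lerXn2r ?nnegrE // (le_trans s0 le).
Qed.

Lemma mindeg_probE :
  rkg_prob K (fun f : key_assign n Y => min_degree_ge (rkg_adj f) k) =
  unifE (fun f => (low k f == set0)%:R).
Proof.
by rewrite rkg_probE //; apply: eq_pE => f; rewrite min_degree_low.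
Qed.

Lemma prob_disj1 (i : 'I_n) :
  unifE (fun f => (i \in low k f)%:R) = 
  unifE (fun f => (disj f [set i] && [forall l in [set i], #|nb f l (~: [set i])| < k]%N)%:R).
Proof.
apply: eq_pE => f; have d1 : disj f [set i].
  by apply/disjP => a b; rewrite !inE => /eqP-> /eqP->; rewrite eqxx.
rewrite d1 /=; congr (_%:R); congr nat_of_bool; apply/idP/forall_inP => [il l|h].
  by rewrite inE => /eqP->; apply: nb_low => //; apply: set11.
exact: disj_nb_low (set11 i) d1 (h i (set11 i)).
Qed.

Lemma rkg_prob_mindeg_ge :
  Rle (Rminus 1 (Rmult (INR n) (low_weight 1)))
    (rkg_prob K (fun f : key_assign n Y => min_degree_ge (rkg_adj f) k)).
Proof.
apply/RleP; rewrite mindeg_probE RminusE RmultE INRE lerBlDr -lerBlDl.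
have e := @unifE_compl R 'I_n 'I_Y K (fun f => low k f == set0) KP; rewrite /= in e; rewrite e.
have h := @unifE_union R 'I_n 'I_Y K 'I_n predT (fun i f => i \in low k f) (fun f => low k f != set0).
apply: le_trans (h _) _ => [f _ /set0Pn[i il]|]; first by exists i.
apply: (@le_trans _ _ (\sum_(i : 'I_n) low_weight 1)).
  apply: ler_sum => i _; rewrite prob_disj1.
  by have := prob_disj_low_weight [set i]; rewrite cards1 expr1.
by rewrite sumr_const card_ord -[leLHS]mulr_natl.
Qed.

Definition low_prob_lb : R :=
  Rmult (poisson_sum k (Rmult (INR (n - k)) (edge_prob K Y))) (pow (Rminus 1 (edge_prob K Y)) n).

Lemma prob_low_lb (i : 'I_n) : low_prob_lb <= unifE (fun f => (i \in low k f)%:R).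
Proof.
have iD : i \notin ~: [set i] by rewrite !inE eqxx.
have cD : #|~: [set i]| = n.-1 by rewrite cardsC_ord cards1 subn1.
have /andP[q0 q1] := qK01 R KP.
apply: (@le_trans _ _ (unifE (fun f => (#|nb f i (~: [set i])| < k)%N%:R))); last first.
  rewrite prob_disj1; apply: le_unifE => f _; rewrite ler_nat.
  have -> : disj f [set i].
    by apply/disjP => a b; rewrite !inE => /eqP-> /eqP->; rewrite eqxx.
  case: (boolP (_ < _)%N) => // h /=; rewrite (_ : [forall l in _, _] = true) //.
  by apply/forall_inP => l; rewrite inE => /eqP->.
apply: le_trans (prob_low1_ge R KP k iD).
rewrite cD sum_small_sets cD /low_prob_lb !(RmultE, RpowE, RminusE, edge_probE, INRE).
have le := poisson_sum_le_sum_bin k q0 n0.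
have p0 : 0 <= poisson_sum k ((n - k)%:R * qK).
  by rewrite poisson_sumE sumr_ge0 // => s _; rewrite divr_ge0 ?exprn_ge0 // mulr_ge0.
rewrite ler_pM ?exprn_ge0 ?subr_ge0 //.
by apply: ler_wiXn2l; rewrite ?subr_ge0 ?leq_pred // lerBlDr lerDl.
Qed.

(** The second moment inequality divided by mu ^ 2, with mu replaced by its lower bound. The result
    is small when the mean is large and the weight of a pair is close to that of two independent
    nodes. *)
Lemma rkg_prob_mindeg_le : (1 < n)%N -> Rlt 0 low_prob_lb ->
  Rle (rkg_prob K (fun f : key_assign n Y => min_degree_ge (rkg_adj f) k))
    (Rminus (Rplus (Rdiv (INR k.+1) (Rmult (INR n) low_prob_lb))
           (pow (Rdiv (low_weight 2) low_prob_lb) 2)) 1).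
Proof.
move=> n1 /RltP b0; apply/RleP; rewrite mindeg_probE.
rewrite !(RminusE, RplusE, RdivE, RmultE, RpowE, INRE).
set b := low_prob_lb in b0 *; set P0 := unifE _.
pose mu := \sum_(i : 'I_n) unifE (fun f => (i \in low k f)%:R).
have mub : n%:R * b <= mu.
  apply: (@le_trans _ _ (\sum_(i : 'I_n) b)).
    by rewrite sumr_const card_ord -[leRHS]mulr_natl.
  by apply: ler_sum => i _; apply: prob_low_lb.
have nb0 : 0 < n%:R * b by rewrite mulr_gt0 ?ltr0n.
have mu0 : 0 < mu by apply: lt_le_trans nb0 mub.
have := @prob_no_low_second_moment R n Y K k KY mu (low_weight 2 ^+ 2) n1 erefl.
move=> /(_ _)-h; have {h} : P0 * mu ^+ 2 <= (1 + k%:R) * mu + (n ^ 2)%:R * low_weight 2 ^+ 2 - mu ^+ 2.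
  apply: h => i j ij; have := prob_disj_low_weight [set i; j].
  by rewrite cards2 ij.
rewrite -ler_pdivlMr ?exprn_gt0 //; move/le_trans; apply.
rewrite mulrBl mulrDl divff ?expf_neq0 ?gt_eqF // lerD2r; apply: lerD.
  have -> : (1 + k%:R) * mu / mu ^+ 2 = k.+1%:R / mu.
    by rewrite -[k.+1]add1n natrD; field; rewrite gt_eqF.
  by rewrite ler_wpM2l // lef_pV2.
rewrite expr_div_n natrX.
have -> : n%:R ^+ 2 * low_weight 2 ^+ 2 / mu ^+ 2 = low_weight 2 ^+ 2 * (n%:R ^+ 2 / mu ^+ 2).
  by rewrite [RHS]mulrA [low_weight 2 ^+ 2 * _]mulrC.
rewrite ler_wpM2l ?sqr_ge0 // ler_pdivrMr ?exprn_gt0 // mulrC ler_pdivlMr ?exprn_gt0 //.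
by rewrite -exprMn lerXn2r ?nnegrE // ltW.
Qed.

(** The expectation of 'C(W, l) for the number W of low nodes, that is, its l-th factorial moment
    over l!. *)
Definition low_tuples (l : nat) : R :=
  \sum_(A : {set 'I_n} | #|A| == l) unifE (fun f => (A \subset low k f)%:R).

Lemma sum_ord_sum_f_R0 (F : nat -> R) (m : nat) : \sum_(l < m.+1) F l = sum_f_R0 F m.
Proof.
elim: m => [|m IH]; first by rewrite big_ord_recl big_ord0 addr0.
by rewrite big_ord_recr /= IH RplusE.
Qed.

Lemma rkg_prob_mindeg_bonferroni (m : nat) :
  Rle (Rabs (Rminus (rkg_prob K (fun f : key_assign n Y => min_degree_ge (rkg_adj f) k))
      (sum_f_R0 (fun l => Rmult (pow (-1) l) (low_tuples l)) m))) (low_tuples m.+1).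
Proof.
apply/RleP; rewrite mindeg_probE RabsE RminusE -sum_ord_sum_f_R0.
have := @prob_no_low_bonferroni R n Y K k m; congr (`|_ - _| <= _).
by apply: eq_bigr => l _; rewrite RmultE RpowE.
Qed.

Lemma card_sets (l : nat) : #|[pred A : {set 'I_n} | #|A| == l]| = 'C(n, l).
Proof.
by rewrite -[n in RHS]card_ord -card_draws; apply: eq_card => A; rewrite !inE.
Qed.

Lemma low_tuples_le (l : nat) (t : R) : (0 < K)%N -> Rlt 0 t -> Rle t 1 ->
  Rle (Rmult (INR l) (xk K Y)) (Rinv 2) ->
  Rle (low_tuples l) (Rmult (INR 'C(n, l)) (Rplus (pow (low_weight l) l)
    (Rmult (pow (INR l) 2)
    (Rmult (Rmult (Rinv (pow t (l * k))) (pow (Rplus 1 (Rmult (Rmult (Rmult 2 (INR l)) t) (xk K Y))) n))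
     (Rmult (Rmult (pow (av K Y (n - l)) K)
       (Rmult (Rmult 2 (xk K Y)) (pow (Rplus (av K Y (n - l)) (yk K Y)) K.-1)))
       (pow (Rplus (av K Y (n - l)) (Rmult (INR l) (yk K Y))) (K * (l - 2)))))))).
Proof.
move=> K0 /RltP t0 /RleP t1 /RleP lx; apply/RleP.
rewrite !(RplusE, RmultE, RpowE, RinvE, INRE, IZR2E) -!xKE -?yKE -?avoidE in lx *.
set E := (X in _ <= _ * (_ + _ * X)).
have x0 : 0 <= xK by apply: xK_ge0.
have y0 : 0 <= yK R 'I_Y K by apply: yK_ge0.
have [a0 _] := andP (avoid01 R 'I_Y K (n - l)).
have E0 : 0 <= E.
  have t0' := ltW t0; rewrite /E; apply: mulr_ge0.
    apply: mulr_ge0; first by rewrite invr_ge0 exprn_ge0.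
    by apply: exprn_ge0; apply: addr_ge0 => //; apply: mulr_ge0 => //; apply: mulr_ge0 => //; apply: mulr_ge0.
  apply: mulr_ge0; last by apply: exprn_ge0; apply: addr_ge0 => //; apply: mulr_ge0.
  apply: mulr_ge0; first exact: exprn_ge0.
  by apply: mulr_ge0; [apply: mulr_ge0 | apply: exprn_ge0; apply: addr_ge0].
apply: (@le_trans _ _ (\sum_(A : {set 'I_n} | #|A| == l) (low_weight l ^+ l + l%:R ^+ 2 * E))); last first.
  by rewrite sumr_const card_sets -[leLHS]mulr_natl.
apply: ler_sum => A /eqP cA; apply: le_trans (@prob_low_le R n Y K k A) _.
apply: lerD; first by rewrite -cA prob_disj_low_weight.
apply: (@le_trans _ _ (\sum_(p : 'I_n * 'I_n | [&& p.1 \in A, p.2 \in A & p.1 != p.2]) E)).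
  apply: ler_sum => -[i j] /= /and3P[iA jA ij].
  have dA : [disjoint A & ~: A] by rewrite disjoints_subset setCK.
  have t01 : 0 < t <= 1 by apply/andP.
  have := @prob_edge_hits_le R _ _ K KP i j A (~: A) (#|A| * k) t dA iA jA ij K0 t01.
  have cD : #|~: A| = (n - l)%N by rewrite cardsC_ord cA.
  rewrite cA cD => /(_ lx)/le_trans; apply; rewrite /E ler_wpM2r //.
    apply: mulr_ge0; last by apply: exprn_ge0; apply: addr_ge0 => //; apply: mulr_ge0.
    apply: mulr_ge0; first exact: exprn_ge0.
    by apply: mulr_ge0; [apply: mulr_ge0 | apply: exprn_ge0; apply: addr_ge0].
  rewrite ler_wpM2l ?invr_ge0 ?exprn_ge0 //; first exact: ltW.
  have tx : 0 <= 2 * l%:R * t * xK.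
    by apply: mulr_ge0 => //; apply: mulr_ge0; [apply: mulr_ge0|apply: ltW].
  by apply: ler_weXn2l; [rewrite lerDl | rewrite leq_subr].
rewrite sumr_const -[leLHS]mulr_natl ler_wpM2r // -natrX ler_nat -cA -mulnn -cardsX.
by rewrite subset_leq_card //; apply/subsetP => -[i j]; rewrite !inE /= => /and3P[-> ->].
Qed.

Lemma low_tuples_le1 (l : nat) : (l <= 1)%N ->
  Rle (low_tuples l) (Rmult (INR 'C(n, l)) (pow (low_weight l) l)).
Proof.
move=> l1; apply/RleP; rewrite !(RmultE, RpowE, INRE).
apply: (@le_trans _ _ (\sum_(A : {set 'I_n} | #|A| == l) low_weight l ^+ l)); last first.
  by rewrite sumr_const card_sets -[leLHS]mulr_natl.
apply: ler_sum => A /eqP cA; apply: le_trans (@prob_low_le R n Y K k A) _.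
rewrite [X in _ + X]big1 ?addr0 => [|[i j] /= /and3P[iA jA ij]].
  by rewrite -cA prob_disj_low_weight.
have : (1 < #|A|)%N by apply/card_gt1P; exists i, j.
by rewrite cA ltnNge l1.
Qed.

(** Only disjoint key sets and outside degrees exactly k - 1 are counted; these configurations carry
    the whole limit. *)
Lemma low_tuples_ge (l : nat) : (k.-1 <= n)%N ->
  Rle 0 (Rminus (edge_prob K Y) (Rmult (INR l) (pow (xk K Y) 2))) ->
  Rle 0 (Rminus 1 (Rmult (INR l) (edge_prob K Y))) ->
  Rle 0 (Rminus 1 (Rmult (INR (l ^ 2)) (xk K Y))) ->
  Rle 0 (Rminus (Rminus 1 (Rdiv (INR (l ^ 2 * k.-1)) (INR n))) (Rdiv (INR (l ^ 2 * k.-1 ^ 2)) (INR n))) ->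
  Rle (Rmult (INR 'C(n, l)) (Rmult (Rmult (pow (INR 'C(n, k.-1)) l)
       (Rminus (Rminus 1 (Rdiv (INR (l ^ 2 * k.-1)) (INR n))) (Rdiv (INR (l ^ 2 * k.-1 ^ 2)) (INR n))))
      (Rmult (Rminus 1 (Rmult (INR (l ^ 2)) (xk K Y)))
         (Rmult (pow (Rminus (edge_prob K Y) (Rmult (INR l) (pow (xk K Y) 2))) (l * k.-1))
           (pow (Rminus 1 (Rmult (INR l) (edge_prob K Y))) n))))) (low_tuples l).
Proof.
move=> kn /RleP h1 /RleP h2 /RleP h3 /RleP h4; apply/RleP.
rewrite !(RminusE, RplusE, RmultE, RdivE, RpowE, RinvE, INRE) -!xKE ?edge_probE in h1 h2 h3 h4 *.
set E := (_ * _ * (_ * _)).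
apply: (@le_trans _ _ (\sum_(A : {set 'I_n} | #|A| == l) E)).
  by rewrite sumr_const card_sets -[leRHS]mulr_natl.
apply: ler_sum => A /eqP cA; apply: le_trans (@prob_low_ge_disj R n Y K k k0 A).
have dA : [disjoint A & ~: A] by rewrite disjoints_subset setCK.
have [q0 q1] := andP (qK01 R KP).
have kI : (k.-1 <= #|'I_n|)%N by rewrite card_ord.
have := @prob_low_ge R 'I_n 'I_Y K KP A (~: A) k.-1 kI dA.
rewrite cA => /(_ h1 h2 q0); apply: le_trans.
have g := prob_good_ge R A kI; rewrite cA card_ord in g.
have d := prob_disj_ge R KP A; rewrite cA in d.
rewrite card_ord /E; apply: ler_pM.
- by rewrite mulr_ge0 ?exprn_ge0.
- by rewrite mulr_ge0 // mulr_ge0 ?exprn_ge0.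
- by rewrite ler_wpM2l ?exprn_ge0.
apply: ler_pM => //; first by rewrite mulr_ge0 ?exprn_ge0.
rewrite ler_wpM2l ?exprn_ge0 //; apply: ler_wiXn2l => //.
  by rewrite lerBlDr lerDl mulr_ge0.
by rewrite -[n in leqRHS]card_ord max_card.
Qed.

End BridgeLow.

End FiniteProbability.
Import FiniteProbability.

(** * Asymptotics of the union bounds *)

Section RealLemmas.
Local Open Scope R_scope.

Lemma le_INR' (a b : nat) : (a <= b)%N -> INR a <= INR b.
Proof. by move=> ab; apply: le_INR; lia. Qed.

Lemma lt_INR' (a b : nat) : (a < b)%N -> INR a < INR b.
Proof. by move=> ab; apply: lt_INR; lia. Qed.

Lemma INR_muln (a b : nat) : INR (a * b)%N = INR a * INR b.
Proof. by rewrite -mult_INR. Qed.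

Lemma INR_expn (a b : nat) : INR (a ^ b)%N = INR a ^ b.
Proof. by elim: b => [|b IH] //; rewrite expnS INR_muln IH. Qed.

Lemma exp_pow (a : R) (m : nat) : exp a ^ m = exp (INR m * a).
Proof.
elim: m => [|m IH]; first by rewrite /= Rmult_0_l exp_0.
by rewrite -tech_pow_Rmult IH -exp_plus S_INR; f_equal; ring.
Qed.

Lemma exp_le (a b : R) : a <= b -> exp a <= exp b.
Proof. by move=> [ab|->]; [left; apply: exp_increasing | right]. Qed.

Lemma exp_ge1 (a : R) : 1 + a <= exp a.
Proof.
have [->|a0] := Req_dec a 0; first by rewrite exp_0; lra.
by have := exp_ineq1 a a0; lra.
Qed.

Lemma pow1B_le_exp (u : R) (m : nat) : u <= 1 -> (1 - u) ^ m <= exp (- (INR m * u)).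
Proof.
move=> u1; apply: Rle_trans (_ : exp (- u) ^ m <= _).
  by apply: pow_incr; have := exp_ge1 (- u); lra.
by rewrite exp_pow; right; f_equal; ring.
Qed.

(** Reduces to exp v (1 - u) >= 1 for v = u + u ^ 2, which follows from exp v >= (1 + v / 2) ^ 2;
    the linear bound exp v >= 1 + v would be too weak. *)
Lemma exp_le_pow1B (u : R) (m : nat) : 0 <= u <= / 4 ->
  exp (- (INR m * (u + u ^ 2))) <= (1 - u) ^ m.
Proof.
move=> [u0 u1]; have -> : exp (- (INR m * (u + u ^ 2))) = exp (- (u + u ^ 2)) ^ m.
  by rewrite exp_pow; f_equal; ring.
apply: pow_incr; split; first exact: Rlt_le (exp_pos _).
have p := exp_pos (u + u ^ 2).
have h : (1 + (u + u ^ 2) / 2) ^ 2 <= exp (u + u ^ 2).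
  have -> : u + u ^ 2 = INR 2 * ((u + u ^ 2) / 2) by rewrite /=; field.
  rewrite -exp_pow; apply: pow_incr; split; last by apply: Rle_trans (exp_ge1 _); rewrite /=; lra.
  by rewrite /=; nra.
rewrite exp_Ropp; apply: (Rmult_le_reg_l (exp (u + u ^ 2))) => //.
rewrite Rinv_r; last by lra.
apply: Rle_trans (Rmult_le_compat_r _ _ _ _ h); last by lra.
have -> : (1 + (u + u ^ 2) / 2) ^ 2 * (1 - u) =
    1 + u ^ 2 * (/ 4 - 3 / 4 * u - / 4 * u ^ 2 - / 4 * u ^ 3) by field.
have u2 : u ^ 2 <= / 16 by nra.
have u3 : u ^ 3 <= / 64 by rewrite -tech_pow_Rmult; nra.
by have := pow2_ge_0 u; nra.
Qed.

Lemma pow_self_le_fact (r : nat) : INR r ^ r <= exp (INR r) * INR (r`!).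
Proof.
elim: r => [|r IH]; first by rewrite /= exp_0; lra.
rewrite factS INR_muln -tech_pow_Rmult.
have h : INR r.+1 ^ r <= exp 1 * INR r ^ r.
  case: r {IH} => [|r]; first by rewrite /=; have := exp_ge1 1; lra.
  have r0 : 0 < INR r.+1 by apply: lt_0_INR; lia.
  have -> : INR r.+2 = INR r.+1 * (1 + / INR r.+1).
    by rewrite (S_INR r.+1); field; lra.
  rewrite Rpow_mult_distr Rmult_comm; apply: Rmult_le_compat_r; first by apply: pow_le; lra.
  apply: Rle_trans (_ : exp (/ INR r.+1) ^ r.+1 <= _).
    apply: pow_incr; split; last exact: exp_ge1.
    by have := Rinv_0_lt_compat _ r0; lra.
  by rewrite exp_pow; right; f_equal; field; lra.
have r0 : 0 <= INR r.+1 by apply: pos_INR.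
apply: Rle_trans (Rmult_le_compat_l _ _ _ r0 h) _.
have -> : exp (INR r.+1) = exp 1 * exp (INR r) by rewrite -exp_plus S_INR; f_equal; ring.
have e0 := exp_pos 1.
have := Rmult_le_compat_l _ _ _ (Rmult_le_pos _ _ r0 (Rlt_le _ _ e0)) IH; lra.
Qed.

Lemma bin_le_pow (n r : nat) : INR 'C(n, r) * INR (r`!) <= INR n ^ r.
Proof. by rewrite -INR_muln bin_ffact -INR_expn; apply: le_INR'; elim: r => [|r IH]; rewrite ?ffactn0 // ffactnSr expnSr leq_mul // leq_subr. Qed.

Lemma bin_le_exp (n r : nat) : (0 < r)%N -> INR 'C(n, r) <= (exp 1 * INR n / INR r) ^ r.
Proof.
move=> r0; have rr : 0 < INR r by apply: lt_0_INR; lia.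
have h1 := bin_le_pow n r; have h2 := pow_self_le_fact r.
rewrite /Rdiv !Rpow_mult_distr exp_pow Rmult_1_r pow_inv.
have p0 : 0 < INR r ^ r by apply: pow_lt.
apply: (Rmult_le_reg_r (INR r ^ r)) => //.
rewrite Rmult_assoc Rinv_l ?Rmult_1_r; last by lra.
apply: Rle_trans (Rmult_le_compat_l _ _ _ (pos_INR _) h2) _.
by have := Rmult_le_compat_l _ _ _ (Rlt_le _ _ (exp_pos (INR r))) h1; lra.
Qed.

(** Two regimes. If rr x <= th, then (1 + rr x / (th K)) ^ K <= e and the sum behaves like its first
    term. Otherwise th < rr x and x / K <= x / 2, so the base is at most 2 rr x <= 1 and K >= 2
    leaves at least its square. *)
Lemma mixed_pow_le (th B x rr : R) (K : nat) : 0 <= th -> th ^ K <= B -> (2 <= K)%N ->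
  0 <= x -> 0 <= rr -> 2 * rr * x <= 1 ->
  (th + rr * (x / INR K)) ^ K <= exp 1 * B + (2 * rr * x) ^ 2.
Proof.
move=> th0 thB K2 x0 r0 rx.
have K2' : 2 <= INR K by have := le_INR' K2; rewrite /=; lra.
have w0 : 0 <= rr * (x / INR K).
  apply: Rmult_le_pos => //; apply: Rmult_le_pos => //; left; apply: Rinv_0_lt_compat; lra.
have B0 : 0 <= B by apply: Rle_trans thB; apply: pow_le.
have e0 := exp_pos 1; have s0 := pow2_ge_0 (2 * rr * x).
have [h|h] := Rle_lt_dec (rr * x) th.
  have [th1|th1] := Rle_lt_or_eq_dec _ _ th0; last first.
    have -> : rr * (x / INR K) = 0.
      have : rr * x = 0 by nra.
      by rewrite /Rdiv -Rmult_assoc => ->; ring.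
    rewrite Rplus_0_r; have : exp 1 * B >= B by have := exp_ge1 1; nra.
    lra.
  apply: Rle_trans (_ : exp 1 * B <= _); last by lra.
  have -> : th + rr * (x / INR K) = th * (1 + rr * x / th / INR K) by field; lra.
  rewrite Rpow_mult_distr Rmult_comm; apply: Rmult_le_compat => //.
  - apply: pow_le; have : 0 <= rr * x / th / INR K; last by lra.
    apply: Rmult_le_pos; last by left; apply: Rinv_0_lt_compat; lra.
    by apply: Rmult_le_pos; [nra | left; apply: Rinv_0_lt_compat].
  - exact: pow_le.
  have h1 : rr * x / th <= 1.
    by apply: (Rmult_le_reg_r th) => //; rewrite /Rdiv Rmult_assoc Rinv_l; lra.
  apply: Rle_trans (_ : exp (/ INR K) ^ K <= _); last first.
    by rewrite exp_pow; right; f_equal; field; lra.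
  apply: pow_incr; split.
    have : 0 <= rr * x / th / INR K; last by lra.
    apply: Rmult_le_pos; last by left; apply: Rinv_0_lt_compat; lra.
    by apply: Rmult_le_pos; [nra | left; apply: Rinv_0_lt_compat].
  apply: Rle_trans (exp_ge1 _); apply: Rplus_le_compat_l.
  rewrite -[X in _ <= X]Rmult_1_l; apply: Rmult_le_compat_r => //.
  by left; apply: Rinv_0_lt_compat; lra.
have hK : x / INR K <= x / 2.
  by apply: Rmult_le_compat_l => //; apply: Rinv_le_contravar; lra.
have hs : th + rr * (x / INR K) <= 2 * rr * x.
  have : rr * (x / INR K) <= rr * (x / 2) by apply: Rmult_le_compat_l.
  by have := Rmult_le_pos _ _ r0 x0; lra.
apply: Rle_trans (_ : (2 * rr * x) ^ K <= _); first by apply: pow_incr; lra.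
have -> : K = (2 + (K - 2))%coq_nat by lia.
rewrite pow_add; have : (2 * rr * x) ^ (K - 2) <= 1.
  rewrite -[X in _ <= X](pow1 (K - 2)); apply: pow_incr; split => //.
  by apply: Rmult_le_pos => //; lra.
have eb : 0 <= exp 1 * B by apply: Rmult_le_pos; lra.
by nra.
Qed.

Lemma pow_le_exp (a : nat) (d c : R) : 0 < d -> 0 < c ->
  exists L0, 0 < L0 /\ forall l, L0 <= l -> l ^ a <= c * exp (d * l).
Proof.
(* exp (d l) is the (a + 1)-st power of exp (b l) >= b l, and the spare factor l beats the
   constants. *)
move=> d0 c0; pose b := d / INR a.+1.
have a0 : 0 < INR a.+1 by apply: lt_0_INR; lia.
have b0 : 0 < b by apply: Rmult_lt_0_compat => //; apply: Rinv_0_lt_compat.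
have B0 : 0 < b ^ a.+1 by apply: pow_lt.
exists (/ (c * b ^ a.+1)); split; first by apply: Rinv_0_lt_compat; apply: Rmult_lt_0_compat.
move=> l hl; have l0 : 0 < l.
  by apply: Rlt_le_trans hl; apply: Rinv_0_lt_compat; apply: Rmult_lt_0_compat.
have -> : d * l = INR a.+1 * (b * l) by rewrite /b; field; lra.
rewrite -exp_pow; apply: Rle_trans (_ : c * (b * l) ^ a.+1 <= _); last first.
  apply: Rmult_le_compat_l; first by lra.
  apply: pow_incr; split; first by nra.
  by have := exp_ge1 (b * l); lra.
rewrite Rpow_mult_distr -(tech_pow_Rmult l).
have : 1 <= c * b ^ a.+1 * l.
  apply: (Rmult_le_reg_l (/ (c * b ^ a.+1))); first by apply: Rinv_0_lt_compat; nra.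
  by rewrite -Rmult_assoc Rinv_l; nra.
by have := pow_lt l a l0; nra.
Qed.

Lemma ln_large (M : R) : exists N : nat, forall n : nat, (N <= n)%N -> M <= ln (INR n).
Proof.
have [N hN] := INR_unbounded (exp M); exists N.+1 => n nN.
have h : exp M < INR n by apply: Rlt_le_trans hN _; apply: le_INR'; lia.
rewrite -(ln_exp M); left; apply: ln_increasing => //; exact: exp_pos.
Qed.

End RealLemmas.

(** * Estimates for n q of order ln n, and the probability of an edge with few outside neighbours *)

Section Regime.
Local Open Scope R_scope.

Definition eventually (P : nat -> Prop) := exists N : nat, forall n : nat, (N <= n)%N -> P n.

Lemma eventually_and (P Q : nat -> Prop) :
  eventually P -> eventually Q -> eventually (fun n => P n /\ Q n).
Proof.
move=> [N1 h1] [N2 h2]; exists (maxn N1 N2) => n; rewrite geq_max => /andP[a b].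
by split; [apply: h1 | apply: h2].
Qed.

Lemma eventually_imp (P Q : nat -> Prop) :
  (forall n, P n -> Q n) -> eventually P -> eventually Q.
Proof. by move=> PQ [N h]; exists N => n /h/PQ. Qed.

Lemma eventually_true (P : nat -> Prop) : (forall n, P n) -> eventually P.
Proof. by move=> h; exists 0%N. Qed.

Lemma eventually_ln (Q : R -> Prop) :
  (exists L0, forall l, L0 <= l -> Q l) -> eventually (fun n => Q (ln (INR n))).
Proof. by move=> [L0 h]; have [N hN] := ln_large L0; exists N => n /hN/h. Qed.

Lemma eventually_pow_le_exp (a : nat) (d c : R) : 0 < d -> 0 < c ->
  eventually (fun n => ln (INR n) ^ a <= c * exp (d * ln (INR n))).
Proof.
move=> d0 c0; apply: (eventually_ln (Q := fun l => l ^ a <= c * exp (d * l))).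
by have [L0 [_ h]] := pow_le_exp a d0 c0; exists L0.
Qed.

Lemma eventually_ln_ge (M : R) : eventually (fun n => M <= ln (INR n)).
Proof. exact: ln_large. Qed.

Lemma exp_ln_INR (n : nat) : 0 < ln (INR n) -> exp (ln (INR n)) = INR n.
Proof.
case: n => [|n]; last by move=> _; rewrite exp_ln //; apply: lt_0_INR; lia.
(* For n = 0 the logarithm takes its default value 0, against the hypothesis. *)
move=> h; exfalso; move: h; rewrite /= /ln; case: (Rlt_dec 0 0) => /= [a|_]; [by case: (Rlt_irrefl 0) | exact: Rlt_irrefl].
Qed.

(** From 1 - q <= (1 - K / Y) ^ K <= exp (- x) <= 1 / (1 + x) one gets x (1 - q) <= q. The error 2 q
    ^ 2 is quadratic, so that n (x - q) vanishes for n q of order ln n. *)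
Lemma xk_le_edge_prob (K Y : nat) : (0 < K)%N -> (K <= Y)%N -> edge_prob K Y <= / 2 ->
  xk K Y <= edge_prob K Y + 2 * edge_prob K Y ^ 2 /\ xk K Y <= 2 * edge_prob K Y.
Proof.
move=> K0 KY q2; have q0 := edge_prob_ge0 KY; have h := edge_prob_ge_pow KY.
set q := edge_prob K Y in q2 q0 h *; have Kp : 0 < INR K by apply: lt_0_INR; lia.
have Yp : 0 < INR Y by apply: lt_0_INR; lia.
have y1 : yk K Y <= 1.
  rewrite /yk; apply: (Rmult_le_reg_r (INR Y)) => //.
  by rewrite /Rdiv Rmult_assoc Rinv_l; have := le_INR' KY; lra.
have x0 : 0 <= xk K Y.
  by rewrite /xk; apply: Rmult_le_pos; [lra | apply: Rmult_le_pos; [lra | left; apply: Rinv_0_lt_compat]].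
have hx : (1 - yk K Y) ^ K <= exp (- xk K Y) by apply: (pow1B_le_exp K y1).
have he := exp_ge1 (xk K Y); have p := exp_pos (xk K Y).
have h1 : exp (- xk K Y) * (1 + xk K Y) <= 1.
  rewrite exp_Ropp; apply: (Rmult_le_reg_l (exp (xk K Y))) => //.
  by rewrite -Rmult_assoc Rinv_r; lra.
set x := xk K Y in x0 hx h1 *; have h2 : x * (1 - q) <= q by nra.
split; last by nra.
have : (x - q - 2 * q ^ 2) * (1 - q) <= 0; last by nra.
have -> : (x - q - 2 * q ^ 2) * (1 - q) = x * (1 - q) - q - q ^ 2 * (1 - 2 * q) by ring.
by have := pow2_ge_0 q; nra.
Qed.

Definition regime (k : nat) (C0 C : R) (n K Y : nat) : Prop :=
  [/\ (2 <= K)%N, (K <= Y)%N, INR n * edge_prob K Y <= C0 * ln (INR n) &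
   ln (INR n) + (INR k - 1) * ln (ln (INR n)) - C <= INR n * edge_prob K Y].

Lemma av_pow_le (K Y b : nat) : (0 < Y)%N -> av K Y b ^ K <= exp (- (INR b * xk K Y)).
Proof.
move=> Y0; have Yp : 1 <= INR Y by have := le_INR' Y0; rewrite /=; lra.
have iY : / INR Y <= 1 by rewrite -Rinv_1; apply: Rinv_le_contravar; lra.
rewrite /av -pow_mult; apply: Rle_trans (pow1B_le_exp _ iY) _.
right; f_equal; f_equal; rewrite mult_INR INR_muln /xk; field; lra.
Qed.

Lemma av_ge0 (K Y b : nat) : (0 < Y)%N -> 0 <= av K Y b.
Proof.
move=> Y0; have Yp : 1 <= INR Y by have := le_INR' Y0; rewrite /=; lra.
have iY : / INR Y <= 1 by rewrite -Rinv_1; apply: Rinv_le_contravar; lra.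
by apply: pow_le; lra.
Qed.

Lemma regime_facts (k : nat) (C0 C d : R) : (0 < k)%N -> 0 < C0 -> 0 < d ->
  eventually (fun n => forall K Y, regime k C0 C n K Y ->
    [/\ 0 < ln (INR n), 0 <= xk K Y <= 2 * C0 * ln (INR n) / INR n, xk K Y <= d,
        exp (- (INR n * xk K Y)) <= exp C / INR n &
        ln (INR n) - C <= INR n * xk K Y]).
Proof.
move=> k0 C00 d0.
have c0 : 0 < Rmin (/ 2) d / (2 * C0).
  by apply: Rmult_lt_0_compat; [apply: Rmin_glb_lt; lra | apply: Rinv_0_lt_compat; lra].
have := eventually_and (eventually_ln_ge 1) (eventually_pow_le_exp 1 Rlt_0_1 c0).
apply: eventually_imp => n [l1]; set l := ln (INR n) in l1 *.
rewrite pow_1 Rmult_1_l exp_ln_INR; last by rewrite -/l; lra.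
move=> ln_n K Y [K2 KY]; rewrite -/l => Lu Ll.
have np : 0 < INR n.
  by rewrite -exp_ln_INR; [apply: exp_pos | rewrite -/l; lra].
have q0 := edge_prob_ge0 KY.
have hq : edge_prob K Y <= C0 * l / INR n.
  apply: (Rmult_le_reg_l (INR n)) => //; rewrite /Rdiv.
  by rewrite (Rmult_comm _ (/ INR n)) -Rmult_assoc Rinv_r; lra.
have hd : 2 * (C0 * l / INR n) <= Rmin (/ 2) d.
  apply: (Rmult_le_reg_l (INR n)) => //.
  have -> : INR n * (2 * (C0 * l / INR n)) = 2 * C0 * l by field; lra.
  have := Rmult_le_compat_l (2 * C0) _ _ ltac:(lra) ln_n.
  have -> : 2 * C0 * (Rmin (/ 2) d / (2 * C0) * INR n) = INR n * Rmin (/ 2) d by field; lra.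
  by [].
have m1 := Rmin_l (/ 2) d; have m2 := Rmin_r (/ 2) d.
have K0 : (0 < K)%N by lia.
have [_ x2] := xk_le_edge_prob K0 KY ltac:(lra).
have qx := edge_prob_le_xk KY.
have nx : l - C <= INR n * xk K Y.
  have : 0 <= (INR k - 1) * ln l.
    apply: Rmult_le_pos; first by have := le_INR' k0; rewrite /=; lra.
    by have [l1'|<-] := l1; [rewrite -ln_1; left; apply: ln_increasing; lra | rewrite ln_1; lra].
  by have := Rmult_le_compat_l _ _ _ (Rlt_le _ _ np) qx; lra.
split=> //.
- by lra.
- by split; [lra | have -> : 2 * C0 * l / INR n = 2 * (C0 * l / INR n) by field; lra]; lra.
- by lra.
- apply: Rle_trans (_ : exp (C - l) <= _); first by apply: exp_le; lra.
  by rewrite /Rminus exp_plus exp_Ropp exp_ln_INR; [right|rewrite -/l; lra].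
Qed.

(* Probability bound for an edge inside a set of [l] nodes with at most [m]
   neighbours outside; [t] is the parameter of the exponential Markov bound. *)
Definition edge_term (n K Y l m : nat) (t : R) : R :=
  (/ t ^ m * (1 + 2 * INR l * t * xk K Y) ^ n) *
  ((av K Y (n - l) ^ K * (2 * xk K Y * (av K Y (n - l) + yk K Y) ^ K.-1)) *
   (av K Y (n - l) + INR l * yk K Y) ^ (K * (l - 2))).

Lemma edge_term_small (k : nat) (C0 C : R) (l : nat) : (0 < k)%N -> 1 <= C0 -> (2 <= l)%N ->
  exists t e0, [/\ 0 < t, t <= 1, 0 < e0 & forall e, 0 < e ->
   eventually (fun n => forall K Y, regime k C0 C n K Y -> INR l * xk K Y <= / 2 /\
     forall m, INR m <= e0 * ln (INR n) -> INR n ^ l * edge_term n K Y l m t <= e)].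
Proof.
move=> k0 C01 l2; have lp : 2 <= INR l by have := le_INR' l2; rewrite /=; lra.
(* With t = 1 / T the factor (1 + 2 l t x) ^ n is at most n ^ (1/10), and m <= ln n / (10 ln T)
   gives the same bound for t ^ (- m). Together they use n ^ (1/5) of the n ^ (1/2) gained from the
   edge. *)
pose T := 40 * INR l * C0; have T1 : 40 <= T by rewrite /T; nra.
have lnT : 0 < ln T by rewrite -ln_1; apply: ln_increasing; lra.
exists (/ T), (/ (10 * ln T)); split.
- by apply: Rinv_0_lt_compat; lra.
- by rewrite -Rinv_1; apply: Rinv_le_contravar; lra.
- by apply: Rinv_0_lt_compat; lra.
move=> e e0; pose A := exp (C + 1); pose D := exp 1 * A + 1.
have A0 : 0 < A by apply: exp_pos.
have D0 : 1 < D by rewrite /D; have := exp_pos 1; nra.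
pose c := 4 * A * C0 * sqrt D * D ^ (l - 2).
have c0 : 0 < c.
  by repeat apply: Rmult_lt_0_compat; try lra; [apply: sqrt_lt_R0; lra | apply: pow_lt; lra].
have d0 : 0 < / (2 * INR l) by apply: Rinv_0_lt_compat; lra.
have ec : 0 < e / c by apply: Rmult_lt_0_compat => //; apply: Rinv_0_lt_compat.
have cc : 0 < / (16 * INR l ^ 2 * C0 ^ 2).
  by apply: Rinv_0_lt_compat; have := pow_lt (INR l) 2 ltac:(lra); have := pow_lt C0 2 ltac:(lra); nra.
have := eventually_and (regime_facts C k0 (Rlt_le_trans _ _ _ Rlt_0_1 C01) d0)
  (eventually_and (eventually_pow_le_exp 1 (ltac:(lra) : 0 < 3 / 10) ec)
  (eventually_and (eventually_pow_le_exp 2 Rlt_0_1 cc)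
  (eventually_and (eventually_ln_ge (ln D)) (eventually_ln_ge (ln (INR l) + 1))))).
apply: eventually_imp => n [rf [le1 [le2 [lD ll]]]] K Y reg.
have [] := rf K Y reg; have [K2 KY _ _] := reg.
set L := ln (INR n) in le1 le2 lD ll *; set x := xk K Y => L0 [x0 x1] xd ex _.
have nE : exp L = INR n by apply: exp_ln_INR.
have np : 0 < INR n by rewrite -nE; apply: exp_pos.
have lx : INR l * x <= / 2.
  have := Rmult_le_compat_l (INR l) _ _ ltac:(lra) xd.
  by have -> : INR l * / (2 * INR l) = / 2 by field; lra.
split=> // m hm.
have Y0 : (0 < Y)%N by lia.
have ln' : (l <= n)%N.
  apply/leP; apply: INR_le; rewrite -nE.
  apply: Rle_trans (_ : exp (ln (INR l)) <= _); first by rewrite exp_ln; lra.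
  by apply: exp_le; lra.
have nl : INR (n - l) = INR n - INR l by rewrite -minus_INR //; apply/leP.
have a0 := av_ge0 K (n - l) Y0.
have aK : av K Y (n - l) ^ K <= A / INR n.
  apply: Rle_trans (av_pow_le K (n - l) Y0) _; rewrite nl -/x.
  have -> : - ((INR n - INR l) * x) = - (INR n * x) + INR l * x by ring.
  rewrite exp_plus /A exp_plus.
  have : exp (INR l * x) <= exp 1 by apply: exp_le; lra.
  have e1 := exp_pos (INR l * x); have e2 := exp_pos (- (INR n * x)).
  move=> h; apply: Rle_trans (Rmult_le_compat _ _ _ _ _ _ ex h) _; lra.
have l2x : (2 * INR l * x) ^ 2 <= / INR n.
  apply: Rle_trans (_ : (2 * INR l * (2 * C0 * L / INR n)) ^ 2 <= _).
    by apply: pow_incr; nra.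
  have -> : (2 * INR l * (2 * C0 * L / INR n)) ^ 2 =
     (L ^ 2 * (16 * INR l ^ 2 * C0 ^ 2)) * / INR n ^ 2 by field; lra.
  have -> : / INR n = INR n * / INR n ^ 2 by field; lra.
  apply: Rmult_le_compat_r; first by left; apply: Rinv_0_lt_compat; apply: pow_lt.
  rewrite Rmult_1_l nE in le2.
  have p : 0 < 16 * INR l ^ 2 * C0 ^ 2.
    by have := pow_lt (INR l) 2 ltac:(lra); have := pow_lt C0 2 ltac:(lra); nra.
  apply: Rle_trans (Rmult_le_compat_r _ _ _ (Rlt_le _ _ p) le2) _.
  by right; field; split; lra.
have mix rr : 0 <= rr -> rr <= INR l -> (av K Y (n - l) + rr * yk K Y) ^ K <= D / INR n.
  move=> r0 rl.
  have -> : yk K Y = x / INR K.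
    rewrite /x /xk /yk; field; split; apply: Rgt_not_eq; apply: lt_0_INR; lia.
  apply: Rle_trans (mixed_pow_le a0 aK K2 x0 r0 _) _; first by nra.
  have : (2 * rr * x) ^ 2 <= (2 * INR l * x) ^ 2 by apply: pow_incr; nra.
  by rewrite /D /Rdiv; lra.
have y0 : 0 <= yk K Y.
  by apply: Rmult_le_pos; [apply: pos_INR | left; apply: Rinv_0_lt_compat; apply: lt_0_INR; lia].
have s0 : 0 <= av K Y (n - l) + yk K Y by lra.
have sK := mix 1 ltac:(lra) ltac:(lra); rewrite Rmult_1_l in sK.
have Dn : D / INR n <= 1.
  apply: (Rmult_le_reg_r (INR n)) => //; rewrite /Rdiv Rmult_assoc Rinv_l ?Rmult_1_r ?Rmult_1_l; try lra.
  rewrite -nE; apply: Rle_trans (exp_le lD); rewrite exp_ln; lra.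
have s1 : av K Y (n - l) + yk K Y <= 1.
  apply: Rnot_lt_le => s1; have : 1 < (av K Y (n - l) + yk K Y) ^ K by apply: Rlt_pow_R1; [lra | lia].
  by lra.
(* The base is at most 1 and 2 (K - 1) = K + (K - 2) >= K, so the square of this power is at most D
   / n. This is where K >= 2 makes an edge profitable. *)
have sK1 : (av K Y (n - l) + yk K Y) ^ K.-1 <= sqrt D * exp (- L / 2).
  set s := (_ + _) in s0 sK s1 *.
  apply: Rsqr_incr_0_var; last by apply: Rmult_le_pos; [apply: sqrt_pos | left; apply: exp_pos].
  rewrite Rsqr_mult Rsqr_sqrt; last by lra.
  have -> : Rsqr (exp (- L / 2)) = / INR n.
    by rewrite /Rsqr -exp_plus -nE -exp_Ropp; f_equal; field.
  apply: Rle_trans sK; rewrite /Rsqr -pow_add.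
  have -> : (K.-1 + K.-1)%coq_nat = (K + (K - 2))%coq_nat by lia.
  rewrite pow_add -[X in _ <= X]Rmult_1_r; apply: Rmult_le_compat_l; first exact: pow_le.
  by rewrite -(pow1 (K - 2)); apply: pow_incr.
have t1 : / (/ T) ^ m <= exp (L / 10).
  rewrite pow_inv Rinv_inv.
  have -> : T ^ m = exp (INR m * ln T) by rewrite -exp_pow exp_ln //; lra.
  apply: exp_le; apply: Rle_trans (Rmult_le_compat_r _ _ _ (Rlt_le _ _ lnT) hm) _.
  by right; field; lra.
have t2 : (1 + 2 * INR l * / T * x) ^ n <= exp (L / 10).
  apply: Rle_trans (_ : exp (2 * INR l * / T * x) ^ n <= _).
    apply: pow_incr; split; last exact: exp_ge1.
    have : 0 <= 2 * INR l * / T * x; last by lra.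
    by repeat apply: Rmult_le_pos => //; try lra; left; apply: Rinv_0_lt_compat; lra.
  rewrite exp_pow; apply: exp_le.
  apply: Rle_trans (_ : INR n * (2 * INR l * / T * (2 * C0 * L / INR n)) <= _).
    apply: Rmult_le_compat_l; first by lra.
    apply: Rmult_le_compat_l => //.
    by repeat apply: Rmult_le_pos => //; try lra; left; apply: Rinv_0_lt_compat; lra.
  by right; rewrite /T; field; lra.
have lst : (av K Y (n - l) + INR l * yk K Y) ^ (K * (l - 2)) <= (D / INR n) ^ (l - 2).
  rewrite pow_mult; apply: pow_incr; split; last by apply: mix; lra.
  by apply: pow_le; nra.
have x2 : 2 * x <= 4 * C0 * L / INR n.
  have -> : 4 * C0 * L / INR n = 2 * (2 * C0 * L / INR n) by field; lra.
  lra.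
have ae := exp_pos (L / 10); have be := exp_pos (- L / 2); have sq := sqrt_pos D.
have tp : 0 < / T by apply: Rinv_0_lt_compat; lra.
have tx0 : 0 <= 2 * INR l * / T * x.
  by apply: Rmult_le_pos => //; apply: Rmult_le_pos; lra.
have b1 : / (/ T) ^ m * (1 + 2 * INR l * / T * x) ^ n <= exp (L / 10) * exp (L / 10).
  apply: Rmult_le_compat => //; first by left; apply: Rinv_0_lt_compat; apply: pow_lt.
  by apply: pow_le; lra.
have b2 : 2 * x * (av K Y (n - l) + yk K Y) ^ K.-1 <= 4 * C0 * L / INR n * (sqrt D * exp (- L / 2)).
  by apply: Rmult_le_compat => //; [lra | apply: pow_le].
have p2 : 0 <= 2 * x * (av K Y (n - l) + yk K Y) ^ K.-1.
  by apply: Rmult_le_pos; [lra | apply: pow_le].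
have p3 : 0 <= av K Y (n - l) ^ K by apply: pow_le.
have p4 : 0 <= (av K Y (n - l) + INR l * yk K Y) ^ (K * (l - 2)) by apply: pow_le; nra.
have b3 := Rmult_le_compat _ _ _ _ p3 p2 aK b2.
have b4 := Rmult_le_compat _ _ _ _ (Rmult_le_pos _ _ p3 p2) p4 b3 lst.
have p5 : 0 <= / (/ T) ^ m * (1 + 2 * INR l * / T * x) ^ n.
  apply: Rmult_le_pos; first by left; apply: Rinv_0_lt_compat; apply: pow_lt.
  by apply: pow_le; lra.
have b5 := Rmult_le_compat _ _ _ _ p5 (Rmult_le_pos _ _ (Rmult_le_pos _ _ p3 p2) p4) b1 b4.
apply: Rle_trans (Rmult_le_compat_l (INR n ^ l) _ _ _ b5) _; first by apply: pow_le; lra.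
(* The exponent 3/10 is 1/2 - 1/10 - 1/10; all powers of n cancel. *)
apply: Rle_trans (_ : c * (L * exp (- (3 / 10 * L))) <= _).
  right; rewrite /c /Rdiv (Rpow_mult_distr D) pow_inv.
  have -> : INR n ^ l = INR n ^ 2 * INR n ^ (l - 2).
    by rewrite -pow_add; f_equal; lia.
  have -> : exp (- (3 * / 10 * L)) = exp (L * / 10) * exp (L * / 10) * exp (- L * / 2).
    by rewrite -!exp_plus; f_equal; field.
  by field; split; [apply: pow_nonzero; lra | lra].
rewrite pow_1 in le1; have ep := exp_pos (3 / 10 * L).
rewrite exp_Ropp.
apply: Rle_trans (_ : c * (e / c * exp (3 / 10 * L) * / exp (3 / 10 * L)) <= _).
  apply: Rmult_le_compat_l; first by lra.
  by apply: Rmult_le_compat_r => //; left; apply: Rinv_0_lt_compat.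
by right; field; split; lra.
Qed.

End Regime.

(** * Cuts of size between a multiple of ln n and 2 n / (ln n)^3 *)

Section Cuts.
Local Open Scope R_scope.

Lemma ln_le_sub1 (z : R) : 0 < z -> ln z <= z - 1.
Proof.
move=> z0; have := exp_ge1 (ln z); rewrite exp_ln //; lra.
Qed.

Lemma bin_le_exp_ln (n r : nat) : (0 < r)%N -> (0 < n)%N ->
  INR 'C(n, r) <= exp (INR r * (1 - ln (INR r / INR n))).
Proof.
move=> r0 n0; have rp : 0 < INR r by apply: lt_0_INR; lia.
have np : 0 < INR n by apply: lt_0_INR; lia.
apply: Rle_trans (bin_le_exp n r0) _; right.
rewrite -exp_pow; f_equal; rewrite /Rminus exp_plus; rewrite /Rdiv Rmult_assoc; f_equal.
rewrite -ln_Rinv; last by apply: Rmult_lt_0_compat => //; apply: Rinv_0_lt_compat.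
rewrite exp_ln; first by field; lra.
by apply: Rinv_0_lt_compat; apply: Rmult_lt_0_compat => //; apply: Rinv_0_lt_compat.
Qed.

Lemma bin_le_exp_n (n r : nat) : (0 < r)%N -> (0 < n)%N -> INR 'C(n, r) <= exp (INR n).
Proof.
move=> r0 n0; have rp : 0 < INR r by apply: lt_0_INR; lia.
have np : 0 < INR n by apply: lt_0_INR; lia.
apply: Rle_trans (bin_le_exp_ln r0 n0) _; apply: exp_le.
have rn : 0 < INR r / INR n by apply: Rmult_lt_0_compat => //; apply: Rinv_0_lt_compat.
have := ln_le_sub1 (Rinv_0_lt_compat _ rn); rewrite ln_Rinv // => h.
have : INR r * (1 - ln (INR r / INR n)) <= INR r * / (INR r / INR n).
  by apply: Rmult_le_compat_l; lra.
by have -> : INR r * / (INR r / INR n) = INR n by field; lra.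
Qed.

Definition nfloor (z : R) : nat := Z.to_nat (Int_part z).

Lemma nfloorP (z : R) : 0 <= z -> INR (nfloor z) <= z < INR (nfloor z) + 1.
Proof.
move=> z0; have [h1 h2] := base_Int_part z.
have i0 : (0 <= Int_part z)%Z.
  have : (-1 < Int_part z)%Z by apply: lt_IZR; rewrite /=; lra.
  by lia.
rewrite /nfloor INR_IZR_INZ (_ : Z.of_nat (Z.to_nat (Int_part z)) = Int_part z); last by lia.
by lra.
Qed.

Lemma eventually_lnln_ge (M : R) : eventually (fun n => M <= ln (ln (INR n))).
Proof.
apply: eventually_imp (eventually_ln_ge (exp M)) => n h.
by rewrite -(ln_exp M); have [h'|<-] := h; [left; apply: ln_increasing => //; apply: exp_pos | right].
Qed.

Lemma eventually_lnln_pow (a : nat) (c : R) : 0 < c ->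
  eventually (fun n => ln (ln (INR n)) ^ a <= c * ln (INR n)).
Proof.
move=> c0; have [L0 [_ h]] := pow_le_exp a Rlt_0_1 c0.
have := eventually_and (eventually_ln_ge 1) (eventually_lnln_ge L0).
apply: eventually_imp => n [l1 lL]; have := h _ lL.
by rewrite Rmult_1_l exp_ln; lra.
Qed.

(** Each of the at most n + 1 sizes in a union bound is allowed a contribution of n ^ (-2). *)
Lemma union_small (e : R) : 0 < e ->
  eventually (fun n => INR n.+1 * exp (- (2 * ln (INR n))) <= e).
Proof.
move=> e0; have := eventually_and (eventually_ln_ge 1) (eventually_ln_ge (2 / e)).
apply: eventually_imp => n [l1 l2]; set l := ln (INR n) in l1 l2 *.
have nE : exp l = INR n by apply: exp_ln_INR; rewrite -/l; lra.
have e1 := exp_ge1 l; rewrite S_INR -nE.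
have -> : exp (- (2 * l)) = / exp l * / exp l by rewrite -exp_Ropp -exp_plus; f_equal; ring.
have i1 : / exp l <= 1 by rewrite -Rinv_1; apply: Rinv_le_contravar; lra.
have i0 : 0 < / exp l by apply: Rinv_0_lt_compat; lra.
have -> : (exp l + 1) * (/ exp l * / exp l) = (1 + / exp l) * / exp l by field; lra.
apply: Rle_trans (_ : 2 * / exp l <= _); first by nra.
apply: (Rmult_le_reg_r (exp l)); first by lra.
rewrite Rmult_assoc Rinv_l; last by lra.
have : e * (2 / e) <= e * exp l by apply: Rmult_le_compat_l; lra.
have -> : e * (2 / e) = 2 by field; lra.
lra.
Qed.

Lemma cut_sparse_small (k : nat) (C0 C e0 e : R) : (0 < k)%N -> 1 <= C0 -> 0 < e0 -> 0 < e ->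
  eventually (fun n => forall K Y, regime k C0 C n K Y -> forall r1 r2 : nat,
    e0 * ln (INR n) <= INR r1 -> INR r2 <= 2 * INR n / ln (INR n) ^ 3 ->
    rkg_prob K (fun f : key_assign n Y => cut_in f k r1 r2) <= e).
Proof.
move=> k0 C01 e00 ep; pose A := exp (C + 1); have A0 : 0 < A by apply: exp_pos.
pose E := exp 1; have Ep : 0 < E by apply: exp_pos.
(* The two terms of [mixed_pow_le] times e n / r: the first is e ^ 2 A / r with r >= e0 ln n, the
   second 4 e n r x ^ 2 with r <= 2 n / (ln n) ^ 3. Both are of order 1 / ln n. *)
pose c4 := E * E * A / e0 + 32 * E * C0 ^ 2.
have c40 : 0 < c4.
  have : 0 < E * E * A / e0.
    by apply: Rmult_lt_0_compat; [repeat apply: Rmult_lt_0_compat | apply: Rinv_0_lt_compat].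
  by rewrite /c4; have := pow_lt C0 2 ltac:(lra); nra.
(* For r >= e0 l, exp (- M r) is at most exp (- (k + 4) l), which absorbs k n ^ k <= exp ((k + 1) l)
   and leaves n ^ (-3). *)
pose M := (INR k + 4) / e0.
have kp : 1 <= INR k by have := le_INR' k0; rewrite /=; lra.
have d0 : 0 < / (2 * INR k) by apply: Rinv_0_lt_compat; lra.
have := eventually_and (regime_facts C k0 (Rlt_le_trans _ _ _ Rlt_0_1 C01) d0)
  (eventually_and (union_small ep)
  (eventually_and (eventually_ln_ge (c4 * exp M))
  (eventually_and (eventually_ln_ge (INR k)) (eventually_ln_ge (8 * C0 + / e0))))).
apply: eventually_imp => n [rf [un [lM [lk l8]]]] K Y reg r1 r2 hr1 hr2.
have [] := rf K Y reg; have [K2 KY _ _] := reg.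
set l := ln (INR n) in un lM lk l8 hr1 hr2 *; set x := xk K Y => L0 [x0 x1] xd ex _.
have nE : exp l = INR n by apply: exp_ln_INR.
have np : 0 < INR n by rewrite -nE; apply: exp_pos.
have n0 : (0 < n)%N by apply/ltP; apply: INR_lt.
have Y0 : (0 < Y)%N by lia.
apply: Rle_trans (rkg_prob_cut_sparse KY n0 (Rlt_le _ _ (exp_pos (- (2 * l)))) _) un.
move=> r /andP[r1r rr2] rn.
have e0i : 0 < / e0 by apply: Rinv_0_lt_compat.
have l8' : 8 * C0 <= l by lra.
have rl : e0 * l <= INR r by apply: Rle_trans hr1 (le_INR' r1r).
have ru : INR r <= 2 * INR n / l ^ 3 by apply: Rle_trans hr2; apply: le_INR'.
have el : 1 <= e0 * l.
  have -> : 1 = e0 * / e0 by field; lra.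
  by apply: Rmult_le_compat_l; lra.
have rp : 0 < INR r by nra.
have r0 : (0 < r)%N by apply/ltP; apply: INR_lt.
have l3 : 0 < l ^ 3 by apply: pow_lt.
have rx : INR r * x <= 4 * C0 / l ^ 2.
  apply: Rle_trans (_ : 2 * INR n / l ^ 3 * (2 * C0 * l / INR n) <= _).
    by apply: Rmult_le_compat => //; lra.
  by right; field; lra.
have l2 : 64 * C0 <= l ^ 2 by nra.
have rx' : INR r * x <= / 16.
  apply: Rle_trans rx _; apply: (Rmult_le_reg_r (l ^ 2)); first by apply: pow_lt.
  by rewrite /Rdiv Rmult_assoc Rinv_l; [lra | apply: pow_nonzero; lra].
have kx : INR k * x <= / 2.
  have h : INR k * x <= INR k * / (2 * INR k) by apply: Rmult_le_compat_l; lra.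
  by apply: Rle_trans h _; right; field; lra.
have a0 := av_ge0 K (n - r - k) Y0.
have nb : INR n - INR r - INR k <= INR (n - r - k).
  have [h|h] := leqP (r + k) n.
    rewrite minus_INR; last by lia.
    by rewrite minus_INR; [lra | lia].
  have : INR n <= INR (r + k) by apply: le_INR'; lia.
  by rewrite plus_INR; have := pos_INR (n - r - k); lra.
have aK : av K Y (n - r - k) ^ K <= A / INR n.
  apply: Rle_trans (av_pow_le K _ Y0) _.
  apply: Rle_trans (_ : exp (- (INR n * x)) * exp 1 <= _).
    rewrite -exp_plus; apply: exp_le; rewrite -/x.
    have : (INR n - INR r - INR k) * x <= INR (n - r - k) * x by apply: Rmult_le_compat_r.
    by lra.
  rewrite /A exp_plus; have := Rmult_le_compat_r _ _ _ (Rlt_le _ _ (exp_pos 1)) ex; lra.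
have yE : yk K Y = x / INR K.
  by rewrite /x /xk /yk; field; split; apply: Rgt_not_eq; apply: lt_0_INR; lia.
have mix := @mixed_pow_le _ _ x (INR r) K a0 aK K2 x0 (pos_INR r) ltac:(lra).
rewrite -yE in mix.
have B0 : 0 <= av K Y (n - r - k) + INR r * yk K Y.
  have : 0 <= yk K Y.
    by apply: Rmult_le_pos; [apply: pos_INR | left; apply: Rinv_0_lt_compat; apply: lt_0_INR; lia].
  by move=> y0; nra.
have base : E * INR n / INR r * (av K Y (n - r - k) + INR r * yk K Y) ^ K <= c4 / l.
  have en0 : 0 <= E * INR n / INR r.
    by apply: Rmult_le_pos; [nra | left; apply: Rinv_0_lt_compat].
  apply: Rle_trans (Rmult_le_compat_l _ _ _ en0 mix) _.
  rewrite Rmult_plus_distr_l /c4 Rdiv_plus_distr; apply: Rplus_le_compat.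
    have -> : E * INR n / INR r * (exp 1 * (A / INR n)) = E * E * A * / INR r by rewrite /E; field; lra.
    have -> : E * E * A / e0 / l = E * E * A * / (e0 * l) by field; lra.
    apply: Rmult_le_compat_l; first by repeat apply: Rmult_le_pos; lra.
    by apply: Rinv_le_contravar; lra.
  have -> : E * INR n / INR r * (2 * INR r * x) ^ 2 = 4 * E * INR n * ((INR r * x) * x) by field; lra.
  apply: Rle_trans (_ : 4 * E * INR n * (4 * C0 / l ^ 2 * (2 * C0 * l / INR n)) <= _).
    apply: Rmult_le_compat_l; first by nra.
    by apply: Rmult_le_compat => //; apply: Rmult_le_pos; lra.
  by right; field; lra.
have cl : c4 / l <= exp (- M).
  apply: (Rmult_le_reg_r l) => //; rewrite /Rdiv Rmult_assoc Rinv_l ?Rmult_1_r; last by lra.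
  have := Rmult_le_compat_l _ _ _ (Rlt_le _ _ (exp_pos (- M))) lM.
  by have -> : exp (- M) * (c4 * exp M) = c4 by rewrite exp_Ropp; field; have := exp_pos M; lra.
apply: Rle_trans (_ : (E * INR n / INR r * (av K Y (n - r - k) + INR r * yk K Y) ^ K) ^ r * INR (k * n ^ k) <= _).
  rewrite (Rpow_mult_distr (E * INR n / INR r)) -(pow_mult _ K r) -/(muln K r).
  have h := bin_le_exp n r0; rewrite -/E in h.
  have p : 0 <= INR (k * n ^ k) * (av K Y (n - r - k) + INR r * yk K Y) ^ (K * r).
    by apply: Rmult_le_pos; [apply: pos_INR | apply: pow_le].
  have := Rmult_le_compat_r _ _ _ p h.
  by lra.
apply: Rle_trans (_ : exp (- M) ^ r * INR (k * n ^ k) <= _).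
  apply: Rmult_le_compat_r; first exact: pos_INR.
  apply: pow_incr; split; last by lra.
  by apply: Rmult_le_pos; [apply: Rmult_le_pos; [nra | left; apply: Rinv_0_lt_compat] | apply: pow_le].
rewrite INR_muln INR_expn -nE !exp_pow.
apply: Rle_trans (_ : exp (- ((INR k + 4) * l)) * (exp l * exp (INR k * l)) <= _).
  apply: Rmult_le_compat.
  - by left; apply: exp_pos.
  - by apply: Rmult_le_pos; [lra | left; apply: exp_pos].
  - apply: exp_le; have : M * (e0 * l) <= M * INR r.
      apply: Rmult_le_compat_l => //; rewrite /M; apply: Rmult_le_pos; lra.
    have -> : M * (e0 * l) = (INR k + 4) * l by rewrite /M; field; lra.
    lra.
  - by apply: Rmult_le_compat_r; [left; apply: exp_pos | have := exp_ge1 l; lra].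
by rewrite -!exp_plus; apply: exp_le; lra.
Qed.

End Cuts.

(** * Larger cuts when nodes have at least ln ln n keys *)

Section LargeCuts.
Local Open Scope R_scope.

Lemma exp_ln_ratio_pow (v : R) (m : nat) : 0 < v -> v ^ m = exp (INR m * ln v).
Proof. by move=> v0; rewrite -exp_pow exp_ln. Qed.

(** With z = ln (u / Y), the binomial is at most exp (u (1 - z)), so the exponent is at most M (c (1
    - z) + z) = M (c + (1 - c) z), and z <= - w. *)
Lemma bin_ratio_pow_le (Y u M : nat) (w c : R) : (0 < M)%N -> (0 < Y)%N ->
  1 <= w -> 0 <= c <= 1 -> INR u <= c * INR M -> INR u <= exp (- w) * INR Y ->
  INR 'C(Y, u) * (INR u / INR Y) ^ M <= exp (INR M * (c * (1 + w) - w)).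
Proof.
move=> M0 Y0 w1 c01 uM uY; have Yp : 0 < INR Y by apply: lt_0_INR; lia.
have Mp : 0 < INR M by apply: lt_0_INR; lia.
have [u0|u0] := posnP u.
  rewrite u0 /Rdiv Rmult_0_l pow_i; last by lia.
  by rewrite Rmult_0_r; left; apply: exp_pos.
have up : 0 < INR u by apply: lt_0_INR; lia.
have vp : 0 < INR u / INR Y by apply: Rmult_lt_0_compat => //; apply: Rinv_0_lt_compat.
have lv : ln (INR u / INR Y) <= - w.
  rewrite -(ln_exp (- w)); have h : INR u / INR Y <= exp (- w).
    by apply: (Rmult_le_reg_r (INR Y)) => //; rewrite /Rdiv Rmult_assoc Rinv_l; lra.
  by have [h'|->] := h; [left; apply: ln_increasing | right].
apply: Rle_trans (Rmult_le_compat_r _ _ _ _ (bin_le_exp_ln u0 Y0)) _.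
  by apply: pow_le; lra.
rewrite exp_ln_ratio_pow // -exp_plus; apply: exp_le.
set z := ln _ in lv *; have : INR u * (1 - z) <= c * INR M * (1 - z).
  by apply: Rmult_le_compat_r; lra.
have : INR M * ((1 - c) * z) <= INR M * ((1 - c) * - w).
  by apply: Rmult_le_compat_l; [lra | apply: Rmult_le_compat_l; lra].
lra.
Qed.

Lemma bin_le_exp_dense (n r : nat) (l : R) : (0 < r)%N -> (0 < n)%N -> 0 < l ->
  INR n / l ^ 3 <= INR r -> INR 'C(n, r) <= exp (INR r * (1 + 3 * ln l)).
Proof.
move=> r0 n0 l0 nr; apply: Rle_trans (bin_le_exp_ln r0 n0) _; apply: exp_le.
have rp : 0 < INR r by apply: lt_0_INR; lia.
have np : 0 < INR n by apply: lt_0_INR; lia.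
apply: Rmult_le_compat_l; first by lra.
have l3 : 0 < l ^ 3 by apply: pow_lt.
have h : / l ^ 3 <= INR r / INR n.
  apply: (Rmult_le_reg_r (INR n)) => //.
  by rewrite /Rdiv (Rmult_assoc (INR r)) Rinv_l; lra.
have : ln (/ l ^ 3) <= ln (INR r / INR n).
  by have [h'|->] := h; [left; apply: ln_increasing => //; apply: Rinv_0_lt_compat | right].
rewrite ln_Rinv // -Rpower_pow // /Rpower ln_exp /=; lra.
Qed.

Lemma cut_dense_small (k : nat) (C0 C e : R) : (0 < k)%N -> 1 <= C0 -> 0 < e ->
  eventually (fun n => forall K Y, regime k C0 C n K Y -> ln (ln (INR n)) <= INR K ->
    forall r1 : nat, INR n / ln (INR n) ^ 3 <= INR r1 ->
    rkg_prob K (fun f : key_assign n Y => cut_in f k r1 n) <= e).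
Proof.
(* With w = 8 in [bin_ratio_pow_le], u / Y <= exp (- 8) and the exponent per key is 9 c - 8 <= - 7.
   Since K >= ln (ln n), this outweighs the 1 + 3 ln (ln n) per node from the choice of [A]. *)
move=> k0 C01 ep; pose c := exp (Ropp 8).
have c0 : 0 < c by apply: exp_pos.
have c1 : c <= / 16.
  have h : 16 <= exp 8.
    have -> : exp 8 = exp 1 ^ 8 by rewrite exp_pow /=; f_equal; lra.
    have : 2 ^ 8 <= exp 1 ^ 8 by apply: pow_incr; have := exp_ge1 1; lra.
    lra.
  by rewrite /c exp_Ropp; apply: Rinv_le_contravar; lra.
have kp : 1 <= INR k by have := le_INR' k0; rewrite /=; lra.
have ic : 0 < / c by apply: Rinv_0_lt_compat.
have k5 : 0 < / (INR k + 5) by apply: Rinv_0_lt_compat; lra.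
have cc : 0 < c / (8 * C0) by apply: Rmult_lt_0_compat => //; apply: Rinv_0_lt_compat; lra.
have := eventually_and (regime_facts C k0 (Rlt_le_trans _ _ _ Rlt_0_1 C01) Rlt_0_1)
  (eventually_and (union_small ep)
  (eventually_and (eventually_lnln_ge (12 / c))
  (eventually_and (eventually_ln_ge (2 * Rabs C + INR k + 8 * / c))
  (eventually_and (eventually_pow_le_exp 4 Rlt_0_1 k5)
  (eventually_and (eventually_pow_le_exp 1 Rlt_0_1 cc)
  (eventually_lnln_pow 1 (Rmult_lt_0_compat _ _ c0 (ltac:(lra) : 0 < / 60)))))))).
apply: eventually_imp => n [rf [un [lln [lC [l4 [lc lll]]]]]] K Y reg hK r1 hr1.
have [] := rf K Y reg; have [K2 KY _ _] := reg.
set l := ln (INR n) in un lln lC l4 lc lll hK hr1 *; set x := xk K Y => L0 [x0 x1] xd ex nx.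
have nE : exp l = INR n by apply: exp_ln_INR.
have np : 0 < INR n by rewrite -nE; apply: exp_pos.
have n0 : (0 < n)%N by apply/ltP; apply: INR_lt.
have Y0 : (0 < Y)%N by lia.
have Yp : 0 < INR Y by apply: lt_0_INR; lia.
have Kp : 2 <= INR K by have := le_INR' K2; rewrite /=; lra.
rewrite Rmult_1_l nE in l4 lc; rewrite !pow_1 in lc lll.
have aC := RRle_abs C; have aC0 := Rabs_pos C.
have ic16 : 16 <= / c by rewrite -(Rinv_inv 16); apply: Rinv_le_contravar; lra.
have lbig : 128 <= l by lra.
have l3 : 0 < l ^ 3 by apply: pow_lt.
have nl3 : (INR k + 5) * l <= INR n / l ^ 3.
  apply: (Rmult_le_reg_r (l ^ 3)) => //; rewrite /Rdiv (Rmult_assoc (INR n)) Rinv_l ?Rmult_1_r; last by lra.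
  have := Rmult_le_compat_l (INR k + 5) _ _ ltac:(lra) l4.
  have -> : (INR k + 5) * (/ (INR k + 5) * INR n) = INR n by field; lra.
  by lra.
have xp : 0 < x by nra.
(* A small fraction of min (r K, Y), the order of magnitude of the number of keys held by r
   nodes. *)
pose u r := nfloor (c * Rmin (INR r * INR K) (INR Y)).
have mn0 r : 0 <= Rmin (INR r * INR K) (INR Y).
  by apply: Rmin_glb; [apply: Rmult_le_pos; [apply: pos_INR | lra] | lra].
have uP r := nfloorP (Rmult_le_pos _ _ (Rlt_le _ _ c0) (mn0 r)).
have uY r : INR (u r) <= c * INR Y.
  have [h _] := uP r; apply: Rle_trans h _; apply: Rmult_le_compat_l; first by lra.
  exact: Rmin_r.
have uY' r : (u r <= Y)%N by apply/leP; apply: INR_le; have := uY r; nra.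
apply: Rle_trans (rkg_prob_cut_dense KY n0 (Rlt_le _ _ (exp_pos (- (2 * l)))) uY' _) un.
move=> r r1r rn.
have rb : INR n / l ^ 3 <= INR r by apply: Rle_trans hr1 (le_INR' r1r).
have rl : (INR k + 5) * l <= INR r by lra.
have rp : 0 < INR r by nra.
have r0 : (0 < r)%N by apply/ltP; apply: INR_lt.
have rn' : 2 * INR r <= INR n by have := le_INR' rn; rewrite INR_muln /=; lra.
have uK : INR (u r) <= c * INR (K * r).
  have [h _] := uP r; apply: Rle_trans h _; apply: Rmult_le_compat_l; first by lra.
  by rewrite INR_muln Rmult_comm; apply: Rmin_l.
have Kr0 : (0 < K * r)%N by rewrite muln_gt0 r0 andbT; lia.
have bin := bin_le_exp_dense r0 n0 L0 rb.
have T1 := @bin_ratio_pow_le Y (u r) (K * r) 8 c Kr0 Y0 ltac:(lra) ltac:(lra) uK (uY r).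
have vle : INR (u r) / INR Y <= 1.
  by apply: (Rmult_le_reg_r (INR Y)) => //; rewrite /Rdiv Rmult_assoc Rinv_l; have := uY r; nra.
have T2 := pow1B_le_exp (K * (n - r - k)) vle.
have nk6 : 6 * INR k <= INR n.
  have : 1 + l <= INR n by rewrite -nE; apply: exp_ge1.
  have : l <= INR r by nra.
  nra.
have nb : INR n / 3 <= INR (n - r - k).
  have h : (r + k <= n)%N by apply/leP; apply: INR_le; rewrite plus_INR; lra.
  rewrite minus_INR; last by lia.
  by rewrite minus_INR; [lra | lia].
have B1 : INR 'C(n, r) * (INR 'C(Y, u r) * (INR (u r) / INR Y) ^ (K * r)) <= exp (- INR r).
  apply: Rle_trans (Rmult_le_compat _ _ _ _ (pos_INR _) _ bin T1) _.
    apply: Rmult_le_pos; first exact: pos_INR.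
    by apply: pow_le; apply: Rmult_le_pos; [apply: pos_INR | left; apply: Rinv_0_lt_compat].
  rewrite -exp_plus; apply: exp_le; rewrite INR_muln.
  have h : INR K * INR r * (c * (1 + 8) - 8) <= INR K * INR r * - 7.
    by apply: Rmult_le_compat_l; [nra | lra].
  have : INR r * (1 + 3 * ln l - 7 * INR K) <= INR r * - 1 by apply: Rmult_le_compat_l; lra.
  lra.
(* Rounding down costs at most a factor 2 because the argument is at least 2; for Y this comes from
   Y x = K ^ 2 >= 4 with x of order at most ln n / n. *)
have mnb : c / 2 * Rmin (INR r * INR K) (INR Y) <= INR (u r).
  have [_ h] := uP r; rewrite -/(u r) in h.
  suff : 2 <= c * Rmin (INR r * INR K) (INR Y) by lra.
  have -> : 2 = c * (2 * / c) by field; lra.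
  apply: Rmult_le_compat_l; first by lra.
  apply: Rmin_glb; first by nra.
  have YE : INR Y * x = INR K * INR K by rewrite /x /xk; field; lra.
  have h1 : INR Y * (2 * C0 * l / INR n) >= 4 by nra.
  have h2 : l / INR n <= c / (8 * C0).
    apply: (Rmult_le_reg_r (INR n)) => //; rewrite /Rdiv Rmult_assoc Rinv_l; lra.
  have h3 : INR Y * (2 * C0 * (c / (8 * C0))) >= 4.
    apply: Rge_trans h1; apply: Rle_ge; apply: Rmult_le_compat_l; first by lra.
    rewrite /Rdiv (Rmult_assoc (2 * C0) l); apply: Rmult_le_compat_l; lra.
  have h4 : INR Y * (2 * C0 * (c / (8 * C0))) = INR Y * c / 4 by field; lra.
  apply: (Rmult_le_reg_r c) => //; rewrite Rmult_assoc Rinv_l; lra.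
have B2 : INR 'C(n, r) * (1 - INR (u r) / INR Y) ^ (K * (n - r - k)) <= exp (- INR r).
  apply: Rle_trans (Rmult_le_compat_l _ _ _ (pos_INR _) T2) _.
  rewrite INR_muln; have Kn : INR K * (INR n / 3) <= INR K * INR (n - r - k).
    by apply: Rmult_le_compat_l; lra.
  have uYm : c / 2 * Rmin (INR r * INR K) (INR Y) / INR Y <= INR (u r) / INR Y.
    by apply: Rmult_le_compat_r => //; left; apply: Rinv_0_lt_compat.
  have low0 : 0 <= c / 2 * Rmin (INR r * INR K) (INR Y) / INR Y.
    apply: Rmult_le_pos; last by left; apply: Rinv_0_lt_compat.
    by apply: Rmult_le_pos; [lra | apply: mn0].
  have Kn0 : 0 <= INR K * (INR n / 3) by apply: Rmult_le_pos; lra.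
  have expo := Rmult_le_compat _ _ _ _ Kn0 low0 Kn uYm.
  (* If r K <= Y, the exponent is of order r n x, hence at least r ln n, against r (1 + 3 ln (ln
     n)). Otherwise it is c K n / 6 >= 2 n, against 'C(n, r) <= exp n. *)
  have [rKY|YrK] := Rle_lt_dec (INR r * INR K) (INR Y).
    rewrite Rmin_left // in expo.
    have e1 : INR K * (INR n / 3) * (c / 2 * (INR r * INR K) / INR Y) = c / 6 * INR r * (INR n * x).
      by rewrite /x /xk; field; lra.
    apply: Rle_trans (Rmult_le_compat_r _ _ _ (Rlt_le _ _ (exp_pos _)) bin) _.
    rewrite -exp_plus; apply: exp_le.
    have : c / 6 * INR r * (l / 2) <= c / 6 * INR r * (INR n * x).
      by apply: Rmult_le_compat_l; [apply: Rmult_le_pos; lra | lra].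
    have : INR r * (1 + 3 * ln l - c / 12 * l) <= INR r * - 1.
      apply: Rmult_le_compat_l; first by lra.
      have : 12 / c <= c * / 60 * l by lra.
      by rewrite /Rdiv; lra.
    lra.
  rewrite Rmin_right in expo; last by lra.
  have e1 : INR K * (INR n / 3) * (c / 2 * INR Y / INR Y) = c / 6 * INR K * INR n by field; lra.
  apply: Rle_trans (Rmult_le_compat_r _ _ _ (Rlt_le _ _ (exp_pos _)) (bin_le_exp_n r0 n0)) _.
  rewrite -exp_plus; apply: exp_le.
  have h : c / 6 * (12 / c) <= c / 6 * INR K by apply: Rmult_le_compat_l; lra.
  have e2 : c / 6 * (12 / c) = 2 by field; lra.
  by rewrite e1 in expo; nra.
rewrite INR_muln INR_expn -nE exp_pow.
apply: Rle_trans (_ : (exp l * exp (INR k * l)) * (2 * exp (- INR r)) <= _).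
  set Q1 := INR 'C(Y, u r) * _ in B1 *; set Q2 := (1 - _) ^ _ in B2 *.
  have -> : INR 'C(n, r) * (INR k * exp (INR k * l)) * (Q1 + Q2) =
     (INR k * exp (INR k * l)) * (INR 'C(n, r) * Q1 + INR 'C(n, r) * Q2) by ring.
  apply: Rle_trans (_ : INR k * exp (INR k * l) * (2 * exp (- INR r)) <= _).
    apply: Rmult_le_compat_l; last by lra.
    by apply: Rmult_le_pos; [lra | left; apply: exp_pos].
  apply: Rmult_le_compat_r; first by have := exp_pos (- INR r); lra.
  apply: Rmult_le_compat_r; first by left; apply: exp_pos.
  by have := exp_ge1 l; lra.
apply: Rle_trans (_ : exp l * exp (INR k * l) * (exp l * exp (- INR r)) <= _).
  apply: Rmult_le_compat_l; first by left; apply: Rmult_lt_0_compat; apply: exp_pos.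
  by apply: Rmult_le_compat_r; [left; apply: exp_pos | have := exp_ge1 l; lra].
by rewrite -!exp_plus; apply: exp_le; lra.
Qed.

End LargeCuts.

(** * Larger cuts when nodes have at most ln ln n keys, and the comparison of both properties *)

Section SmallPool.
Local Open Scope R_scope.

(** For v <= 1/2 the sum is at most the average of v ^ (K-1) and (1 - v) ^ (K-1) with weights v and
    1 - v, hence at most (1 - v) ^ (K-1); and K - 1 >= K / 2. *)
Lemma split_pow_le (v : R) (K : nat) : (2 <= K)%N -> 0 <= v <= / 2 ->
  v ^ K + (1 - v) ^ K <= exp (- (INR K * v / 2)).
Proof.
move=> K2 [v0 v2]; have -> : K = K.-1.+1 by lia.
rewrite -!tech_pow_Rmult.
have p : v ^ K.-1 <= (1 - v) ^ K.-1 by apply: pow_incr; lra.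
apply: Rle_trans (_ : (1 - v) ^ K.-1 <= _); first by nra.
apply: Rle_trans (pow1B_le_exp K.-1 (ltac:(lra) : v <= 1)) _; apply: exp_le.
have : INR K.-1.+1 <= 2 * INR K.-1.
  by rewrite S_INR; have := le_INR' (ltac:(lia) : (1 <= K.-1)%N); rewrite /=; lra.
by nra.
Qed.

(** Here K is too small to outweigh the choice of the nodes, but Y = K ^ 2 / x is then small
    compared with n, and choosing a set of keys is affordable. *)
Lemma cut_small_pool_small (k : nat) (C0 C e : R) : (0 < k)%N -> 1 <= C0 -> 0 < e ->
  eventually (fun n => forall K Y, regime k C0 C n K Y -> INR K <= ln (ln (INR n)) ->
    forall r1 : nat, INR n / ln (INR n) ^ 3 <= INR r1 ->
    rkg_prob K (fun f : key_assign n Y => cut_in f k r1 n) <= e).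
Proof.
move=> k0 C01 ep; have ep2 : 0 < e / 2 by lra.
have kp : 1 <= INR k by have := le_INR' k0; rewrite /=; lra.
have k5 : 0 < / (4 * (INR k + 5)) by apply: Rinv_0_lt_compat; lra.
have := eventually_and (regime_facts C k0 (Rlt_le_trans _ _ _ Rlt_0_1 C01) Rlt_0_1)
  (eventually_and (union_small ep2)
  (eventually_and (eventually_lnln_ge 1)
  (eventually_and (eventually_ln_ge (2 * Rabs C + 128 + INR k + 2 / e))
  (eventually_and (eventually_pow_le_exp 6 Rlt_0_1 k5)
  (eventually_lnln_pow 2 (ltac:(lra) : 0 < / 128)))))).
apply: eventually_imp => n [rf [un [lln [lC [l6 lll]]]]] K Y reg hK r1 hr1.
have [] := rf K Y reg; have [K2 KY _ _] := reg.
set l := ln (INR n) in un lln lC l6 lll hK hr1 *; set x := xk K Y => L0 [x0 x1] xd ex nx.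
have nE : exp l = INR n by apply: exp_ln_INR.
have np : 0 < INR n by rewrite -nE; apply: exp_pos.
have n0 : (0 < n)%N by apply/ltP; apply: INR_lt.
have Y0 : (0 < Y)%N by lia.
have Yp : 0 < INR Y by apply: lt_0_INR; lia.
have Kp : 2 <= INR K by have := le_INR' K2; rewrite /=; lra.
rewrite Rmult_1_l nE in l6.
have aC := RRle_abs C; have aC0 := Rabs_pos C.
have e2 : 0 < 2 / e by apply: Rmult_lt_0_compat; [lra | apply: Rinv_0_lt_compat].
have lbig : 128 <= l by lra.
have l3 : 0 < l ^ 3 by apply: pow_lt.
have l5 : 0 < l ^ 5 by apply: pow_lt.
have il5 : 0 < / l ^ 5 by apply: Rinv_0_lt_compat.
have YE : INR Y * x = INR K * INR K by rewrite /x /xk; field; lra.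
have KK : INR K * INR K <= ln l ^ 2 by rewrite -tech_pow_Rmult pow_1; nra.
have nx2 : l / 2 <= INR n * x by lra.
have Yl : INR Y * (l / 2) <= INR n * (INR K * INR K) by rewrite -YE; nra.
have Yn : INR Y <= INR n.
  apply: (Rmult_le_reg_r (l / 2)); first by lra.
  apply: Rle_trans Yl _; apply: Rmult_le_compat_l; lra.
(* With the fraction l ^ (-5) of the pool and K >= 2, holding at most u1 keys costs r1 nodes nearly
   10 r1 ln l in the exponent, against 3 r1 ln l for choosing them. The fraction is still large
   enough for v n to dominate ln n in the second sum. *)
pose u1 := nfloor (INR Y / l ^ 5).
have [u1a u1b] : INR u1 <= INR Y / l ^ 5 < INR u1 + 1.
  by apply: nfloorP; apply: Rmult_le_pos; lra.
have il51 : / l ^ 5 <= / 128.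
  apply: Rinv_le_contravar; first by lra.
  have -> : l ^ 5 = l * l ^ 4 by ring.
  by have := pow_R1_Rle l 4 ltac:(lra); nra.
have u1Y : (u1 <= Y)%N.
  by apply/leP; apply: INR_le; rewrite /Rdiv in u1a; nra.
have rp : 0 < INR r1.
  by apply: Rlt_le_trans hr1; apply: Rmult_lt_0_compat => //; apply: Rinv_0_lt_compat.
have r0 : (0 < r1)%N by apply/ltP; apply: INR_lt.
have rbig : 4 * (INR k + 5) * l <= INR r1.
  apply: Rle_trans hr1; apply: (Rmult_le_reg_r (l ^ 3)) => //.
  rewrite /Rdiv (Rmult_assoc (INR n)) Rinv_l ?Rmult_1_r; last by lra.
  have h := Rmult_le_compat_l (4 * (INR k + 5)) _ _ ltac:(lra) l6.
  have e1 : 4 * (INR k + 5) * (/ (4 * (INR k + 5)) * INR n) = INR n by field; lra.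
  rewrite e1 in h; apply: Rle_trans h; rewrite -Rmult_assoc Rmult_assoc.
  have -> : 4 * (INR k + 5) * l ^ 6 = 4 * (INR k + 5) * (l * l ^ 3) * l ^ 2 by ring.
  have : 1 <= l ^ 2 by apply: pow_R1_Rle; lra.
  have : 0 <= 4 * (INR k + 5) * (l * l ^ 3) by apply: Rmult_le_pos; nra.
  by nra.
apply: Rle_trans (_ : exp (- INR r1) + INR Y.+1 * exp (- (2 * l)) <= _); last first.
  have h1 : INR Y.+1 <= INR n.+1 by rewrite !S_INR; lra.
  have h2 := Rmult_le_compat_r _ _ _ (Rlt_le _ _ (exp_pos (- (2 * l)))) h1.
  suff : exp (- INR r1) <= e / 2 by lra.
  rewrite exp_Ropp; have h3 := exp_ge1 (INR r1).
  have h4 : 2 / e <= exp (INR r1) by nra.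
  have -> : e / 2 = / (2 / e) by field; lra.
  exact: Rinv_le_contravar.
have K0 : (0 < K)%N by lia.
apply: (rkg_prob_cut_small_pool KY K0 n0 u1Y (Rlt_le _ _ (exp_pos (- (2 * l))))).
  have Kr0 : (0 < K * r1)%N by rewrite muln_gt0 r0 andbT; lia.
  have w1 : 1 <= 5 * ln l by lra.
  have ew : exp (- (5 * ln l)) = / l ^ 5.
    by rewrite exp_Ropp; f_equal; have := exp_pow (ln l) 5; rewrite exp_ln //= => ->; f_equal; lra.
  have hu : INR u1 <= / 32 * INR (K * r1).
    apply: Rle_trans u1a _; apply: Rle_trans (_ : INR n / l ^ 5 <= _).
      by apply: Rmult_le_compat_r; lra.
    have -> : INR n / l ^ 5 = INR n / l ^ 3 * / l ^ 2 by field; lra.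
    apply: Rle_trans (_ : INR r1 * / 16 <= _); last by rewrite INR_muln; nra.
    apply: Rmult_le_compat => //.
    - by left; apply: Rmult_lt_0_compat => //; apply: Rinv_0_lt_compat.
    - by left; apply: Rinv_0_lt_compat; apply: pow_lt.
    - apply: Rinv_le_contravar; first by lra.
      by nra.
  have hY : INR u1 <= exp (- (5 * ln l)) * INR Y by rewrite ew Rmult_comm.
  have T1 := @bin_ratio_pow_le Y u1 (K * r1) _ (/ 32) Kr0 Y0 w1 ltac:(lra) hu hY.
  have bin := bin_le_exp_dense r0 n0 L0 hr1.
  apply: Rle_trans (Rmult_le_compat _ _ _ _ (pos_INR _) _ bin T1) _.
    apply: Rmult_le_pos; first exact: pos_INR.
    by apply: pow_le; apply: Rmult_le_pos; [apply: pos_INR | left; apply: Rinv_0_lt_compat].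
  rewrite -exp_plus; apply: exp_le; rewrite INR_muln.
  have h : INR r1 * (INR K * (/ 32 * (1 + 5 * ln l) - 5 * ln l)) <= INR r1 * (2 * (/ 32 * (1 + 5 * ln l) - 5 * ln l)).
    by apply: Rmult_le_compat_l; [lra | nra].
  have : INR r1 * (1 + 3 * ln l + 2 * (/ 32 * (1 + 5 * ln l) - 5 * ln l)) <= INR r1 * - 1.
    by apply: Rmult_le_compat_l; lra.
  lra.
move=> u u1u uY.
have up : INR u1 + 1 <= INR u by rewrite -S_INR; apply: le_INR'.
have upos : 0 < INR u by have := pos_INR u1; lra.
have u0 : (0 < u)%N by lia.
set v := INR u / INR Y.
have vl : / l ^ 5 < v.
  apply: (Rmult_lt_reg_r (INR Y)) => //.
  rewrite /v /Rdiv (Rmult_assoc (INR u)) Rinv_l; rewrite /Rdiv in u1b; lra.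
have v2 : v <= / 2.
  apply: (Rmult_le_reg_r (INR Y)) => //; rewrite /v /Rdiv (Rmult_assoc (INR u)) Rinv_l; last by lra.
  by have := le_INR' uY; rewrite INR_muln /=; lra.
have lv : - (5 * ln l) <= ln v.
  have : ln (/ l ^ 5) < ln v by apply: ln_increasing.
  by rewrite ln_Rinv // -Rpower_pow // /Rpower ln_exp /=; lra.
have bin := bin_le_exp_ln u0 Y0; rewrite -/v in bin.
have phi := @split_pow_le v K K2 ltac:(lra).
have phi0 : 0 <= v ^ K + (1 - v) ^ K.
  by apply: Rplus_le_le_0_compat; apply: pow_le; lra.
have nk : INR n / 2 <= INR (n - k).
  have h : (k <= n)%N.
    by apply/leP; apply: INR_le; have := exp_ge1 l; rewrite nE; lra.
  rewrite minus_INR; last by lia.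
  have : 2 * INR k <= INR n; last by lra.
  have : INR k <= l by lra.
  have -> : INR n = exp (l / 2) * exp (l / 2) by rewrite -exp_plus -nE; f_equal; field.
  by have := exp_ge1 (l / 2); nra.
have pw : (v ^ K + (1 - v) ^ K) ^ (n - k) <= exp (- (INR K * v * INR n / 4)).
  apply: Rle_trans (pow_incr _ _ (n - k) (conj phi0 phi)) _.
  rewrite exp_pow; apply: exp_le.
  have : INR n / 2 * (INR K * v / 2) <= INR (n - k) * (INR K * v / 2).
    by apply: Rmult_le_compat_r => //; apply: Rmult_le_pos; [apply: Rmult_le_pos; lra | lra].
  lra.
apply: Rle_trans (_ : exp (INR u * (1 - ln v)) * INR (k * n ^ k) * exp (- (INR K * v * INR n / 4)) <= _).
  apply: Rmult_le_compat => //.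
  - by apply: Rmult_le_pos; apply: pos_INR.
  - exact: pow_le.
  - by apply: Rmult_le_compat_r => //; apply: pos_INR.
have uE : INR u = v * INR Y by rewrite /v; field; lra.
have Yb : INR Y * (1 + 5 * ln l) <= INR K * INR n / 8.
  apply: (Rmult_le_reg_r (l / 2)); first by lra.
  have h1 := Rmult_le_compat_r (1 + 5 * ln l) _ _ ltac:(lra) Yl.
  have h2 : INR K * (1 + 5 * ln l) <= l / 16.
    have : INR K * (1 + 5 * ln l) <= ln l * (6 * ln l) by apply: Rmult_le_compat; lra.
    have -> : ln l * (6 * ln l) = 6 * ln l ^ 2 by ring.
    lra.
  have : INR n * INR K * (INR K * (1 + 5 * ln l)) <= INR n * INR K * (l / 16).
    by apply: Rmult_le_compat_l => //; apply: Rmult_le_pos; lra.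
  lra.
have vY : INR u * (1 - ln v) <= v * (INR K * INR n / 8).
  rewrite uE Rmult_assoc; apply: Rmult_le_compat_l; first by lra.
  apply: Rle_trans Yb; apply: Rmult_le_compat_l; lra.
have vn : (INR k + 3) * l <= v * (INR K * INR n / 8).
  apply: Rle_trans (_ : / l ^ 5 * (2 * INR n / 8) <= _).
    apply: (Rmult_le_reg_l (l ^ 5)) => //.
    have -> : l ^ 5 * (/ l ^ 5 * (2 * INR n / 8)) = INR n / 4 by field; lra.
    have h := Rmult_le_compat_l (INR k + 5) _ _ ltac:(lra) l6.
    have e1 : (INR k + 5) * (/ (4 * (INR k + 5)) * INR n) = INR n / 4 by field; lra.
    rewrite e1 in h; apply: Rle_trans h.
    have -> : l ^ 5 * ((INR k + 3) * l) = (INR k + 3) * l ^ 6 by ring.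
    by apply: Rmult_le_compat_r; [apply: pow_le; lra | lra].
  apply: Rmult_le_compat; try lra; last by nra.
have nkE : INR n ^ k = exp (INR k * l) by rewrite -nE exp_pow.
rewrite INR_muln INR_expn nkE.
apply: Rle_trans (_ : exp (INR u * (1 - ln v)) * (exp l * exp (INR k * l)) * exp (- (INR K * v * INR n / 4)) <= _).
  apply: Rmult_le_compat_r; first by left; apply: exp_pos.
  apply: Rmult_le_compat_l; first by left; apply: exp_pos.
  apply: Rmult_le_compat_r; first by left; apply: exp_pos.
  by have := exp_ge1 l; lra.
by rewrite -!exp_plus; apply: exp_le; lra.
Qed.

Lemma edge_term2 (n K Y m : nat) (t : R) :
  edge_term n K Y 2 m t = / t ^ m * (1 + 4 * t * xk K Y) ^ n *
   (av K Y (n - 2) ^ K * (2 * xk K Y * (av K Y (n - 2) + yk K Y) ^ K.-1)).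
Proof.
rewrite /edge_term subnn muln0 /=.
have -> : 1 + 2 * (1 + 1) * t * xk K Y = 1 + 4 * t * xk K Y by ring.
ring.
Qed.

Lemma mindeg_kconn_close (k : nat) (C0 C e : R) : (0 < k)%N -> 1 <= C0 -> 0 < e ->
  eventually (fun n => forall K Y, regime k C0 C n K Y ->
    rkg_prob K (fun f : key_assign n Y => min_degree_ge (rkg_adj f) k) <=
    rkg_prob K (fun f : key_assign n Y => k_connected (rkg_adj f) k) + e).
Proof.
move=> k0 C01 ep; have ep3 : 0 < e / 3 by lra.
have [t [e0 [t0 t1 e00 edge]]] := edge_term_small C k0 C01 (leqnn 2).
(* The sparse range starts at [m.+1 - k], which is about e0 ln n - k and therefore at least (e0 / 2)
   ln n. *)
have e02 : 0 < e0 / 2 by lra.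
have := eventually_and (edge _ ep3) (eventually_and (cut_sparse_small C k0 C01 e02 ep3)
  (eventually_and (cut_dense_small C k0 C01 ep3) (eventually_and (cut_small_pool_small C k0 C01 ep3)
  (eventually_and (eventually_ln_ge (1 + INR k + 2 * INR k / e0)) (eventually_pow_le_exp 3 Rlt_0_1 Rlt_0_1))))).
apply: eventually_imp => n [hedge [hsp [hde [hpo [lk l3]]]]] K Y reg.
have {hedge} [x2 hedge] := hedge K Y reg.
have {}hsp := hsp K Y reg; have {}hde := hde K Y reg; have {}hpo := hpo K Y reg.
have [K2 KY _ _] := reg.
set l := ln (INR n) in hedge hsp hde hpo lk l3 *.
have kp : 1 <= INR k by have := le_INR' k0; rewrite /=; lra.
have ke : 0 < 2 * INR k / e0 by apply: Rmult_lt_0_compat; [lra | apply: Rinv_0_lt_compat].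
have nE : exp l = INR n by apply: exp_ln_INR; rewrite -/l; lra.
have kn : (k < n)%N by apply/ltP; apply: INR_lt; have := exp_ge1 l; rewrite nE; lra.
have K0 : (0 < K)%N by lia.
have l3p : 0 < l ^ 3 by apply: pow_lt; lra.
pose m := nfloor (e0 * l); have [m1 m2] : INR m <= e0 * l < INR m + 1 by apply: nfloorP; nra.
(* Rounding up makes the dense range start at r; r stays below 2 n / l ^ 3, as the sparse range
   requires. *)
pose r := (nfloor (INR n / l ^ 3)).+1.
have np : 0 < INR n by rewrite -nE; apply: exp_pos.
have [r1 r2] : INR (nfloor (INR n / l ^ 3)) <= INR n / l ^ 3 < INR (nfloor (INR n / l ^ 3)) + 1.
  by apply: nfloorP; apply: Rmult_le_pos; [lra | left; apply: Rinv_0_lt_compat].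
have one : 1 <= INR n / l ^ 3.
  apply: (Rmult_le_reg_r (l ^ 3)) => //; rewrite /Rdiv Rmult_assoc Rinv_l; last by lra.
  by rewrite !Rmult_1_l nE in l3; lra.
have rl : INR n / l ^ 3 <= INR r by rewrite /r S_INR; lra.
have ru : INR r <= 2 * INR n / l ^ 3 by rewrite /r S_INR /Rdiv; rewrite /Rdiv in r1 one; lra.
have [_ main] := @prob_mindeg_sub_kconn n K Y k m r KY kn.
apply: Rle_trans main _; apply: Rplus_le_compat_l.
have E1 : rkg_prob K (fun f : key_assign n Y => edge_with_few_hits f m) <= e / 3.
  apply: Rle_trans (rkg_prob_edge_few_hits n m KY K0 t0 t1 _) _; first by rewrite /= in x2; lra.
  by have := hedge m m1; rewrite edge_term2.
have E2 : rkg_prob K (fun f : key_assign n Y => cut_in f k (m.+1 - k) r) <= e / 3.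
  apply: hsp => //.
  have h : INR m.+1 - INR k <= INR (m.+1 - k).
    have [h|h] := leqP k m.+1; first by rewrite minus_INR; [lra | lia].
    by have := lt_INR' h; have := pos_INR (m.+1 - k); lra.
  rewrite S_INR in h.
  have : e0 * (2 * INR k / e0) <= e0 * l by apply: Rmult_le_compat_l; lra.
  have -> : e0 * (2 * INR k / e0) = 2 * INR k by field; lra.
  lra.
have E3 : rkg_prob K (fun f : key_assign n Y => cut_in f k r n) <= e / 3.
  by have [h|h] := Rle_lt_dec (ln l) (INR K); [apply: hde | apply: hpo => //; lra].
lra.
Qed.

End SmallPool.

(** * Moments of the number of nodes of low degree *)

Section LowDegreeLimits.
Local Open Scope R_scope.

Definition alpha (k n K Y : nat) : R :=
  INR n * edge_prob K Y - ln (INR n) - (INR k - 1) * ln (ln (INR n)).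

Lemma poisson_sum_ge0 (k : nat) (z : R) : 0 <= z -> 0 <= poisson_sum k z.
Proof.
move=> z0; elim: k => [|k IH] /=; first by lra.
apply: Rplus_le_le_0_compat => //; apply: Rmult_le_pos; first exact: pow_le.
by left; apply: Rinv_0_lt_compat; apply: lt_0_INR; have := fact_gt0 k; lia.
Qed.

Lemma inv_fact_le1 (k : nat) : 0 < / INR (k`!) <= 1.
Proof.
have h : 1 <= INR (k`!) by have := le_INR' (fact_gt0 k); rewrite /=; lra.
by split; [apply: Rinv_0_lt_compat; lra | rewrite -Rinv_1; apply: Rinv_le_contravar; lra].
Qed.

Lemma poisson_sum_le (k : nat) (z : R) : 1 <= z -> poisson_sum k z <= INR k * z ^ k.-1.
Proof.
move=> z1; elim: k => [|k IH]; first by rewrite /= Rmult_0_l; lra.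
rewrite [poisson_sum _ _]/= S_INR [k.+1.-1]/=.
have zk : z ^ k.-1 <= z ^ k by apply: Rle_pow => //; lia.
have [i0 i1] := inv_fact_le1 k; have zp := pow_lt z k ltac:(lra).
have := Rmult_le_compat_l _ _ _ (pos_INR k) zk; rewrite /Rdiv; nra.
Qed.

Lemma poisson_sum_ge_last (k : nat) (z : R) : (0 < k)%N -> 0 <= z ->
  z ^ k.-1 / INR ((k.-1)`!) <= poisson_sum k z.
Proof. by case: k => // k _ z0; rewrite /=; have := poisson_sum_ge0 k z0; lra. Qed.

Lemma poisson_sum_ge1 (k : nat) (z : R) : (0 < k)%N -> 0 <= z -> 1 <= poisson_sum k z.
Proof.
case: k => // k _ z0; elim: k => [|k IH]; first by rewrite /=; lra.
rewrite [poisson_sum _ _]/=; have [i0 _] := inv_fact_le1 k.+1.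
have : 0 <= z ^ k.+1 / INR (k.+1`!) by apply: Rmult_le_pos; [apply: pow_le | lra].
by rewrite /= in IH *; lra.
Qed.

Lemma poisson_sum_scale (k : nat) (c z : R) : 1 <= c -> 0 <= z -> poisson_sum k (c * z) <= c ^ k * poisson_sum k z.
Proof.
move=> c1 z0; elim: k => [|k IH]; first by rewrite /=; lra.
rewrite [poisson_sum _ (c * z)]/= [poisson_sum k.+1 z]/= Rpow_mult_distr -tech_pow_Rmult.
have ck : 0 < c ^ k by apply: pow_lt; lra.
have [i0 _] := inv_fact_le1 k; have p0 := poisson_sum_ge0 k z0; have zk := pow_le z k z0.
set P := poisson_sum k z in IH p0 *; set Q := poisson_sum k (c * z) in IH *.
have a0 : 0 <= z ^ k * / INR (k`!) by apply: Rmult_le_pos; lra.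
have a1 : 0 <= c ^ k * P by apply: Rmult_le_pos; lra.
have a2 : 0 <= c ^ k * (z ^ k * / INR (k`!)) by apply: Rmult_le_pos; lra.
by rewrite /Rdiv; nra.
Qed.

Lemma low_weight_le (n K Y k l : nat) : (0 < Y)%N -> (l + l * k <= n)%N ->
  0 <= low_weight n K Y k l <= poisson_sum k (INR n * xk K Y) *
     (exp (- (INR n * xk K Y)) * exp (INR (l + l * k) * xk K Y)).
Proof.
move=> Y0 ln; have Yp : 1 <= INR Y by have := le_INR' Y0; rewrite /=; lra.
have iY : / INR Y <= 1 by rewrite -Rinv_1; apply: Rinv_le_contravar; lra.
have x0 : 0 <= xk K Y.
  by repeat apply: Rmult_le_pos; try apply: pos_INR; left; apply: Rinv_0_lt_compat; lra.
have p0 := poisson_sum_ge0 k (Rmult_le_pos _ _ (pos_INR n) x0).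
split; first by apply: Rmult_le_pos => //; apply: pow_le; lra.
apply: Rmult_le_compat_l => //; apply: Rle_trans (pow1B_le_exp _ iY) _.
rewrite -exp_plus; apply: exp_le; right.
rewrite -subnDA !INR_muln minus_INR; last by lia.
by rewrite /xk; field; lra.
Qed.

(** Up to the factor 1 / (k - 1)!, and with n q replaced by ln n in the power, the left-hand side is
    the expected number of nodes of degree k - 1. *)
Lemma exp_alpha (k n K Y : nat) : 0 < ln (INR n) -> (0 < k)%N ->
  INR n * exp (- (INR n * edge_prob K Y)) * ln (INR n) ^ k.-1 = exp (- alpha k n K Y).
Proof.
move=> l0 k0; have -> : - alpha k n K Y = ln (INR n) + - (INR n * edge_prob K Y) + INR k.-1 * ln (ln (INR n)).
  rewrite /alpha; have -> : INR k = INR k.-1 + 1 by rewrite -S_INR; f_equal; lia.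
  ring.
by rewrite !exp_plus exp_ln_INR // -exp_pow exp_ln.
Qed.

Lemma first_moment_bound (k : nat) (C0 C : R) : (0 < k)%N -> 1 <= C0 ->
  exists c, 0 < c /\ eventually (fun n => forall K Y, regime k C0 C n K Y ->
    INR n * low_weight n K Y k 1 <= c * exp (- alpha k n K Y)).
Proof.
move=> k0 C01; have kp : 1 <= INR k by have := le_INR' k0; rewrite /=; lra.
exists (INR k * (2 * C0) ^ k.-1 * exp 1); split.
  by repeat apply: Rmult_lt_0_compat; [lra | apply: pow_lt; lra | apply: exp_pos].
have d0 : 0 < / (INR k + 1) by apply: Rinv_0_lt_compat; lra.
have := eventually_and (regime_facts C k0 (Rlt_le_trans _ _ _ Rlt_0_1 C01) d0)
  (eventually_and (eventually_ln_ge (1 + Rabs C)) (eventually_ln_ge (INR k + 1))).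
apply: eventually_imp => n [rf [l1 l2]] K Y reg.
have [] := rf K Y reg; have [K2 KY _ _] := reg.
set l := ln (INR n) in l1 l2 *; set x := xk K Y => L0 [x0 x1] xd ex nx.
have nE : exp l = INR n by apply: exp_ln_INR.
have np : 0 < INR n by rewrite -nE; apply: exp_pos.
have Y0 : (0 < Y)%N by lia.
have kn : (1 + 1 * k <= n)%N.
  by apply/leP; apply: INR_le; rewrite plus_INR INR_muln /=; have := exp_ge1 l; rewrite nE; lra.
have [_ lw] := low_weight_le K Y0 kn; rewrite -/x in lw.
have aC := RRle_abs C; have z1 : 1 <= INR n * x by lra.
have p1 := poisson_sum_le k z1.
have zl : INR n * x <= 2 * C0 * l.
  have := Rmult_le_compat_l _ _ _ (Rlt_le _ _ np) x1.
  by have -> : INR n * (2 * C0 * l / INR n) = 2 * C0 * l by field; lra.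
have p2 : (INR n * x) ^ k.-1 <= (2 * C0) ^ k.-1 * l ^ k.-1.
  by rewrite -Rpow_mult_distr; apply: pow_incr; lra.
have p3 : poisson_sum k (INR n * x) <= INR k * ((2 * C0) ^ k.-1 * l ^ k.-1).
  by apply: Rle_trans p1 _; apply: Rmult_le_compat_l; lra.
have e1 : exp (INR (1 + 1 * k) * x) <= exp 1.
  apply: exp_le; have -> : INR (1 + 1 * k) = INR k + 1 by rewrite mul1n add1n S_INR.
  have := Rmult_le_compat_l (INR k + 1) _ _ ltac:(lra) xd.
  by rewrite Rinv_r; lra.
have e2 : exp (- (INR n * x)) <= exp (- (INR n * edge_prob K Y)).
  apply: exp_le; have := Rmult_le_compat_l _ _ _ (Rlt_le _ _ np) (edge_prob_le_xk KY).
  by rewrite -/x; lra.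
rewrite -(exp_alpha K Y L0 k0) -/l.
apply: Rle_trans (Rmult_le_compat_l _ _ _ (Rlt_le _ _ np) lw) _.
have q0 := exp_pos (- (INR n * x)); have q1 := exp_pos (INR (1 + 1 * k) * x).
have p0 := poisson_sum_ge0 k (ltac:(lra) : 0 <= INR n * x).
apply: Rle_trans (_ : INR n * (INR k * ((2 * C0) ^ k.-1 * l ^ k.-1) *
   (exp (- (INR n * edge_prob K Y)) * exp 1)) <= _); last by right; ring.
apply: Rmult_le_compat_l; first by lra.
apply: Rmult_le_compat => //; first by left; apply: Rmult_lt_0_compat.
by apply: Rmult_le_compat; lra.
Qed.

(** Nothing bounds alpha from below, so n q may be far smaller than ln n and single weights have no
    common asymptotics. Hence the weight of a pair is compared with the lower bound for one node
    through their ratio. *)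
Lemma mindeg_prob_small (k : nat) (e : R) : (0 < k)%N -> 0 < e ->
  exists M : R, eventually (fun n => forall K Y, (2 <= K)%N -> (K <= Y)%N -> alpha k n K Y <= M ->
    rkg_prob K (fun f : key_assign n Y => min_degree_ge (rkg_adj f) k) <= e).
Proof.
move=> k0 ep; have kp : 1 <= INR k by have := le_INR' k0; rewrite /=; lra.
pose F := INR ((k.-1)`!); have [F0 _] := inv_fact_le1 k.-1; rewrite -/F in F0.
have Fp : 0 < F by apply: lt_0_INR; have := fact_gt0 k.-1; lia.
(* Chosen so that n b >= D, with b = [low_prob_lb], makes the term (k + 1) / (n b) at most e / 2. *)
pose D := 2 * (INR k + 1) / e; have D0 : 0 < D.
  by apply: Rmult_lt_0_compat; [lra | apply: Rinv_0_lt_compat].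
(* Constant in n b >= c exp (- alpha): exp (- 1) accounts for n q ^ 2 <= 1, the rest for the last
   term of the Poisson sum at an argument of at least l / 4. *)
pose c := exp (- 1) * (/ 4) ^ k.-1 / F.
have c0 : 0 < c.
  by repeat apply: Rmult_lt_0_compat => //; [apply: exp_pos | apply: pow_lt; lra].
exists (- Rmax 0 (ln (D / c))).
(* The ratio of the weights enters squared, and exp (2 d) = 1 + e / 2. *)
pose d := ln (1 + e / 2) / 2.
have dp : 0 < d.
  by apply: Rmult_lt_0_compat; [rewrite -ln_1; apply: ln_increasing; lra | lra].
pose G := 16 * INR k + 8 + 2 * INR k ^ 2.
have Gp : 0 < G by rewrite /G; have := pow2_ge_0 (INR k); lra.
have dG : 0 < d / G by apply: Rmult_lt_0_compat => //; apply: Rinv_0_lt_compat.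
have k4 : 0 < / (4 * INR k + 8) by apply: Rinv_0_lt_compat; lra.
have := eventually_and (eventually_ln_ge (2 + 2 * ln (D * exp 1) + 2))
  (eventually_and (eventually_pow_le_exp 2 Rlt_0_1 dG)
  (eventually_and (eventually_pow_le_exp 2 Rlt_0_1 k4)
  (eventually_and (eventually_ln_ge 2)
   (eventually_lnln_pow 1 (Rinv_0_lt_compat _ (Rlt_le_trans _ _ _ Rlt_0_1 kp)))))).
apply: eventually_imp => n [lD [l2d [l2k [l2 lll]]]] K Y K2 KY ha.
set l := ln (INR n) in lD l2d l2k l2 lll *.
have L0 : 0 < ln (INR n) by rewrite -/l; lra.
have nE : exp l = INR n by apply: exp_ln_INR.
have np : 0 < INR n by rewrite -nE; apply: exp_pos.
rewrite Rmult_1_l nE in l2d l2k; rewrite pow_1 in lll.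
set q := edge_prob K Y; set x := xk K Y.
have q0 : 0 <= q := edge_prob_ge0 KY; have qx : q <= x := edge_prob_le_xk KY.
have m0 := Rmax_l 0 (ln (D / c)); have m1 := Rmax_r 0 (ln (D / c)).
have nq : INR n * q <= 2 * l.
  have : (INR k - 1) * ln l <= l.
    have [h|h] := Rle_lt_dec (ln l) 0; first by nra.
    have : INR k * ln l <= INR k * (/ INR k * l) by apply: Rmult_le_compat_l; lra.
    rewrite -Rmult_assoc Rinv_r ?Rmult_1_l; last by lra.
    by lra.
  by move: ha; rewrite /alpha -/q -/l; lra.
have lsq : l <= l ^ 2 by nra.
have l2n : (4 * INR k + 8) * l ^ 2 <= INR n.
  have := Rmult_le_compat_l (4 * INR k + 8) _ _ ltac:(lra) l2k.
  by rewrite -Rmult_assoc Rinv_r ?Rmult_1_l; lra.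
have n12 : 12 * l <= INR n by nra.
have nk2 : 4 * INR k + 8 <= INR n by nra.
have q6 : q <= / 6 by apply: (Rmult_le_reg_l (INR n)) => //; lra.
have Y0 : (0 < Y)%N by lia.
have Yp : 0 < INR Y by apply: lt_0_INR; lia.
have Kp : 2 <= INR K by have := le_INR' K2; rewrite /=; lra.
have xp : 0 < x.
  by rewrite /x /xk; repeat apply: Rmult_lt_0_compat; try lra; apply: Rinv_0_lt_compat.
have K0 : (0 < K)%N by lia.
have [xq2 x2q] := @xk_le_edge_prob K Y K0 KY ltac:(rewrite -/q; lra).
rewrite -/q -/x in xq2 x2q; have qp : 0 < q by lra.
have n1 : (1 < n)%N by apply/ltP; apply: INR_lt; rewrite /=; lra.
have n0 : (0 < n)%N by lia.
have kn : (k <= n)%N by apply/leP; apply: INR_le; lra.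
have nkE : INR (n - k) = INR n - INR k by rewrite minus_INR; [ | lia].
pose z := INR (n - k) * q; have z0 : 0 < z by apply: Rmult_lt_0_compat => //; rewrite nkE; lra.
have zh : INR n * q / 2 <= z by rewrite /z nkE; nra.
pose b := low_prob_lb n K Y k.
have hexp : exp (- (INR n * (q + q ^ 2))) <= (1 - q) ^ n by apply: exp_le_pow1B; lra.
have nq2 : INR n * q ^ 2 <= 4 * l ^ 2 / INR n.
  apply: (Rmult_le_reg_l (INR n)) => //.
  have -> : INR n * (INR n * q ^ 2) = (INR n * q) ^ 2 by ring.
  have -> : INR n * (4 * l ^ 2 / INR n) = (2 * l) ^ 2 by field; lra.
  by apply: pow_incr; split => //; apply: Rmult_le_pos; lra.
have l2n1 : 4 * l ^ 2 / INR n <= 1.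
  apply: (Rmult_le_reg_r (INR n)) => //; rewrite /Rdiv Rmult_assoc Rinv_l; last by lra.
  by have := pow2_ge_0 l; nra.
have pz := poisson_sum_ge1 k0 (Rlt_le _ _ z0).
have be : poisson_sum k z * exp (- (INR n * (q + q ^ 2))) <= b.
  by rewrite /b /low_prob_lb -/q -/z; apply: Rmult_le_compat_l; lra.
have bp : 0 < b.
  by apply: Rlt_le_trans be; apply: Rmult_lt_0_compat; [lra | apply: exp_pos].
have be' : poisson_sum k z * (exp (- (INR n * q)) * exp (- 1)) <= b.
  apply: Rle_trans be; apply: Rmult_le_compat_l; first by lra.
  by rewrite -exp_plus; apply: exp_le; lra.
have nb : D <= INR n * b.
  apply: Rle_trans (Rmult_le_compat_l _ _ _ (Rlt_le _ _ np) be').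
  (* For n q <= l / 2 the exponential alone keeps n b of order n ^ (1/2) at least. Otherwise the
     last Poisson term is comparable with l ^ (k - 1) and [exp_alpha] applies. *)
  have [small|big] := Rle_lt_dec (INR n * q) (l / 2).
    apply: Rle_trans (_ : INR n * (exp (- (l / 2)) * exp (- 1)) <= _).
      rewrite -nE -!exp_plus.
      have : exp (ln (D * exp 1)) <= exp (l / 2) by apply: exp_le; lra.
      rewrite exp_ln; last by apply: Rmult_lt_0_compat => //; apply: exp_pos.
      have -> : l + (- (l / 2) + - 1) = l / 2 + - (1) by field.
      rewrite exp_plus exp_Ropp => h.
      apply: (Rmult_le_reg_r (exp 1)); first exact: exp_pos.
      by rewrite Rmult_assoc Rinv_l; [lra | have := exp_pos 1; lra].
    apply: Rmult_le_compat_l; first by lra.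
    apply: Rle_trans (_ : 1 * (exp (- (INR n * q)) * exp (- 1)) <= _).
      rewrite Rmult_1_l; apply: Rmult_le_compat_r; first by left; apply: exp_pos.
      by apply: exp_le; lra.
    apply: Rmult_le_compat_r => //; left; apply: Rmult_lt_0_compat; apply: exp_pos.
  apply: Rle_trans (_ : c * exp (- alpha k n K Y) <= _).
    have : exp (ln (D / c)) <= exp (- alpha k n K Y) by apply: exp_le; lra.
    rewrite exp_ln; last by apply: Rmult_lt_0_compat => //; apply: Rinv_0_lt_compat.
    move=> h; have := Rmult_le_compat_l _ _ _ (Rlt_le _ _ c0) h.
    by have -> : c * (D / c) = D by field; lra.
  rewrite -(exp_alpha K Y L0 k0) -/l -/q.
  apply: Rle_trans (_ : INR n * ((l / 4) ^ k.-1 / F * (exp (- (INR n * q)) * exp (- 1))) <= _).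
    by right; rewrite /c (Rpow_mult_distr l); field; lra.
  apply: Rmult_le_compat_l; first by lra.
  apply: Rmult_le_compat_r; first by left; apply: Rmult_lt_0_compat; apply: exp_pos.
  apply: Rle_trans (poisson_sum_ge_last k0 (Rlt_le _ _ z0)).
  by apply: Rmult_le_compat_r; [lra | apply: pow_incr; lra].
apply: Rle_trans (rkg_prob_mindeg_le KY n0 n1 bp) _; rewrite -/b.
have t1 : INR k.+1 / (INR n * b) <= e / 2.
  have nb0 : 0 < INR n * b by apply: Rmult_lt_0_compat.
  apply: (Rmult_le_reg_r (INR n * b)) => //.
  rewrite /Rdiv (Rmult_assoc (INR k.+1)) Rinv_l ?Rmult_1_r; last by lra.
  have := Rmult_le_compat_l (e * / 2) _ _ ltac:(lra) nb.
  have -> : e * / 2 * D = INR k + 1 by rewrite /D; field; lra.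
  by rewrite S_INR.
have kk : (2 + 2 * k <= n)%N.
  by apply/leP; apply: INR_le; rewrite plus_INR INR_muln /=; lra.
have [lw0 lw] := low_weight_le K Y0 kk; rewrite -/x in lw.
(* The quotient collects x / q and n / (n - k), both close to 1; by [poisson_sum_scale] it costs
   only r ^ k. *)
pose r := INR n * x / z.
have rE : INR n * x = r * z by rewrite /r; field; lra.
have r1 : 1 <= r.
  apply: (Rmult_le_reg_r z) => //; rewrite -rE /z nkE; nra.
have rexp : r <= exp (2 * q + 2 * INR k / INR n).
  have h1 : INR n / (INR n - INR k) <= 1 + 2 * INR k / INR n.
    apply: (Rmult_le_reg_r (INR n - INR k)); first by lra.
    rewrite /Rdiv Rmult_assoc Rinv_l ?Rmult_1_r; last by lra.
    have : 0 <= INR k * / INR n * (INR n - 2 * INR k).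
      by apply: Rmult_le_pos; [apply: Rmult_le_pos; [lra | left; apply: Rinv_0_lt_compat] | lra].
    have -> : INR k * / INR n * (INR n - 2 * INR k) = INR k - 2 * INR k * INR k * / INR n by field; lra.
    have -> : (1 + 2 * INR k * / INR n) * (INR n - INR k) = INR n - INR k + 2 * INR k - 2 * INR k * INR k * / INR n by field; lra.
    lra.
  have h2 : x / q <= 1 + 2 * q.
    by apply: (Rmult_le_reg_r q) => //; rewrite /Rdiv Rmult_assoc Rinv_l; lra.
  have -> : r = x / q * (INR n / (INR n - INR k)) by rewrite /r /z nkE; field; lra.
  rewrite exp_plus; apply: Rmult_le_compat.
  - by left; apply: Rmult_lt_0_compat => //; apply: Rinv_0_lt_compat.
  - by left; apply: Rmult_lt_0_compat => //; apply: Rinv_0_lt_compat; lra.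
  - exact: Rle_trans h2 (exp_ge1 _).
  - exact: Rle_trans h1 (exp_ge1 _).
have ratio : low_weight n K Y k 2 / b <= exp d.
  apply: (Rmult_le_reg_r b) => //; rewrite /Rdiv Rmult_assoc Rinv_l ?Rmult_1_r; last by lra.
  apply: Rle_trans lw _; rewrite rE.
  apply: Rle_trans (_ : r ^ k * poisson_sum k z * (exp (- (r * z)) * exp (INR (2 + 2 * k) * x)) <= _).
    apply: Rmult_le_compat_r; first by left; apply: Rmult_lt_0_compat; apply: exp_pos.
    by apply: poisson_sum_scale; [lra | left].
  apply: Rle_trans (Rmult_le_compat_l _ _ _ (Rlt_le _ _ (exp_pos d)) be).
  rewrite -rE; have rk : r ^ k <= exp (INR k * (2 * q + 2 * INR k / INR n)).
    by rewrite -exp_pow; apply: pow_incr; lra.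
  apply: Rle_trans (_ : exp (INR k * (2 * q + 2 * INR k / INR n)) * poisson_sum k z *
     (exp (- (INR n * x)) * exp (INR (2 + 2 * k) * x)) <= _).
    apply: Rmult_le_compat_r; first by left; apply: Rmult_lt_0_compat; apply: exp_pos.
    by apply: Rmult_le_compat_r; lra.
  have -> : exp d * (poisson_sum k z * exp (- (INR n * (q + q ^ 2)))) =
     poisson_sum k z * exp (d + - (INR n * (q + q ^ 2))) by rewrite exp_plus; ring.
  have -> : exp (INR k * (2 * q + 2 * INR k / INR n)) * poisson_sum k z *
     (exp (- (INR n * x)) * exp (INR (2 + 2 * k) * x)) =
     poisson_sum k z * exp (INR k * (2 * q + 2 * INR k / INR n) + (- (INR n * x) + INR (2 + 2 * k) * x)).
    by rewrite !exp_plus; ring.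
  apply: Rmult_le_compat_l; first by lra.
  apply: exp_le; rewrite plus_INR INR_muln /=.
  have nx : INR n * q <= INR n * x by apply: Rmult_le_compat_l; lra.
  have qn : q <= 2 * l ^ 2 / INR n.
    apply: (Rmult_le_reg_l (INR n)) => //.
    have -> : INR n * (2 * l ^ 2 / INR n) = 2 * l ^ 2 by field; lra.
    lra.
  have kn' : INR k / INR n <= INR k * l ^ 2 / INR n.
    apply: Rmult_le_compat_r; first by left; apply: Rinv_0_lt_compat.
    by have := pow_R1_Rle l 2 ltac:(lra); nra.
  have fin : G * (l ^ 2 / INR n) <= d.
    apply: (Rmult_le_reg_r (INR n)) => //.
    have -> : G * (l ^ 2 / INR n) * INR n = G * l ^ 2 by field; lra.
    have := Rmult_le_compat_l _ _ _ (Rlt_le _ _ Gp) l2d.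
    have -> : G * (d / G * INR n) = d * INR n by field; lra.
    by [].
  have t : INR k * (2 * q) <= INR k * (2 * (2 * l ^ 2 / INR n)) by apply: Rmult_le_compat_l; lra.
  have t' : INR k * (INR k / INR n) <= INR k * (INR k * l ^ 2 / INR n) by apply: Rmult_le_compat_l; lra.
  have t'' : INR k * x <= INR k * (2 * (2 * l ^ 2 / INR n)) by apply: Rmult_le_compat_l; lra.
  have GE : G * (l ^ 2 / INR n) = 4 * (INR k * (l ^ 2 / INR n)) * 4 + 8 * (l ^ 2 / INR n) + 2 * (INR k * (INR k * l ^ 2 / INR n)).
    by rewrite /G; field; lra.
  have up : 0 <= l ^ 2 / INR n.
    by apply: Rmult_le_pos; [apply: pow2_ge_0 | left; apply: Rinv_0_lt_compat].
  have ku := Rmult_le_compat_r _ _ _ up kp.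
  rewrite GE in fin; rewrite /Rdiv /= in fin t t' t'' kn' qn nq2 up ku *; lra.
have sq : (low_weight n K Y k 2 / b) ^ 2 <= 1 + e / 2.
  apply: Rle_trans (_ : exp d ^ 2 <= _).
    apply: pow_incr; split => //; apply: Rmult_le_pos => //.
    by left; apply: Rinv_0_lt_compat.
  rewrite exp_pow /d /=; have -> : (1 + 1) * (ln (1 + e / 2) / 2) = ln (1 + e / 2) by field.
  by rewrite exp_ln; lra.
lra.
Qed.

End LowDegreeLimits.

(** * Convergence of elementary sequences *)

Section Limits.
Local Open Scope R_scope.

Lemma Un_cvP (u : nat -> R) (c : R) :
  Un_cv u c <-> (forall e, 0 < e -> eventually (fun n => Rabs (u n - c) < e)).
Proof.
split=> h e /h[N hN]; exists N => n Nn; apply: hN; lia.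
Qed.

Lemma Un_cv_eq (v u : nat -> R) (c : R) : eventually (fun n => u n = v n) -> Un_cv v c -> Un_cv u c.
Proof.
move=> E /Un_cvP h; apply/Un_cvP => e /h; move/(eventually_and E).
by apply: eventually_imp => n [-> ].
Qed.

Lemma Un_cv_squeeze (v w u : nat -> R) (c : R) :
  eventually (fun n => v n <= u n <= w n) -> Un_cv v c -> Un_cv w c -> Un_cv u c.
Proof.
move=> E /Un_cvP hv /Un_cvP hw; apply/Un_cvP => e ep.
have := eventually_and E (eventually_and (hv e ep) (hw e ep)).
apply: eventually_imp => n [[h1 h2] [h3 h4]].
apply: Rabs_def1; [have := Rle_abs (w n - c) | have := Rle_abs (- (v n - c)); rewrite Rabs_Ropp]; lra.
Qed.

Lemma Un_cv_const (c : R) : Un_cv (fun=> c) c.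
Proof. by apply/Un_cvP => e ep; apply: eventually_true => n; rewrite Rminus_diag Rabs_R0. Qed.

Lemma Un_cv_pow (u : nat -> R) (c : R) (m : nat) : Un_cv u c -> Un_cv (fun n => u n ^ m) (c ^ m).
Proof.
move=> h; elim: m => [|m IH]; first exact: (Un_cv_const 1).
by apply: (CV_mult _ _ _ _ h IH).
Qed.

Lemma Un_cv_exp (u : nat -> R) (c : R) : Un_cv u c -> Un_cv (fun n => exp (u n)) (exp c).
Proof. by apply: continuity_seq; apply: derivable_continuous_pt; apply: derivable_pt_exp. Qed.

Lemma Un_cv_scale (u : nat -> R) (c b : R) : Un_cv u c -> Un_cv (fun n => b * u n) (b * c).
Proof. exact: (CV_mult _ _ _ _ (Un_cv_const b)). Qed.

Lemma Un_cv_bounded (u : nat -> R) (c : R) : Un_cv u c -> eventually (fun n => Rabs (u n) <= Rabs c + 1).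
Proof.
move=> /Un_cvP /(_ 1 Rlt_0_1); apply: eventually_imp => n h.
by have := Rabs_triang (u n - c) c; rewrite (_ : u n - c + c = u n); [lra | ring].
Qed.

Lemma Un_cv_lt (u : nat -> R) (c b : R) : Un_cv u c -> c < b -> eventually (fun n => u n < b).
Proof.
move=> /Un_cvP h cb; have := h (b - c) ltac:(lra); apply: eventually_imp => n.
by have := Rle_abs (u n - c); lra.
Qed.

Lemma cv_inv_ln : Un_cv (fun n => / ln (INR n)) 0.
Proof.
apply/Un_cvP => e ep; apply: eventually_imp (eventually_ln_ge (/ e + 1)) => n h.
have ei := Rinv_0_lt_compat _ ep; have lp : 0 < ln (INR n) by lra.
rewrite Rminus_0_r Rabs_pos_eq; last by left; apply: Rinv_0_lt_compat.
by rewrite -(Rinv_inv e); apply: Rinv_lt_contravar; [apply: Rmult_lt_0_compat | lra].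
Qed.

Lemma cv_ln_pow_div (j : nat) : Un_cv (fun n => ln (INR n) ^ j / INR n) 0.
Proof.
apply/Un_cvP => e ep; have e2 : 0 < e / 2 by lra.
apply: eventually_imp (eventually_and (eventually_ln_ge 1) (eventually_pow_le_exp j Rlt_0_1 e2)) => n [l1].
rewrite Rmult_1_l exp_ln_INR; last by lra.
move=> h; have np : 0 < INR n by rewrite -exp_ln_INR; [apply: exp_pos | lra].
rewrite Rminus_0_r Rabs_pos_eq.
  apply: Rle_lt_trans (_ : e / 2 < e); last by lra.
  by apply: (Rmult_le_reg_r (INR n)) => //; rewrite /Rdiv Rmult_assoc Rinv_l; lra.
by apply: Rmult_le_pos; [apply: pow_le; lra | left; apply: Rinv_0_lt_compat].
Qed.

Lemma cv_inv_n : Un_cv (fun n => / INR n) 0.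
Proof.
by apply: Un_cv_eq (cv_ln_pow_div 0); apply: eventually_true => n; rewrite /= /Rdiv Rmult_1_l.
Qed.

Lemma cv_lnln : Un_cv (fun n => ln (ln (INR n)) / ln (INR n)) 0.
Proof.
apply/Un_cvP => e ep; have e2 : 0 < e / 2 by lra.
apply: eventually_imp (eventually_and (eventually_ln_ge 1) (eventually_lnln_pow 1 e2)) => n [l1].
rewrite pow_1 => h; have l0 : 0 <= ln (ln (INR n)).
  have [l1'|<-] := l1; [rewrite -ln_1; left; apply: ln_increasing; lra | rewrite ln_1; lra].
rewrite Rminus_0_r Rabs_pos_eq.
  apply: Rle_lt_trans (_ : e / 2 < e); last by lra.
  by apply: (Rmult_le_reg_r (ln (INR n))); first lra; rewrite /Rdiv Rmult_assoc Rinv_l; lra.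
by apply: Rmult_le_pos => //; left; apply: Rinv_0_lt_compat; lra.
Qed.

Lemma cv_bin (l : nat) : Un_cv (fun n => INR 'C(n, l) / INR n ^ l) (/ INR (l`!)).
Proof.
elim: l => [|l IH].
  apply: Un_cv_eq (Un_cv_const _); apply: eventually_true => n.
  by rewrite bin0 fact0 /=; field.
have h : Un_cv (fun n => / INR l.+1 * (INR 'C(n, l) / INR n ^ l * (1 - INR l * / INR n))) (/ INR (l.+1`!)).
  have -> : / INR (l.+1`!) = / INR l.+1 * (/ INR (l`!) * (1 - INR l * 0)).
    by rewrite factS INR_muln Rinv_mult; ring.
  apply: Un_cv_scale; apply: (CV_mult _ _ _ _ IH); apply: (CV_minus _ _ _ _ (Un_cv_const 1)).
  exact: Un_cv_scale cv_inv_n.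
apply: Un_cv_eq h; exists l.+1 => n ln.
have np : 0 < INR n by apply: lt_0_INR; lia.
have lp : 0 < INR l.+1 by apply: lt_0_INR; lia.
have E : INR l.+1 * INR 'C(n, l.+1) = (INR n - INR l) * INR 'C(n, l).
  by rewrite -minus_INR -?INR_muln; [rewrite mul_bin_left mulnC mulnC | lia].
have -> : INR 'C(n, l.+1) = (INR n - INR l) * INR 'C(n, l) * / INR l.+1.
  by rewrite -E; field; lra.
by rewrite -tech_pow_Rmult; field; repeat split; try lra; apply: pow_nonzero; lra.
Qed.

(** Only the last term, s = k - 1, survives: passing to it from the earlier partial sum introduces a
    factor 1 / l. *)
Lemma cv_poisson_sum (k : nat) (z l : nat -> R) : (0 < k)%N ->
  Un_cv (fun n => z n / l n) 1 -> Un_cv (fun n => / l n) 0 -> eventually (fun n => 0 < l n) ->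
  Un_cv (fun n => poisson_sum k (z n) / l n ^ k.-1) (/ INR ((k.-1)`!)).
Proof.
case: k => // k _ zl l0 lp; elim: k => [|k IH].
  apply: Un_cv_eq (Un_cv_const _); apply: eventually_true => n /=; field.
have h : Un_cv (fun n => poisson_sum k.+1 (z n) / l n ^ k * / l n + / INR (k.+1`!) * (z n / l n) ^ k.+1)
   (/ INR (k`!) * 0 + / INR (k.+1`!) * 1 ^ k.+1).
  apply: CV_plus; first exact: CV_mult IH l0.
  by apply: Un_cv_scale; apply: Un_cv_pow.
have <- : / INR (k`!) * 0 + / INR (k.+1`!) * 1 ^ k.+1 = / INR (k.+2.-1`!) by rewrite pow1 /=; ring.
apply: Un_cv_eq h; apply: eventually_imp lp => n lp.
have -> : poisson_sum k.+2 (z n) = poisson_sum k.+1 (z n) + z n ^ k.+1 / INR (k.+1`!) by [].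
have f0 : INR (k.+1`!) <> 0 by apply: Rgt_not_eq; apply: lt_0_INR; have := fact_gt0 k.+1; lia.
rewrite [k.+2.-1]/= -!(tech_pow_Rmult _ k) /Rdiv Rpow_mult_distr pow_inv.
by field; repeat split => //; try lra; apply: pow_nonzero; lra.
Qed.

End Limits.

(** * Factorial moments when alpha converges *)

Section PoissonLimit.
Local Open Scope R_scope.
Variables (k : nat) (X Y : nat -> nat) (a : R).
Hypotheses (k0 : (0 < k)%N) (KY : forall n, (X n <= Y n)%N)
  (X2 : eventually (fun n => (2 <= X n)%N)) (cva : Un_cv (fun n => alpha k n (X n) (Y n)) a).
Let q n := edge_prob (X n) (Y n).
Let x n := xk (X n) (Y n).
Let l n := ln (INR n).
Let la := exp (- a) / INR ((k.-1)`!).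

Lemma regime_of_cv : eventually (fun n => regime k 2 (Rabs a + 1) n (X n) (Y n)).
Proof.
have kp : 1 <= INR k by have := le_INR' k0; rewrite /=; lra.
have d : 0 < / (2 * INR k) by apply: Rinv_0_lt_compat; lra.
have := eventually_and X2 (eventually_and (Un_cv_bounded cva) (eventually_and
  (eventually_ln_ge (2 * (Rabs a + 1))) (eventually_lnln_pow 1 d))).
apply: eventually_imp => n [K2 [ab [l1]]]; rewrite pow_1 -/(l n) => ll.
have ap := Rabs_pos a; rewrite -/(l n) in l1.
have h1 := Rle_abs (alpha k n (X n) (Y n)); have h2 := Rle_abs (- alpha k n (X n) (Y n)).
rewrite Rabs_Ropp in h2.
have {}h1 : alpha k n (X n) (Y n) <= Rabs a + 1 by lra.
have {}h2 : - alpha k n (X n) (Y n) <= Rabs a + 1 by lra.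
split=> //; last by move: h2; rewrite /alpha -/(l n); lra.
have : (INR k - 1) * ln (l n) <= l n / 2.
  have [h|h] := Rle_lt_dec (ln (l n)) 0.
    by have := Rmult_le_compat_l (INR k - 1) _ _ ltac:(lra) h; lra.
  have : INR k * ln (l n) <= INR k * (/ (2 * INR k) * l n) by apply: Rmult_le_compat_l; lra.
  have -> : INR k * (/ (2 * INR k) * l n) = l n / 2 by field; lra.
  lra.
by move: h1; rewrite /alpha -/(l n); lra.
Qed.

Lemma eventually_ln_gt1 : eventually (fun n => 1 < l n /\ 0 < INR n).
Proof.
apply: eventually_imp (eventually_ln_ge 2) => n h; rewrite /l; split; first by lra.
by rewrite -exp_ln_INR; [apply: exp_pos | lra].
Qed.

Lemma cv_nq : Un_cv (fun n => INR n * q n / l n) 1.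
Proof.
have h : Un_cv (fun n => 1 + (INR k - 1) * (ln (l n) / l n) + alpha k n (X n) (Y n) * / l n)
   (1 + (INR k - 1) * 0 + a * 0).
  apply: CV_plus; last exact: CV_mult cva cv_inv_ln.
  by apply: CV_plus; [apply: Un_cv_const | apply: Un_cv_scale; apply: cv_lnln].
have <- : 1 + (INR k - 1) * 0 + a * 0 = 1 by ring.
apply: Un_cv_eq h; apply: eventually_imp eventually_ln_gt1 => n [h _].
by rewrite /alpha -/(q n) -/(l n); field; lra.
Qed.

Lemma cv_q : Un_cv q 0.
Proof.
have h := CV_mult _ _ _ _ cv_nq (cv_ln_pow_div 1); rewrite Rmult_0_r in h.
apply: Un_cv_eq h; apply: eventually_imp eventually_ln_gt1 => n [h n0].
by rewrite pow_1 -/(l n); field; lra.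
Qed.

Lemma cv_nq2 : Un_cv (fun n => INR n * q n ^ 2) 0.
Proof.
have h := CV_mult _ _ _ _ (Un_cv_pow 2 cv_nq) (cv_ln_pow_div 2); rewrite Rmult_0_r in h.
apply: Un_cv_eq h; apply: eventually_imp eventually_ln_gt1 => n [h n0].
by rewrite -/(l n); field; lra.
Qed.

Lemma xq_bounds : eventually (fun n => 0 <= q n <= x n /\ x n <= q n + 2 * q n ^ 2).
Proof.
have := eventually_and X2 (Un_cv_lt cv_q (Rinv_0_lt_compat _ Rlt_0_2)).
apply: eventually_imp => n [K2 q2]; have K0 : (0 < X n)%N by lia.
have [xq _] := xk_le_edge_prob K0 (KY n) (Rlt_le _ _ q2).
by split=> //; split; [apply: edge_prob_ge0 | apply: edge_prob_le_xk].
Qed.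

Lemma cv_x : Un_cv x 0.
Proof.
apply: (Un_cv_squeeze (v := q) (w := fun n => q n + 2 * q n ^ 2)).
- by apply: eventually_imp xq_bounds => n [[_ h1] h2].
- exact: cv_q.
have := CV_plus _ _ _ _ cv_q (Un_cv_scale 2 (Un_cv_pow 2 cv_q)).
by rewrite (_ : 0 + 2 * 0 ^ 2 = 0); [|ring].
Qed.

(** Permits replacing q by x inside exp (- n q), where a relative error would not be enough. *)
Lemma cv_nxq : Un_cv (fun n => INR n * x n - INR n * q n) 0.
Proof.
apply: (Un_cv_squeeze (v := fun=> 0) (w := fun n => 2 * (INR n * q n ^ 2))).
- apply: eventually_imp xq_bounds => n [[_ h1] h2]; have np := pos_INR n.
  by have := Rmult_le_compat_l _ _ _ np h1; have := Rmult_le_compat_l _ _ _ np h2; lra.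
- exact: Un_cv_const.
by have := Un_cv_scale 2 cv_nq2; rewrite Rmult_0_r.
Qed.

Lemma cv_nx : Un_cv (fun n => INR n * x n / l n) 1.
Proof.
have h := CV_plus _ _ _ _ cv_nq (CV_mult _ _ _ _ cv_nxq cv_inv_ln).
rewrite Rmult_0_r Rplus_0_r in h; apply: Un_cv_eq h; apply: eventually_true => n.
by rewrite -/(l n) /Rdiv; ring.
Qed.

Lemma cv_weight : Un_cv (fun n => INR n * exp (- (INR n * q n)) * l n ^ k.-1) (exp (- a)).
Proof.
apply: Un_cv_eq (Un_cv_exp (CV_opp _ _ cva)); apply: eventually_imp eventually_ln_gt1 => n [h _].
by rewrite -exp_alpha //; rewrite -/(l n); lra.
Qed.

(** n times the bound of [low_weight_le]; the last exponential accounts for the m + m k exempted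
    nodes and tends to 1. *)
Definition weight_up (m n : nat) : R :=
  INR n * (poisson_sum k (INR n * x n) * (exp (- (INR n * x n)) * exp (INR (m + m * k) * x n))).

Lemma cv_weight_up (m : nat) : Un_cv (weight_up m) la.
Proof.
have lp : eventually (fun n => 0 < l n) by apply: eventually_imp eventually_ln_gt1 => n [h _]; lra.
have p := cv_poisson_sum k0 cv_nx cv_inv_ln lp.
have d : Un_cv (fun n => exp (- (INR n * x n - INR n * q n))) (exp (- 0)).
  by apply: Un_cv_exp; apply: CV_opp; apply: cv_nxq.
have e := Un_cv_exp (Un_cv_scale (INR (m + m * k)) cv_x).
have h := CV_mult _ _ _ _ (CV_mult _ _ _ _ p cv_weight) (CV_mult _ _ _ _ d e).
rewrite Rmult_0_r Ropp_0 exp_0 !Rmult_1_r in h.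
have -> : la = / INR ((k.-1)`!) * exp (- a) by rewrite /la /Rdiv Rmult_comm.
apply: Un_cv_eq h; apply: eventually_imp lp => n lp; rewrite /weight_up.
have -> : exp (- (INR n * x n)) = exp (- (INR n * q n)) * exp (- (INR n * x n - INR n * q n)).
  by rewrite -exp_plus; f_equal; ring.
by field; apply: pow_nonzero; lra.
Qed.

Lemma bin_weight_le (m n : nat) (w u : R) : 0 <= w -> INR n * w <= u ->
  INR 'C(n, m) * w ^ m <= u ^ m * / INR (m`!).
Proof.
move=> w0 wu; have fp : 0 < INR (m`!) by apply: lt_0_INR; have := fact_gt0 m; lia.
apply: (Rmult_le_reg_r (INR (m`!))) => //; rewrite [X in _ <= X]Rmult_assoc Rinv_l ?Rmult_1_r; last by lra.
apply: Rle_trans (_ : (INR n * w) ^ m <= _); last first.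
  by apply: pow_incr; split => //; apply: Rmult_le_pos => //; apply: pos_INR.
rewrite Rpow_mult_distr; have := Rmult_le_compat_r _ _ _ (pow_le w m w0) (bin_le_pow n m); lra.
Qed.

Definition low_up (m n : nat) : R := weight_up m n ^ m * / INR (m`!).

Lemma low_weight_up (m : nat) : eventually (fun n =>
  INR 'C(n, m) * low_weight n (X n) (Y n) k m ^ m <= low_up m n).
Proof.
have [N hN] := X2; exists (maxn N (m + m * k)) => n nN.
have Y0 : (0 < Y n)%N by have := KY n; have := hN n ltac:(lia); lia.
have mn : (m + m * k <= n)%N by lia.
have [w0 w1] := low_weight_le (X n) Y0 mn.
apply: bin_weight_le => //; apply: Rmult_le_compat_l => //; exact: pos_INR.
Qed.

Lemma cv_low_up (m : nat) : Un_cv (low_up m) (la ^ m / INR (m`!)).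
Proof.
by apply: CV_mult; [apply: Un_cv_pow; apply: cv_weight_up | apply: Un_cv_const].
Qed.

(** An edge among the m nodes contributes at most m ^ 2 n ^ m [edge_term], the quantity already
    shown to vanish for small components, now with at most m k outside neighbours. For m <= 1 there
    is no pair. *)
Lemma low_tuples_up (m : nat) (e : R) : 0 < e ->
  eventually (fun n => low_tuples n (X n) (Y n) k m <= low_up m n + e).
Proof.
move=> ep; have [m1|m2] := leqP m 1.
  apply: eventually_imp (low_weight_up m) => n h.
  by have := @low_tuples_le1 n (X n) (Y n) k (KY n) m m1; lra.
have [t [e0 [t0 t1 e00 edge]]] := edge_term_small (Rabs a + 1) k0 (ltac:(lra) : 1 <= 2) m2.
have mp : 0 < INR m ^ 2 by apply: pow_lt; apply: lt_0_INR; lia.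
have e1 : 0 < e / INR m ^ 2 by apply: Rmult_lt_0_compat => //; apply: Rinv_0_lt_compat.
have := eventually_and (edge _ e1) (eventually_and regime_of_cv (eventually_and (low_weight_up m)
  (eventually_and X2 (eventually_ln_ge (INR (m * k) / e0))))).
apply: eventually_imp => n [ed [reg [lw [K2 l0]]]]; have [lx hm] := ed _ _ reg.
have K0 : (0 < X n)%N by lia.
have le := @low_tuples_le n (X n) (Y n) k (KY n) m t K0 t0 t1 lx.
have h : INR (m * k) <= e0 * ln (INR n).
  have := Rmult_le_compat_l e0 _ _ ltac:(lra) l0.
  have -> : e0 * (INR (m * k) / e0) = INR (m * k) by field; lra.
  lra.
have := hm _ h; rewrite -/(edge_term n (X n) (Y n) m (m * k) t) in le.
set E := edge_term _ _ _ _ _ _ in le *; move=> Ee.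
apply: Rle_trans le _; rewrite Rmult_plus_distr_l; apply: Rplus_le_compat => //.
have Y0 : (0 < Y n)%N by have := KY n; lia.
have a0 := av_ge0 (X n) (n - m) Y0.
have xp : 0 <= xk (X n) (Y n).
  by repeat apply: Rmult_le_pos; try apply: pos_INR; left; apply: Rinv_0_lt_compat; apply: lt_0_INR; lia.
have yp : 0 <= yk (X n) (Y n).
  by apply: Rmult_le_pos; [apply: pos_INR | left; apply: Rinv_0_lt_compat; apply: lt_0_INR; lia].
have mp' := pos_INR m.
have E0 : 0 <= E.
  have tx : 0 <= 2 * INR m * t * xk (X n) (Y n) by apply: Rmult_le_pos => //; apply: Rmult_le_pos; lra.
  have my := Rmult_le_pos _ _ mp' yp.
  rewrite /E /edge_term; apply: Rmult_le_pos; [|apply: Rmult_le_pos; [apply: Rmult_le_pos; [|apply: Rmult_le_pos] |]];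
    try by [apply: pow_le; lra | lra].
  apply: Rmult_le_pos; last by apply: pow_le; lra.
  by left; apply: Rinv_0_lt_compat; apply: pow_lt.
have bl : INR 'C(n, m) <= INR n ^ m.
  have f1 : 1 <= INR (m`!) by have := le_INR' (fact_gt0 m); rewrite /=; lra.
  have := bin_le_pow n m; have := Rmult_le_compat_l _ _ _ (pos_INR 'C(n, m)) f1; lra.
apply: Rle_trans (_ : INR m ^ 2 * (INR n ^ m * E) <= _).
  have := Rmult_le_compat_r (INR m ^ 2 * E) _ _ (Rmult_le_pos _ _ (Rlt_le _ _ mp) E0) bl; lra.
have := Rmult_le_compat_l _ _ _ (Rlt_le _ _ mp) Ee.
have -> : INR m ^ 2 * (e / INR m ^ 2) = e by rewrite /Rdiv Rmult_comm Rmult_assoc Rinv_l; lra.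
by [].
Qed.

(** The bound of [low_tuples_ge] regrouped into convergent factors. The factor with q + 4 (q ^ 2 + q
    ^ 3) bounds (q - m x ^ 2) / q by x <= q + 2 q ^ 2, and the last exponential comes from
    [exp_le_pow1B] at u = m q. *)
Definition low_dn (m n : nat) : R :=
  (INR 'C(n, m) / INR n ^ m) * (INR 'C(n, k.-1) / INR n ^ k.-1) ^ m *
  ((1 - INR (m ^ 2 * k.-1) * / INR n - INR (m ^ 2 * k.-1 ^ 2) * / INR n) *
   (1 - INR (m ^ 2) * x n)) *
  ((1 - INR m * (q n + 4 * (q n ^ 2 + q n ^ 3))) ^ (m * k.-1) *
   ((INR n * q n / l n) ^ (m * k.-1) *
    ((INR n * exp (- (INR n * q n)) * l n ^ k.-1) ^ m * exp (- (INR m ^ 2 * (INR n * q n ^ 2)))))).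

Lemma cv_low_dn (m : nat) : Un_cv (low_dn m) (la ^ m / INR (m`!)).
Proof.
have b := CV_mult _ _ _ _ (cv_bin m) (Un_cv_pow m (cv_bin k.-1)).
have cst c (u : nat -> R) : Un_cv u 0 -> Un_cv (fun n => c * u n) 0.
  by move=> h; have := Un_cv_scale c h; rewrite Rmult_0_r.
have g : Un_cv (fun n => 1 - INR (m ^ 2 * k.-1) * / INR n - INR (m ^ 2 * k.-1 ^ 2) * / INR n) (1 - 0 - 0).
  by apply: CV_minus; [apply: CV_minus; [apply: Un_cv_const|] |]; apply: cst; apply: cv_inv_n.
have d : Un_cv (fun n => 1 - INR (m ^ 2) * x n) (1 - 0).
  by apply: CV_minus; [apply: Un_cv_const | apply: cst; apply: cv_x].
have r : Un_cv (fun n => 1 - INR m * (q n + 4 * (q n ^ 2 + q n ^ 3))) (1 - 0).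
  apply: CV_minus; first exact: Un_cv_const; apply: cst.
  have := CV_plus _ _ _ _ cv_q (Un_cv_scale 4 (CV_plus _ _ _ _ (Un_cv_pow 2 cv_q) (Un_cv_pow 3 cv_q))).
  by rewrite (_ : 0 + 4 * (0 ^ 2 + 0 ^ 3) = 0); [|ring].
have s : Un_cv (fun n => exp (- (INR m ^ 2 * (INR n * q n ^ 2)))) (exp (- 0)).
  by apply: Un_cv_exp; apply: CV_opp; apply: cst; apply: cv_nq2.
have := CV_mult _ _ _ _ (CV_mult _ _ _ _ b (CV_mult _ _ _ _ g d))
  (CV_mult _ _ _ _ (Un_cv_pow (m * k.-1) r) (CV_mult _ _ _ _ (Un_cv_pow (m * k.-1) cv_nq)
    (CV_mult _ _ _ _ (Un_cv_pow m cv_weight) s))).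
rewrite Ropp_0 exp_0 !Rminus_0_r !pow1 !Rmult_1_r !Rmult_1_l.
have -> : / INR m`! * (/ INR (k.-1)`!) ^ m * exp (- a) ^ m = la ^ m / INR m`!.
  by rewrite /la /Rdiv Rpow_mult_distr; ring.
by [].
Qed.

Lemma low_tuples_dn (m : nat) :
  eventually (fun n => low_dn m n <= low_tuples n (X n) (Y n) k m).
Proof.
have d0 : 0 < / (4 * (INR m + 1) ^ 2).
  by apply: Rinv_0_lt_compat; have := pow_lt (INR m + 1) 2; have := pos_INR m; nra.
have c0 : 0 < / (INR (m ^ 2 * k.-1) + INR (m ^ 2 * k.-1 ^ 2) + 1).
  by apply: Rinv_0_lt_compat; have := pos_INR (m ^ 2 * k.-1); have := pos_INR (m ^ 2 * k.-1 ^ 2); lra.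
have := eventually_and eventually_ln_gt1 (eventually_and xq_bounds (eventually_and (Un_cv_lt cv_x d0)
  (eventually_and (Un_cv_lt cv_inv_n c0) (eventually_and (ex_intro _ k (fun n h => h)) X2)))).
apply: eventually_imp => n [[l1 np] [[[q0 qx] xq] [xs [ns [kn K2]]]]].
set Q := q n in q0 qx xq *; set Z := x n in qx xq xs *.
have mp := pos_INR m; have m1 : INR m <= (INR m + 1) ^ 2 by nra.
have m2 : INR m ^ 2 <= (INR m + 1) ^ 2 by nra.
have m3 : 1 <= (INR m + 1) ^ 2 by nra.
have x4 : (INR m + 1) ^ 2 * Z <= / 4.
  have := Rmult_le_compat_l ((INR m + 1) ^ 2) _ _ ltac:(lra) (Rlt_le _ _ xs).
  have -> : (INR m + 1) ^ 2 * / (4 * (INR m + 1) ^ 2) = / 4 by field; lra.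
  lra.
have Z0 : 0 <= Z by lra.
have mZ : INR m * Z <= / 4 by have := Rmult_le_compat_r _ _ _ Z0 m1; lra.
have mmZ : INR m ^ 2 * Z <= / 4 by have := Rmult_le_compat_r _ _ _ Z0 m2; lra.
have Zs : Z <= / 4 by have := Rmult_le_compat_r _ _ _ Z0 m3; lra.
have mQ : 0 <= INR m * Q <= / 4.
  by split; [apply: Rmult_le_pos | have := Rmult_le_compat_l _ _ _ mp qx; lra].
have Q4 : Q + 2 * Q ^ 2 <= 2 * Q by nra.
have Z2 : Z ^ 2 <= Q * (Q + 4 * (Q ^ 2 + Q ^ 3)).
  apply: Rle_trans (_ : (Q + 2 * Q ^ 2) ^ 2 <= _); last by right; ring.
  by apply: pow_incr.
have Z2' : Q * (1 - INR m * (Q + 4 * (Q ^ 2 + Q ^ 3))) <= Q - INR m * Z ^ 2.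
  have := Rmult_le_compat_l _ _ _ mp Z2; lra.
have r0 : 0 <= 1 - INR m * (Q + 4 * (Q ^ 2 + Q ^ 3)).
  have h : Q + 4 * (Q ^ 2 + Q ^ 3) <= 4 * Q.
    have : Q ^ 2 <= Q / 4 by nra.
    have : Q ^ 3 <= Q / 16 by nra.
    lra.
  by have := Rmult_le_compat_l _ _ _ mp h; lra.
have h1 : 0 <= Q - INR m * Z ^ 2 by apply: Rle_trans Z2'; apply: Rmult_le_pos.
have mm : INR (m ^ 2) = INR m ^ 2 by rewrite INR_expn.
have h3 : 0 <= 1 - INR (m ^ 2) * Z by rewrite mm; lra.
have h2 : 0 <= 1 - INR m * Q by lra.
have h4 : 0 <= 1 - INR (m ^ 2 * k.-1) / INR n - INR (m ^ 2 * k.-1 ^ 2) / INR n.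
  have p1 := pos_INR (m ^ 2 * k.-1); have p2 := pos_INR (m ^ 2 * k.-1 ^ 2).
  set A := INR (m ^ 2 * k.-1) in c0 ns p1 *; set B := INR (m ^ 2 * k.-1 ^ 2) in c0 ns p2 *.
  have := Rmult_le_compat_l (A + B + 1) _ _ ltac:(lra) (Rlt_le _ _ ns).
  rewrite Rinv_r; last by lra.
  by have := Rinv_0_lt_compat _ np; rewrite /Rdiv; lra.
have kn' : (k.-1 <= n)%N by lia.
apply: Rle_trans (@low_tuples_ge n (X n) (Y n) k (KY n) k0 m kn' h1 h2 h3 h4).
rewrite /low_dn -/Q -/Z; set G := 1 - INR (m ^ 2 * k.-1) / INR n - _ in h4 *.
rewrite -!/(Rdiv _ (INR n)) -/G.
have e1 : exp (- (INR n * Q)) ^ m * exp (- (INR m ^ 2 * (INR n * Q ^ 2))) <= (1 - INR m * Q) ^ n.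
  apply: Rle_trans (exp_le_pow1B n mQ); right; rewrite exp_pow -exp_plus; f_equal; ring.
have e2 : (Q * (1 - INR m * (Q + 4 * (Q ^ 2 + Q ^ 3)))) ^ (m * k.-1) <= (Q - INR m * Z ^ 2) ^ (m * k.-1).
  by apply: pow_incr; split => //; apply: Rmult_le_pos.
have c1 : 0 <= INR 'C(n, m) * INR 'C(n, k.-1) ^ m.
  by apply: Rmult_le_pos; [apply: pos_INR | apply: pow_le; apply: pos_INR].
have p1 : 0 <= (Q * (1 - INR m * (Q + 4 * (Q ^ 2 + Q ^ 3)))) ^ (m * k.-1).
  by apply: pow_le; apply: Rmult_le_pos.
have p2 : 0 <= exp (- (INR n * Q)) ^ m * exp (- (INR m ^ 2 * (INR n * Q ^ 2))).
  by apply: Rmult_le_pos; [apply: pow_le |]; left; apply: exp_pos.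
have e3 := Rmult_le_compat _ _ _ _ p1 p2 e2 e1.
have GD : 0 <= INR 'C(n, m) * INR 'C(n, k.-1) ^ m * (G * (1 - INR (m ^ 2) * Z)).
  by apply: Rmult_le_pos => //; apply: Rmult_le_pos.
have := Rmult_le_compat_l _ _ _ GD e3; set W := _ * (_ * _) => hW.
change (xk (X n) (Y n)) with Z; change (edge_prob (X n) (Y n)) with Q; rewrite -/G.
apply: Rle_trans (_ : W <= _); last by apply: Rle_trans hW _; right; ring.
clear - np l1; right; rewrite /W.
rewrite /Rdiv !Rpow_mult_distr !pow_inv -!pow_mult (Nat.mul_comm k.-1 m).
have l0 : 0 < l n by lra.
have pn m' : INR n ^ m' <> 0 by apply: pow_nonzero; lra.
have pl m' : l n ^ m' <> 0 by apply: pow_nonzero; lra.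
rewrite multE; field; repeat split => //.
Qed.

Lemma cv_low_tuples (m : nat) : Un_cv (fun n => low_tuples n (X n) (Y n) k m) (la ^ m / INR (m`!)).
Proof.
apply/Un_cvP => e ep; have e2 : 0 < e / 2 by lra.
have /Un_cvP/(_ _ ep) dn := cv_low_dn m.
have /Un_cvP/(_ _ e2) up := cv_low_up m.
have := eventually_and (eventually_and (low_tuples_dn m) (low_tuples_up m e2)) (eventually_and dn up).
apply: eventually_imp => n [[h1 h2] [h3 h4]].
have := Rle_abs (low_up m n - la ^ m / INR (m`!)).
have := Rle_abs (- (low_dn m n - la ^ m / INR (m`!))); rewrite Rabs_Ropp.
by move=> *; apply: Rabs_def1; lra.
Qed.

End PoissonLimit.

(** * Bonferroni's inequalities in the limit *)

Section BonferroniLimit.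
Local Open Scope R_scope.

Lemma fact_factorial (m : nat) : Factorial.fact m = m`!.
Proof. by elim: m => //= m ->; rewrite factS. Qed.

Lemma exp_opp_series (la : R) :
  Un_cv (fun m => sum_f_R0 (fun l => (-1) ^ l * (la ^ l / INR (l`!))) m) (exp (- la)).
Proof.
have h : exp_in (- la) (exp (- la)) by rewrite /exp; case: (exist_exp _).
move=> eps ep; have [N hN] := h eps ep; exists N => m /hN.
rewrite (PartSum.sum_eq _ (fun l => (-1) ^ l * (la ^ l / INR (l`!)))) // => i _.
rewrite fact_factorial (_ : - la = -1 * la); last by ring.
by rewrite Rpow_mult_distr /Rdiv; ring.
Qed.

Lemma Un_cv_sum (F : nat -> nat -> R) (c : nat -> R) (m : nat) : (forall l, Un_cv (F l) (c l)) ->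
  Un_cv (fun n => sum_f_R0 (fun l => F l n) m) (sum_f_R0 c m).
Proof. by move=> h; elim: m => [|m IH]; [apply: h | apply: (CV_plus _ _ _ _ IH)]. Qed.

(** First m is fixed, then n is large: a quarter of e each goes to the remainder of the exponential
    series, to the term of index m + 1, to the convergence of the partial sum and to that of T at m
    + 1. *)
Lemma cv_bonferroni (p : nat -> R) (T : nat -> nat -> R) (la : R) :
  (forall l, Un_cv (T l) (la ^ l / INR (l`!))) ->
  (forall m n, Rabs (p n - sum_f_R0 (fun l => (-1) ^ l * T l n) m) <= T m.+1 n) ->
  Un_cv p (exp (- la)).
Proof.
move=> cvT hp; apply/Un_cvP => e ep; have e4 : 0 < e / 4 by lra.
have [N1 h1] := exp_opp_series la e4.
have [N2 h2] := cv_speed_pow_fact la _ e4.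
pose m := maxn N1 N2; have := h1 m ltac:(rewrite /m; lia); have := h2 m.+1 ltac:(rewrite /m; lia).
rewrite /Rdist Rminus_0_r fact_factorial => {}h2 {}h1.
have /Un_cvP/(_ _ e4) s := Un_cv_sum m (fun l => Un_cv_scale ((-1) ^ l) (cvT l)).
have /Un_cvP/(_ _ e4) t := cvT m.+1.
apply: eventually_imp (eventually_and s t) => n [{}s {}t].
have b := hp m n; set S := sum_f_R0 _ _ in s b; set S' := sum_f_R0 _ _ in s h1.
have b1 := Rabs_triang (p n - S) ((S - S') + (S' - exp (- la))).
have b2 := Rabs_triang (S - S') (S' - exp (- la)).
have b3 := Rle_abs (T m.+1 n - la ^ m.+1 / INR m.+1`!).
have b4 := Rle_abs (la ^ m.+1 / INR m.+1`!).
have -> : p n - exp (- la) = p n - S + (S - S' + (S' - exp (- la))) by ring.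
lra.
Qed.

Variables (k : nat) (X Y : nat -> nat) (a : R).
Hypotheses (k0 : (0 < k)%N) (KY : forall n, (X n <= Y n)%N)
  (X2 : eventually (fun n => (2 <= X n)%N)) (cva : Un_cv (fun n => alpha k n (X n) (Y n)) a).

Lemma cv_prob_mindeg : Un_cv (prob_mindeg k X Y) (exp (- (exp (- a) / INR ((k.-1)`!)))).
Proof.
apply: cv_bonferroni (cv_low_tuples k0 KY X2 cva) _ => m n.
exact: rkg_prob_mindeg_bonferroni.
Qed.

Lemma cv_prob_kconn : Un_cv (prob_kconn k X Y) (exp (- (exp (- a) / INR ((k.-1)`!)))).
Proof.
set L := exp _; apply/Un_cvP => e ep; have e2 : 0 < e / 2 by lra.
have /Un_cvP/(_ _ e2) s := cv_prob_mindeg; rewrite -/L in s.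
have close := mindeg_kconn_close (Rabs a + 1) k0 (ltac:(lra) : 1 <= 2) e2.
have := eventually_and (eventually_and s close) (eventually_and (regime_of_cv k0 KY X2 cva)
  (ex_intro _ k.+1 (fun n h => h) : eventually (fun n => (k < n)%N))).
apply: eventually_imp => n [[{}s cl] [/cl{}cl kn]].
have [le _] := prob_mindeg_sub_kconn 0 0 (KY n) kn.
have := Rle_abs (prob_mindeg k X Y n - L); have := Rle_abs (- (prob_mindeg k X Y n - L)).
rewrite Rabs_Ropp; move: s cl le; rewrite /prob_mindeg /prob_kconn => *.
by apply: Rabs_def1; lra.
Qed.

End BonferroniLimit.

(** * Large alpha and the reduction of dense graphs *)

Section Supercritical.
Local Open Scope R_scope.

Lemma rkg_prob_k_connected_pool (n Y m K k : nat) : (0 < m)%N -> (K <= Y)%N ->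
  rkg_prob K (fun f : key_assign n (m * Y) => k_connected (rkg_adj f) k) <=
  rkg_prob K (fun f : key_assign n Y => k_connected (rkg_adj f) k).
Proof.
move=> m0 KY; have KmY : (K <= m * Y)%N by rewrite (leq_trans KY) // leq_pmull.
by rewrite !rkg_probE //; apply/RleP; apply: prob_k_connected_pool.
Qed.

Lemma rkg_prob01 (n K Y : nat) (Q : key_assign n Y -> bool) : 0 <= rkg_prob K Q <= 1.
Proof.
rewrite /rkg_prob; set a := #|_|; set b := #|[set f : key_assign n Y | valid_assign K f]|.
have ab : INR a <= INR b.
  by apply: le_INR'; apply: subset_leq_card; apply/subsetP => f; rewrite !inE => /andP[].
have a0 := pos_INR a.
have [b0|b0] := posnP b.
  have -> : INR a = 0 by rewrite b0 /= in ab; lra.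
  by rewrite /Rdiv Rmult_0_l; lra.
have bp : 0 < INR b by apply: lt_0_INR; lia.
split; first by apply: Rmult_le_pos => //; left; apply: Rinv_0_lt_compat.
by apply: (Rmult_le_reg_r (INR b)) => //; rewrite /Rdiv Rmult_assoc Rinv_l; lra.
Qed.

Lemma kconn_prob_large (k : nat) (e : R) : (0 < k)%N -> 0 < e ->
  exists M : R, eventually (fun n => forall K Y, (2 <= K)%N -> (K <= Y)%N -> M <= alpha k n K Y ->
    1 - e <= rkg_prob K (fun f : key_assign n Y => k_connected (rkg_adj f) k)).
Proof.
move=> k0 ep; have kp : 1 <= INR k by have := le_INR' k0; rewrite /=; lra.
have C1 : 1 <= 60 by lra.
have [c [c0 fm]] := first_moment_bound 0 k0 C1.
have e2 : 0 < e / 2 by lra.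
(* Above ln (2 c / e) the first moment bound c exp (- alpha) is at most e / 2; M >= 0 gives the
   lower condition of [regime] with C = 0. *)
pose M := Rmax 0 (ln (2 * c / e)); exists M.
have cl := mindeg_kconn_close 0 k0 C1 e2.
have sparse : eventually (fun n => forall K Y, (2 <= K)%N -> (K <= Y)%N -> M <= alpha k n K Y ->
    INR n * edge_prob K Y <= 60 * ln (INR n) ->
    1 - e <= rkg_prob K (fun f : key_assign n Y => k_connected (rkg_adj f) k)).
  apply: eventually_imp (eventually_and fm cl) => n [{}fm {}cl] K Y K2 KY Ma nq.
  have m0 := Rmax_l 0 (ln (2 * c / e)); have m1 := Rmax_r 0 (ln (2 * c / e)); rewrite -/M in m0 m1.
  have reg : regime k 60 0 n K Y by split => //; move: m0 Ma; rewrite /alpha; lra.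
  have h1 := fm _ _ reg; have h2 := cl _ _ reg.
  have h3 := @rkg_prob_mindeg_ge n K Y k KY.
  have h4 : c * exp (- alpha k n K Y) <= e / 2.
    apply: Rle_trans (_ : c * exp (- ln (2 * c / e)) <= _).
      by apply: Rmult_le_compat_l; [lra | apply: exp_le; lra].
    rewrite exp_Ropp exp_ln; first by right; field; lra.
    by apply: Rmult_lt_0_compat; [lra | apply: Rinv_0_lt_compat].
  by lra.
have d : 0 < / (2 * INR k) by apply: Rinv_0_lt_compat; lra.
have d' : 0 < / 120 by lra.
have := eventually_and sparse (eventually_and (eventually_ln_ge (Rmax 1 M))
  (eventually_and (eventually_pow_le_exp 1 Rlt_0_1 d') (eventually_lnln_pow 1 d))).
apply: eventually_imp => n [{}sparse [lM [ln_n]]]; rewrite pow_1 Rmult_1_l in ln_n *.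
have l1 := Rmax_l 1 M; have l2 := Rmax_r 1 M; rewrite exp_ln_INR in ln_n; last by lra.
set l := ln (INR n) in sparse lM ln_n *; rewrite pow_1 => ll K Y K2 KY Ma.
have [nq|nq] := Rle_lt_dec (INR n * edge_prob K Y) (60 * l); first exact: sparse.
have np : 0 < INR n by lra.
have qx := Rmult_le_compat_l _ _ _ (Rlt_le _ _ np) (edge_prob_le_xk KY).
(* With w = n x / (30 l) > 1 and m its integer part, w / m lies between 1 and 2. Splitting each key
   into m divides x by m and brings n x between 30 l and 60 l; since x <= 2 q, the new n q is at
   least 15 l, so alpha stays above M. *)
set x := xk K Y in qx; have [w1 w2] := nfloorP (ltac:(by apply: Rmult_le_pos; [lra | left; apply: Rinv_0_lt_compat; lra]) : 0 <= INR n * x / (30 * l)).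
set w := INR n * x / _ in w1 w2; set m := nfloor w in w1 w2.
have nx : INR n * x = 30 * l * w by rewrite /w; field; lra.
have w3 : 1 < w by apply: (Rmult_lt_reg_l (30 * l)); lra.
have m0 : (0 < m)%N by apply/ltP; apply: INR_lt; rewrite /=; lra.
have mp : 1 <= INR m by have := le_INR' m0; rewrite /=; lra.
apply: Rle_trans (rkg_prob_k_connected_pool n k m0 KY).
have KmY : (K <= m * Y)%N by rewrite (leq_trans KY) // leq_pmull.
have Yp : 0 < INR Y by apply: lt_0_INR; lia.
have xE : INR n * xk K (m * Y) = 30 * l * (w / INR m).
  have -> : xk K (m * Y) = x / INR m by rewrite /x /xk INR_muln; field; lra.
  by rewrite /Rdiv -Rmult_assoc nx; ring.
have wm : 1 <= w / INR m <= 2.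
  clear -w1 w2 mp w3; clearbody w m.
  by split; apply: (Rmult_le_reg_r (INR m)); rewrite /Rdiv ?Rmult_assoc ?Rinv_l; lra.
have x1 : 30 * l <= INR n * xk K (m * Y).
  by rewrite xE; have := Rmult_le_compat_l (30 * l) _ _ ltac:(lra) (proj1 wm); lra.
have x2 : INR n * xk K (m * Y) <= 60 * l.
  by rewrite xE; have := Rmult_le_compat_l (30 * l) _ _ ltac:(lra) (proj2 wm); lra.
have q2 := edge_prob_le_xk KmY.
have q3 : edge_prob K (m * Y) <= / 2.
  by apply: Rle_trans q2 _; apply: (Rmult_le_reg_l (INR n)); lra.
have K0 : (0 < K)%N by lia.
have [_ x3] := xk_le_edge_prob K0 KmY q3.
have nq2 := Rmult_le_compat_l _ _ _ (Rlt_le _ _ np) q2.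
have nq3 := Rmult_le_compat_l _ _ _ (Rlt_le _ _ np) x3.
apply: sparse => //; last by lra.
have : (INR k - 1) * ln l <= l / 2.
  have [h|h] := Rle_lt_dec (ln l) 0.
    by have := Rmult_le_compat_l (INR k - 1) _ _ ltac:(lra) h; lra.
  have : INR k * ln l <= INR k * (/ (2 * INR k) * l) by apply: Rmult_le_compat_l; lra.
  have -> : INR k * (/ (2 * INR k) * l) = l / 2 by field; lra.
  lra.
by rewrite /alpha -/l; lra.
Qed.

End Supercritical.

(** * The three cases for the limit of alpha *)

Theorem theorem1 (k : nat) (X Y : nat -> nat)
  (hk : (1 <= k)%N)
  (hXY : forall n : nat, (1 <= X n)%N /\ (X n <= Y n)%N)
  (hX2 : exists N : nat, forall n : nat, (N <= n)%N -> (2 <= X n)%N) :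
  (tends_to_minus_infty (alpha_seq k X Y) ->
     Un_cv (prob_kconn k X Y) (IZR 0) /\ Un_cv (prob_mindeg k X Y) (IZR 0)) /\
  (tends_to_plus_infty (alpha_seq k X Y) ->
     Un_cv (prob_kconn k X Y) (IZR 1) /\ Un_cv (prob_mindeg k X Y) (IZR 1)) /\
  (forall a : R, Un_cv (alpha_seq k X Y) a ->
     Un_cv (prob_kconn k X Y) (exp (Ropp (Rdiv (exp (Ropp a)) (INR ((k - 1)`!))))) /\
     Un_cv (prob_mindeg k X Y) (exp (Ropp (Rdiv (exp (Ropp a)) (INR ((k - 1)`!)))))).
Proof.
have KY n : (X n <= Y n)%N by case: (hXY n).
have le : eventually (fun n => Rle (prob_kconn k X Y n) (prob_mindeg k X Y n)).
  by exists k.+1 => n kn; case: (prob_mindeg_sub_kconn 0 0 (KY n) kn).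
have le1 n : Rle (prob_mindeg k X Y n) 1 := proj2 (rkg_prob01 _ _).
have ge0 n : Rle 0 (prob_kconn k X Y n) := proj1 (rkg_prob01 _ _).
have squeeze0 : Un_cv (prob_mindeg k X Y) 0 -> Un_cv (prob_kconn k X Y) 0.
  apply: Un_cv_squeeze (Un_cv_const 0).
  by apply: eventually_imp le => n.
have squeeze1 : Un_cv (prob_kconn k X Y) 1 -> Un_cv (prob_mindeg k X Y) 1.
  move=> h; apply: Un_cv_squeeze h (Un_cv_const 1).
  by apply: eventually_imp le => n.
split=> [h|].
  suff cv : Un_cv (prob_mindeg k X Y) 0 by split=> //; apply: squeeze0.
  apply/Un_cvP => e ep; have e2 : Rlt 0 (e / 2) by lra.
  have [M small] := mindeg_prob_small hk e2; have hM := h M.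
  apply: eventually_imp (eventually_and (eventually_and small hM) (eventually_and hX2 le)).
  move=> n [[{}small {}hM] [K2 {}le]].
  have := small _ _ K2 (KY n) (Rlt_le _ _ hM); rewrite -/(prob_mindeg k X Y n) => sm.
  by have g0 := ge0 n; apply: Rabs_def1; lra.
split=> [h|a cva]; last first.
  by rewrite subn1; split; [apply: cv_prob_kconn | apply: cv_prob_mindeg].
suff cv : Un_cv (prob_kconn k X Y) 1 by split=> //; apply: squeeze1.
apply/Un_cvP => e ep; have e2 : Rlt 0 (e / 2) by lra.
have [M large] := kconn_prob_large hk e2; have hM := h M.
apply: eventually_imp (eventually_and (eventually_and large hM) (eventually_and hX2 le)).
move=> n [[{}large {}hM] [K2 {}le]].
have := large _ _ K2 (KY n) (Rlt_le _ _ hM); rewrite -/(prob_kconn k X Y n) => lg.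
by have l1 := le1 n; apply: Rabs_def1; lra.
Qed.
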